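(* Let $M$ be a connected Riemann surface. For a null-torsion pseudoholomorphic curve $X:M\to\mathbf{CP}^3$ in the nearly Kähler $\mathbf{CP}^3$, let $Y:M\to\mathbb{CP}^3$ be the induced map $Y=\Pi_2\circ\hat X$, where $\hat X:M\to\mathbf{Fl}$ is the lift $\hat X(x)=(X(x),\,N_X(x)\otimes X(x))$ (all as defined in the context). Then the assignment $X\mapsto Y$ establishes a one-to-one correspondence between null-torsion pseudoholomorphic curves $X:M\to\mathbf{CP}^3$ and nonconstant holomorphic integrals $Y:M\to\mathbb{CP}^3$ of the holomorphic contact system $\mathbb V^*$ on $\mathbb{CP}^3$.
   Context: **Quaternions and frames.** $\mathbf H$ is the quaternions; each $q\in\mathbf H$ is uniquely $q=z+jw$ with $z,w\in\mathbf C$, $j^2=-1$, $zj=j\bar z$. $\mathbf H^2$ is a right $\mathbf H$-module, hence a right complex vector space, identified with $\mathbf C^4$ by $(z_1,z_2,z_3,z_4)\leftrightarrow(z_1+jz_2,z_3+jz_4)$. Put $\langle(q_1,q_2),(p_1,p_2)\rangle=\bar q_1p_1+\bar q_2p_2$. Let $\mathfrak F$ ($\cong Sp(2)$) be the set of pairs $f=(e_1,e_2)$ in $\mathbf H^2$ with $\langle e_1,e_1\rangle=\langle e_2,e_2\rangle=1$, $\langle e_1,e_2\rangle=0$. There are unique quaternion-valued 1-forms $\phi^b_a$ on $\mathfrak F$ with $de_a=e_b\phi^b_a$; they satisfy $d\phi^a_b+\phi^a_c\wedge\phi^c_b=0$, $\phi^a_b+\overline{\phi^b_a}=0$. Write $$\phi^1_1=i\rho_1+j\overline{\omega_3},\quad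 \phi^1_2=-\tfrac{\overline{\omega_1}}{\sqrt2}+j\tfrac{\omega_2}{\sqrt2},\quad \phi^2_1=\tfrac{\omega_1}{\sqrt2}+j\tfrac{\omega_2}{\sqrt2},\quad \phi^2_2=i\rho_2+j\tau,$$ with $\rho_1,\rho_2$ real and $\omega_1,\omega_2,\omega_3,\tau$ complex-valued 1-forms. Set $\kappa_{1\bar1}=i(\rho_2-\rho_1)$, $\kappa_{1\bar2}=-\bar\tau$, $\kappa_{2\bar1}=\tau$, $\kappa_{2\bar2}=-i(\rho_1+\rho_2)$, $\kappa_{3\bar3}=2i\rho_1$. **Nearly Kähler $\mathbf{CP}^3$.** The map $C_1:\mathfrak F\to\mathbf{CP}^3$, $f\mapsto e_1\mathbf C$, is an $S^1\times S^3$-bundle (action $(e_1,e_2)(z,q)=(e_1z,e_2q)$). $\mathbf{CP}^3$ denotes the complex projective 3-space with the (nonintegrable) nearly Kähler almost Hermitian structure for which $\omega_1,\omega_2,\omega_3$ are unitary and of type $(1,0)$. For $f\in\mathfrak F$, $f_{\bar1},f_{\bar2},f_{\bar3}$ denotes the basis of the complex tangent space of $\mathbf{CP}^3$ at $C_1(f)$ dual to $\omega_1,\omega_2,\omega_3$. Then $T\mathbf{CP}^3=\mathcal H\oplus\mathcal V$, with $\mathcal H$ (rank 2) spanned by $f_{\bar1},f_{\bar2}$ and $\mathcal V$ (rank 1, tangent to the fibers of $v\mathbf C\mapsto v\mathbf H\in\mathbf{HP}^1$) spanned by $f_{\bar3}$. With $\epsilon$ the tautological line bundle (spanned by $e_1$)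 and $\tilde Q\subset\mathbf C^4$ the bundle spanned by $e_2,e_2j$ (the Hermitian complement of $e_1\mathbf H$), one has $\mathcal H\cong\epsilon^*\otimes\tilde Q$, with $f_{\bar1}\leftrightarrow\frac1{\sqrt2}e_1^*\otimes e_2$ and $f_{\bar2}\leftrightarrow\frac1{\sqrt2}e_1^*\otimes e_2j$. **Kähler $\mathbb{CP}^3$ and its contact system.** $\mathbb{CP}^3$ denotes complex projective 3-space with its usual integrable Kähler structure. Via $C_2:\mathfrak F\to\mathbb{CP}^3$, $f\mapsto e_2\mathbf C$, its $(1,0)$-forms are spanned by $\overline{\omega_1},\omega_2,\kappa_{2\bar1}$. $\mathbb V^*$ is the line subbundle of the $(1,0)$ cotangent bundle of $\mathbb{CP}^3$ locally spanned by $\kappa_{2\bar1}$ (pulled back via $C_2$); it is a holomorphic line bundle defining a holomorphic contact structure on $\mathbb{CP}^3$. A holomorphic integral of $\mathbb V^*$ is a holomorphic map $Y:M\to\mathbb{CP}^3$ with $Y^*\theta=0$ for all local sections $\theta$ of $\mathbb V^*$. **Flag manifold.** $\mathbf{Fl}=\mathfrak F/(U(1)\times U(1))$ is the set of pairs of complex lines $([e_1],[e_2])$ in $\mathbf C^4=\mathbf H^2$ with $\langle e_1,e_2\rangle=0$. $\Pi_1:\mathbf{Fl}\to\mathbf{CP}^3$ and $\Pi_2:\mathbf{Fl}\to\mathbb{CP}^3$ send $([e_1],[e_2])$ to $[e_1]$ and $[e_2]$ respectively. **Curves and null-torsion.** A pseudoholomorphic curve is a nonconstant map $X:M\to\mathbf{CP}^3$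 whose differential commutes with the almost complex structures. Let $\mathfrak F_X,\mathcal H_X$ be the pullbacks to $M$ of $\mathfrak F\to\mathbf{CP}^3$, $\mathcal H$; pulled-back forms keep their names. $\mathcal H_X$ carries the Hermitian connection $\nabla(f_{\bar i}s_i)=f_{\bar i}\otimes(ds_i+\kappa_{i\bar j}s_j)$ ($i,j\in\{1,2\}$) and the induced holomorphic structure $\bar\partial=\nabla^{0,1}$. $T^*M$ is the holomorphic line bundle of $(1,0)$-forms. $\mathbf I_1=f_{\bar1}\otimes\omega_1+f_{\bar2}\otimes\omega_2$ is a holomorphic section of $\mathcal H_X\otimes T^*M$. Suppose $\mathbf I_1\not\equiv0$. There is a unique holomorphic line subbundle $L\subset\mathcal H_X$ such that $\mathbf I_1$ is a section of $L\otimes T^*M$; put $N_X=\mathcal H_X/L$. Let $\mathfrak F_X^{(1)}\subset\mathfrak F_X$ be the $U(1)\times U(1)$-subbundle of those $(x,f)$ with $f_{\bar2}\in L_x$; on it $\omega_1=0$ and $\kappa_{1\bar2}$ is of type $(1,0)$. Let $(f_{\bar1})$ be the class of $f_{\bar1}$ in $N_X$, $f_2$ the dual of $f_{\bar2}$, and $\mathbf{II}=(f_{\bar1})\otimes f_2\otimes\kappa_{1\bar2}$, a section of $N_X\otimes L^*\otimes T^*M$. $X$ has *null-torsion* if $\mathbf I_1\not\equiv0$ and $\mathbf{II}\equiv0$. **The lift.** For $X$ with $\mathbf I_1\not\equiv0$, identify $N_X$ with the Hermitian orthogonal complement of $L$ in $\mathcal H_X\cong X^*(\epsilon^*\otimes\tilde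 Q)\subset X^*(\epsilon^* )\otimes\mathbf C^4$. Tensoring with $X^*\epsilon$ and contracting $\epsilon\otimes\epsilon^*=\mathbf C$, $N_X(x)\otimes X(x)$ becomes a complex line in $\mathbf C^4$, Hermitian orthogonal to $X(x)$ and $X(x)j$; for $(x,f)\in\mathfrak F_X^{(1)}$ it is $[e_2]$. Hence $\hat X(x)=(X(x),N_X(x)\otimes X(x))\in\mathbf{Fl}$ is well defined. *)

(* Defs.v *)
From HB Require Import structures.
From mathcomp Require Import all_boot all_order all_algebra.
From mathcomp Require Import all_classical all_reals all_analysis.
From mathcomp Require Import complex.

Set Implicit Arguments.
Unset Strict Implicit.
Unset Printing Implicit Defensive.

Import Order.TTheory GRing.Theory Num.Theory.
Import numFieldNormedType.Exports.

Local Open Scope classical_set_scope.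
Local Open Scope ring_scope.
Local Open Scope complex_scope.

(* The pair [(z, w)] stands for z + jw, where zj = j(conj z). The ring product
   that MathComp puts on pairs is componentwise and is not the one of H; the
   addition is the right one. *)
Definition quat (R : realType) : Type := (R[i] * R[i])%type.

Definition qmul (R : realType) (p q : quat R) : quat R :=
  (p.1 * q.1 - p.2^* * q.2, p.1^* * q.2 + p.2 * q.1).

Definition qconj (R : realType) (q : quat R) : quat R := (q.1^*, - q.2).

Definition qone (R : realType) : quat R := (1, 0).

Definition qj (R : realType) : quat R := (0, 1).

(* (z1, z2, z3, z4) is identified with (z1 + j z2, z3 + j z4). Scaling by a
   complex number on the right is then the usual scaling of C^4. *)
Definition C4 (R : realType) : Type := 'rV[R[i]]_4.

Definition qfst (R : realType) (v : C4 R) : quat R :=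
  (v ord0 (inord 0), v ord0 (inord 1)).

Definition qsnd (R : realType) (v : C4 R) : quat R :=
  (v ord0 (inord 2), v ord0 (inord 3)).

Definition of_quats (R : realType) (p q : quat R) : C4 R :=
  \row_(k < 4) [:: p.1; p.2; q.1; q.2]`_k.

Definition qscale (R : realType) (v : C4 R) (q : quat R) : C4 R :=
  of_quats (qmul (qfst v) q) (qmul (qsnd v) q).

Definition qdot (R : realType) (v w : C4 R) : quat R :=
  qmul (qconj (qfst v)) (qfst w) + qmul (qconj (qsnd v)) (qsnd w).

Definition is_frame (R : realType) (f : C4 R * C4 R) : Prop :=
  [/\ qdot f.1 f.1 = qone R, qdot f.2 f.2 = qone R & qdot f.1 f.2 = 0].

(* Coordinate domains are subsets of [R * R], with (x, y) standing for x + iy. *)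
(* multiplication of a tangent vector of the plane by i *)
Definition iplane (R : realType) (u : R * R) : R * R := (- u.2, u.1).

(* D is meant to be open. *)
Definition smooth_on (R : realType) (D : set (R * R)) (g : R * R -> R) : Prop :=
  forall (us : seq (R * R)) (z : R * R), D z ->
    let h := foldr (fun u (k : R * R -> R) => fun y => 'D_u k y) g us in
    {for z, continuous h} /\ forall u, derivable h z u.

Definition csmooth_on (R : realType) (D : set (R * R)) (g : R * R -> R[i]) : Prop :=
  smooth_on D (fun z => complex.Re (g z)) /\ smooth_on D (fun z => complex.Im (g z)).

Definition cdiff (R : realType) (g : R * R -> R[i]) (z u : R * R) : R[i] :=
  ('D_u (fun y => complex.Re (g y)) z) +i* ('D_u (fun y => complex.Im (g y)) z).

Definition rsmooth_on (R : realType) n (D : set (R * R)) (g : R * R -> 'rV[R[i]]_n)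
  : Prop := forall k, csmooth_on D (fun z => g z ord0 k).

Definition rdiff (R : realType) n (g : R * R -> 'rV[R[i]]_n) (z u : R * R)
  : 'rV[R[i]]_n := \row_k cdiff (fun y => g y ord0 k) z u.

(* A complex-valued real linear form on the tangent plane is of type (1,0). *)
Definition type10 (R : realType) (alpha : R * R -> R[i]) : Prop :=
  forall u, alpha (iplane u) = 'i * alpha u.

Definition holomorphic_on (R : realType) (D : set (R * R)) (g : R * R -> R[i]) : Prop :=
  csmooth_on D g /\ forall z, D z -> type10 (cdiff g z).

(* For a frame field f = (e1, e2), d e_a = e_b phi^b_a means
   phi^b_a = <e_b, d e_a>, because the frames are orthonormal. *)
Section Forms.
Variable (R : realType) (f : R * R -> C4 R * C4 R) (z u : R * R).

Definition phi11 : quat R := qdot (f z).1 (rdiff (fun y => (f y).1) z u).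
Definition phi12 : quat R := qdot (f z).1 (rdiff (fun y => (f y).2) z u).
Definition phi21 : quat R := qdot (f z).2 (rdiff (fun y => (f y).1) z u).
Definition phi22 : quat R := qdot (f z).2 (rdiff (fun y => (f y).2) z u).

Definition rho1 : R := complex.Im phi11.1.
Definition rho2 : R := complex.Im phi22.1.
Definition omega1 : R[i] := (Num.sqrt 2)%:C * phi21.1.
Definition omega2 : R[i] := (Num.sqrt 2)%:C * phi21.2.
Definition omega3 : R[i] := (phi11.2)^*.
Definition tau : R[i] := phi22.2.

Definition kappa11 : R[i] := 'i * (rho2 - rho1)%:C.
Definition kappa12 : R[i] := - tau^*.
Definition kappa21 : R[i] := tau.
Definition kappa22 : R[i] := - ('i * (rho1 + rho2)%:C).

End Forms.

Definition CP3 (R : realType) : Type := {l : {vspace 'rV[R[i]]_4} | \dim l == 1%N}.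

Definition hconj (R : realType) m n (A : 'M[R[i]]_(m, n)) : 'M[R[i]]_(n, m) :=
  (map_mx (@conjc R) A)^T.

Definition hcompl (R : realType) m n (U : {vspace 'M[R[i]]_(m, n)})
  : {vspace 'M[R[i]]_(m, n)} :=
  (\bigcap_(B <- vbasis U) lker (linfun (fun A => \tr (A *m hconj B) : R[i]^o)))%VS.

(* The fibre of Q~ at the line l, i.e. the Hermitian complement of l H. *)
Definition Qtilde (R : realType) (l : CP3 R) : {vspace 'rV[R[i]]_4} :=
  hcompl (val l + <<[seq qscale v (qj R) | v <- vbasis (val l)]>>)%VS.

(* The fibre of H = epsilon^* (x) Q~ at l. Matrices act on row vectors from the
   right, epsilon^* is extended by 0 to the Hermitian complement of l, and
   so e^* (x) w is the matrix [hconj e *m w] when e is a unit vector of l. *)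
Definition horizontal (R : realType) (l : CP3 R) : {vspace 'M[R[i]]_4} :=
  <<[seq hconj v *m w | v <- vbasis (val l), w <- vbasis (Qtilde l)]>>%VS.

Definition fbar1 (R : realType) (f : C4 R * C4 R) : 'M[R[i]]_4 :=
  (Num.sqrt 2)^-1%:C *: (hconj f.1 *m f.2).

Definition fbar2 (R : realType) (f : C4 R * C4 R) : 'M[R[i]]_4 :=
  (Num.sqrt 2)^-1%:C *: (hconj f.1 *m qscale f.2 (qj R)).

Record chart (R : realType) (M : Type) : Type := Chart {
  cdom : set M;
  cmap : M -> R * R;
  cinv : R * R -> M }.

Definition cimg (R : realType) (M : Type) (c : chart R M) : set (R * R) :=
  cmap c @` cdom c.

Definition is_chart (R : realType) (M : topologicalType) (c : chart R M) : Prop :=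
  [/\ open (cdom c), open (cimg c),
      {in cdom c, cancel (cmap c) (cinv c)},
      {in cdom c, continuous (cmap c)}
    & {in cimg c, continuous (cinv c)}].

Definition compatible (R : realType) (M : Type) (c d : chart R M) : Prop :=
  holomorphic_on (cmap c @` (cdom c `&` cdom d))
    (fun z => let w := cmap d (cinv c z) in w.1 +i* w.2).

Record riemann_surface (R : realType) : Type := RiemannSurface {
  rs_space :> topologicalType;
  rs_hausdorff : hausdorff_space rs_space;
  atlas : set (chart R rs_space);
  atlas_chart : forall c, atlas c -> is_chart c;
  atlas_cover : forall x : rs_space, exists2 c, atlas c & cdom c x;
  atlas_compatible : forall c d, atlas c -> atlas d -> compatible c d }.

Section Maps.
Variables (R : realType) (M : riemann_surface R).
Implicit Types (X Y : M -> CP3 R) (c : chart R M) (W : set (R * R))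
  (f : R * R -> C4 R * C4 R) (L : M -> {vspace 'M[R[i]]_4}).

Definition nonconstant X : Prop := exists x y, X x <> X y.

(* [v] is a local expression of X in homogeneous coordinates, over the part W
   of the image of the chart c. *)
Definition homogeneous_lift X c W (v : R * R -> C4 R) : Prop :=
  [/\ atlas c, open W, W `<=` cimg c
    & forall z, W z -> val (X (cinv c z)) = <[v z]>%VS].

Definition smooth_map X : Prop :=
  forall x, exists c W v,
    [/\ homogeneous_lift X c W v, cdom c x, W (cmap c x) & rsmooth_on W v].

(* Holomorphic for the usual complex structure of projective space. *)
Definition holomorphic_map Y : Prop :=
  forall x, exists c W v,
    [/\ homogeneous_lift Y c W v, cdom c x, W (cmap c x)
      & forall k, holomorphic_on W (fun z => v z ord0 k)].

Definition frame_field W f : Prop :=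
  [/\ rsmooth_on W (fun z => (f z).1), rsmooth_on W (fun z => (f z).2)
    & forall z, W z -> is_frame (f z)].

(* Local sections of the pullbacks to M of C_1, C_2 : F -> CP^3. *)
Definition frame_along1 X c W f : Prop :=
  frame_field W f /\ homogeneous_lift X c W (fun z => (f z).1).

Definition frame_along2 Y c W f : Prop :=
  frame_field W f /\ homogeneous_lift Y c W (fun z => (f z).2).

(* The differential of X = C_1 o f, in coordinates with respect to the complex
   basis f_{bar 1}, f_{bar 2}, f_{bar 3} of the tangent space of CP^3 at C_1(f).
   By definition of the nearly Kaehler structure its almost complex structure
   is multiplication by i in these coordinates. *)
Definition dC1 f (z u : R * R) : 'rV[R[i]]_3 :=
  \row_(k < 3) [:: omega1 f z u; omega2 f z u; omega3 f z u]`_k.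

Definition pseudoholomorphic_curve X : Prop :=
  [/\ nonconstant X, smooth_map X
    & forall c W f, frame_along1 X c W f -> forall z, W z ->
        forall u, dC1 f z (iplane u) = 'i *: dC1 f z u].

Definition I1 f (z u : R * R) : 'M[R[i]]_4 :=
  omega1 f z u *: fbar1 (f z) + omega2 f z u *: fbar2 (f z).

Definition I1_nonzero X : Prop :=
  exists c W f z u, [/\ frame_along1 X c W f, W z & I1 f z u <> 0].

(* nabla (f_{bar i} s_i) = f_{bar i} (x) (d s_i + kappa_{i bar j} s_j), and a
   section is holomorphic when the (0,1) part of its derivative vanishes. *)
Definition holomorphic_section W f (s1 s2 : R * R -> R[i]) : Prop :=
  [/\ csmooth_on W s1, csmooth_on W s2
    & forall z, W z ->
        type10 (fun u => cdiff s1 z u + (kappa11 f z u * s1 z + kappa12 f z u * s2 z)) /\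
        type10 (fun u => cdiff s2 z u + (kappa21 f z u * s1 z + kappa22 f z u * s2 z))].

(* L is a holomorphic line subbundle of H_X: it is locally spanned by a nowhere
   vanishing holomorphic section of H_X. *)
Definition holomorphic_line_subbundle X L : Prop :=
  forall x, exists c W f s1 s2,
    [/\ frame_along1 X c W f, cdom c x, W (cmap c x), holomorphic_section W f s1 s2
      & forall z, W z -> (s1 z, s2 z) <> (0, 0) /\
          L (cinv c z) = <[s1 z *: fbar1 (f z) + s2 z *: fbar2 (f z)]>%VS].

Definition is_L X L : Prop :=
  holomorphic_line_subbundle X L /\
  forall c W f, frame_along1 X c W f -> forall z, W z ->
    forall u, I1 f z u \in L (cinv c z).

(* The local sections of F_X^(1). *)
Definition adapted_frame X L c W f : Prop :=
  frame_along1 X c W f /\ forall z, W z -> fbar2 (f z) \in L (cinv c z).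

(* The value on f_{bar 2} of II = (f_{bar 1}) (x) f_2 (x) kappa_{1 bar 2}, where
   N_X is identified with the Hermitian complement of L in H_X (f_{bar 1} is
   orthogonal to f_{bar 2}). As f_{bar 2} spans L, it determines II. *)
Definition II f (z u : R * R) : 'M[R[i]]_4 := kappa12 f z u *: fbar1 (f z).

Definition null_torsion X : Prop :=
  [/\ pseudoholomorphic_curve X, I1_nonzero X
    & exists2 L, is_L X L &
        forall c W f, adapted_frame X L c W f -> forall z, W z -> forall u, II f z u = 0].

(* The line bundle L of X; it is unique when I_1 is not identically 0. *)
Definition LX X : M -> {vspace 'M[R[i]]_4} := xget (fun=> 0%VS) (is_L X).

Definition NX X (x : M) : {vspace 'M[R[i]]_4} :=
  (horizontal (X x) :&: hcompl (LX X x))%VS.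

(* N_X(x) (x) X(x), contracted into C^4; it is a line as soon as L exists, and
   otherwise the point X x is used as a default value. *)
Definition NX_tensor_X X (x : M) : CP3 R :=
  insubd (X x) <<[seq v *m n | v <- vbasis (val (X x)), n <- vbasis (NX X x)]>>%VS.

End Maps.

(* Fl is a subset of the pairs of lines; Pi2 is the restriction to it of the
   second projection, and [hatX X x] lies in it when X is null-torsion. *)
Definition Fl (R : realType) : set (CP3 R * CP3 R) :=
  [set p : CP3 R * CP3 R |
    forall v w : C4 R, v \in val p.1 -> w \in val p.2 -> qdot v w = 0].

Definition Pi2 (R : realType) (p : CP3 R * CP3 R) : CP3 R := p.2.

Definition hatX (R : realType) (M : riemann_surface R) (X : M -> CP3 R) (x : M)
  : CP3 R * CP3 R := (X x, NX_tensor_X X x).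

(* V^* is spanned by kappa_{2 bar 1}, pulled back by local sections of C_2. *)
Definition contact_integral (R : realType) (M : riemann_surface R) (Y : M -> CP3 R)
  : Prop :=
  forall c W f, frame_along2 Y c W f -> forall z, W z -> forall u, kappa21 f z u = 0.

Definition holomorphic_integral (R : realType) (M : riemann_surface R)
  (Y : M -> CP3 R) : Prop := holomorphic_map Y /\ contact_integral Y.

(* Main.v *)
Require Import Defs.
From HB Require Import structures.
From mathcomp Require Import all_boot all_order all_algebra.
From mathcomp Require Import all_classical all_reals all_analysis.
From mathcomp Require Import complex ring lra.

Set Implicit Arguments.
Unset Strict Implicit.
Unset Printing Implicit Defensive.

Import Order.TTheory GRing.Theory Num.Theory.
Import numFieldNormedType.Exports.

Local Open Scope classical_set_scope.
Local Open Scope ring_scope.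
Local Open Scope complex_scope.

(** Write J for right multiplication by the quaternion j. It is an antilinear map
    of C^4 with J^2 = -1, and the quaternionic pairing of v and w is
    h(v, w) + j o(v, w), where h is the Hermitian form and o(v, w) = h(Jv, w) is a
    complex symplectic form.

    From X to Y. Along a null-torsion curve X with its line L there are local frames
    (e_1, e_2) such that e_1 spans X and L is spanned by e_1^* (x) e_2 j; then e_2
    spans the line Y. Since I_1 has its values in L and II vanishes, only two terms
    remain in the structure equation of e_2:
      de_2 = theta Je_1 + rho e_2, where theta = o(e_2, de_1) is of type (1,0).
    After division of e_2 by one of its coordinates this says that Y is holomorphic
    ([torsionfree_hol]), and o(e_2, de_2) = 0 says that Y is an integral of the
    contact system. Where theta is not zero the tangent line of Y is spanned by e_2
    and Je_1, so X is the image under J of the Hermitian complement of Y in its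
    tangent line: X is determined by Y at these points.

    From Y to X. This suggests the inverse map. If v is a holomorphic lift of an
    integral Y then o(v, dv) = 0, so the tangent line of Y is Lagrangian for o. If b
    is orthogonal to v in it, then Jb is orthogonal to v and to Jv, and Jb/|b|, v/|v|
    is a frame. Differentiating the orthogonality relations shows that X = [Jb] is
    pseudoholomorphic ([tangent_pseudohol]) with omega_1 = 0 and kappa_{1 bar 2} = 0
    in this frame ([tangent_relations]), so that X is null-torsion with L spanned by
    f_{bar 2}, and its image is Y ([tensor_tangent_L]).

    The zeros of dY. Near such a zero z_0 the derivative of a lift of Y with a
    coordinate equal to 1 is (z - z_0)^n t with t(z_0) not zero, unless Y is constant
    there ([const_or_tangent]); hence the tangent line of Y extends across z_0. As M
    is connected and Y is not constant, the zeros of dY are isolated, and two smooth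
    maps which agree away from them are equal ([smooth_maps_agree]). This gives the
    injectivity of the correspondence, and also the uniqueness of L: outside the
    zeros of dY the line L is spanned by I_1. The factorisation needs no power
    series: if g(z_0) = 0 then g(z) is the product of z - z_0 and the mean of g' over
    the segment from z_0 to z, which is holomorphic by differentiation under the
    integral sign ([hol_divide]), and if all the quotients obtained in this way
    vanish at z_0 then the maximum principle forces g to vanish near z_0
    ([infinite_order_zero]).

    Change of charts and lifts. All conditions on X and Y are conditions on the first
    order jet of a lift. Two lifts in two charts have the same jet up to a complex
    factor, a multiple of the lift itself and a complex linear change of the tangent
    plane ([chart_jet]), so each condition need only be verified for one lift near
    each point. *)

(** * Functions with iterated directional derivatives *)

Lemma near_open (T : topologicalType) (D : set T) (z : T) (P : T -> Prop) :
  open D -> D z -> (forall y, D y -> P y) -> \forall y \near z, P y.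
Proof. by move=> oD Dz DP; exact (filterS DP (open_nbhs_nbhs (conj oD Dz))). Qed.

Section LineCalculus.
Variables (R : realType) (V : normedModType R).
Implicit Types (D : set V) (f g k : V -> R) (z u : V).

(** The restriction of g to the line z + R u turns directional derivatives into
    derivatives of a function of one variable, to which the mean value theorem
    applies. *)
Lemma line_growth g z u (s : R) :
  (fun h : R => h^-1 *: (((fun t : R => g (t *: u + z)) \o shift s) (h *: 1) - g (s *: u + z)))
  = (fun h : R => h^-1 *: ((g \o shift (s *: u + z)) (h *: u) - g (s *: u + z))).
Proof.
apply/funext => h /=; congr (_ *: (g _ - _)).
by rewrite scalerDl -addrA [h *: 1]mulr1.
Qed.

Lemma line_derivable g z u (s : R) :
  derivable g (s *: u + z) u <-> derivable (fun t : R => g (t *: u + z)) s 1.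
Proof. by rewrite /derivable line_growth. Qed.

Lemma line_derive g z u (s : R) :
  'D_1 (fun t : R => g (t *: u + z)) s = 'D_u g (s *: u + z).
Proof. by rewrite /derive line_growth. Qed.

Lemma line_is_derive g z u (s : R) : derivable g (s *: u + z) u ->
  is_derive s 1 (fun t : R => g (t *: u + z)) ('D_u g (s *: u + z)).
Proof.
by move=> dg; apply: DeriveDef; [exact/line_derivable | rewrite line_derive].
Qed.

Lemma line_MVT g z u (a : R) : 0 < a ->
  (forall s : R, 0 <= s <= a -> derivable g (s *: u + z) u) ->
  exists2 s, 0 < s < a & g (a *: u + z) - g z = a * 'D_u g (s *: u + z).
Proof.
move=> a0 dg.
have cf : {within `[0, a], continuous (fun t : R => g (t *: u + z))}.
  apply: derivable_within_continuous => x; rewrite in_itv/= => xa.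
  by apply/line_derivable/dg.
have df x : x \in `]0, a[ ->
    is_derive x 1 (fun t : R => g (t *: u + z)) ('D_u g (x *: u + z)).
  rewrite in_itv/= => /andP[x0 xa]; apply: line_is_derive.
  by apply: dg; rewrite !ltW.
have [s sa E] := MVT a0 df cf.
exists s; first by move: sa; rewrite in_itv.
by move: E; rewrite scale0r add0r subr0 mulrC.
Qed.

(** Slightly more than class C^n: the derivatives of order n are also derivable
    in every direction, so that being smooth means satisfying this for all n. *)
Fixpoint Cn n D g : Prop :=
  (forall z, D z -> {for z, continuous g} /\ forall u, derivable g z u) /\
  if n is m.+1 then forall u, Cn m D (fun y => 'D_u g y) else True.

Lemma Cn_le n D g : Cn n.+1 D g -> Cn n D g.
Proof.
elim: n g => [|n IH] g [H1 H2]; split => // u; apply: IH; exact: H2.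
Qed.

Lemma Cn_ext n D f g : open D -> {in D, f =1 g} -> Cn n D f -> Cn n D g.
Proof.
move=> oD.
have nearD f' g' z : {in D, f' =1 g'} -> D z -> {near z, f' =1 g'}.
  move=> fg Dz; near=> y; apply: fg; rewrite inE; near: y.
  exact: open_nbhs_nbhs.
have near_cont f' g' z : {in D, f' =1 g'} -> D z ->
    {for z, continuous f'} -> {for z, continuous g'}.
  move=> fg Dz cf; rewrite /prop_for /continuous_at -(fg z) ?inE//.
  by apply: cvg_trans cf; apply: near_eq_cvg; exact: nearD.
elim: n f g => [|n IH] f g fg [H1 H2]; split; try exact I.
- move=> z Dz; have [cf df] := H1 z Dz; split; first exact: near_cont cf.
  by move=> u; apply: near_eq_derivable (df u); exact: nearD.
- move=> z Dz; have [cf df] := H1 z Dz; split; first exact: near_cont cf.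
  by move=> u; apply: near_eq_derivable (df u); exact: nearD.
move=> u; apply: IH (H2 u) => z /[1!inE] Dz.
by apply: near_eq_derive; apply: nearD Dz.
Unshelve. all: by end_near.
Qed.

Lemma CnW n D g z : Cn n D g -> D z -> {for z, continuous g}.
Proof. by case: n => [|n] [/(_ z) H _] /H[]. Qed.

Lemma CnWd n D g z u : Cn n D g -> D z -> derivable g z u.
Proof. by case: n => [|n] [/(_ z) H _] /H[]. Qed.

Lemma Cn_sub n D D' g : D' `<=` D -> Cn n D g -> Cn n D' g.
Proof.
move=> sD; elim: n g => [|n IH] g [H1 H2]; split => //.
- by move=> z /sD; exact: H1.
- by move=> z /sD; exact: H1.
- by move=> u; apply: IH; exact: H2.
Qed.

Lemma Cn_derive n D g u : Cn n.+1 D g -> Cn n D (fun y => 'D_u g y).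
Proof. by case=> _ /(_ u). Qed.

Lemma Cn_cst n D (c : R) : open D -> Cn n D (cst c).
Proof.
move=> oD; elim: n c => [|n IH] c; split => //.
- by move=> z _; split; [exact: cst_continuous|move=> u; exact: derivable_cst].
- by move=> z _; split; [exact: cst_continuous|move=> u; exact: derivable_cst].
by move=> u; apply: Cn_ext (IH 0) => // z _; rewrite derive_cst.
Qed.

Lemma CnD n D f g : open D -> Cn n D f -> Cn n D g -> Cn n D (fun z => f z + g z).
Proof.
move=> oD; elim: n f g => [|n IH] f g Cf Cg; (split; first by
  move=> z Dz; split => [|u]; [apply: continuousD; [exact: CnW Cf _|exact: CnW Cg _]
    |apply: derivableD; [exact: CnWd Cf _|exact: CnWd Cg _]]) => //.
move=> u; have [_ /(_ u) Cf'] := Cf; have [_ /(_ u) Cg'] := Cg.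
apply: Cn_ext (IH _ _ Cf' Cg') => // z /[1!inE] Dz.
by apply/esym/deriveD; [exact: CnWd Cf _|exact: CnWd Cg _].
Qed.

Lemma CnN n D f : open D -> Cn n D f -> Cn n D (fun z => - f z).
Proof.
move=> oD; elim: n f => [|n IH] f Cf; (split; first by
  move=> z Dz; split => [|u]; [apply: continuousN; exact: CnW Cf _
    |apply: derivableN; exact: CnWd Cf _]) => //.
move=> u; have [_ /(_ u) Cf'] := Cf.
apply: Cn_ext (IH _ Cf') => // z /[1!inE] Dz.
by apply/esym/deriveN; exact: CnWd Cf _.
Qed.

Lemma CnM n D f g : open D -> Cn n D f -> Cn n D g -> Cn n D (fun z => f z * g z).
Proof.
move=> oD; elim: n f g => [|n IH] f g Cf Cg; (split; first by
  move=> z Dz; split => [|u]; [apply: continuousM; [exact: CnW Cf _|exact: CnW Cg _]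
    |apply: derivableM; [exact: CnWd Cf _|exact: CnWd Cg _]]) => //.
move=> u; have [_ /(_ u) Cf'] := Cf; have [_ /(_ u) Cg'] := Cg.
apply: Cn_ext (CnD oD (IH _ _ (Cn_le Cf) Cg') (IH _ _ (Cn_le Cg) Cf')) => // z.
move=> /[1!inE] Dz.
by apply/esym/deriveM; [exact: CnWd Cf _|exact: CnWd Cg _].
Qed.

Lemma CnV n D f : open D -> (forall z, D z -> f z != 0) ->
  Cn n D f -> Cn n D (fun z => (f z)^-1).
Proof.
move=> oD f0; elim: n f f0 => [|n IH] f f0 Cf; (split; first by
  move=> z Dz; split => [|u]; [apply: continuousV; [exact: f0|exact: CnW Cf _]
    |apply: derivableV; [exact: f0|exact: CnWd Cf _]]) => //.
move=> u; have [_ /(_ u) Cf'] := Cf.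
have CV := IH _ f0 (Cn_le Cf).
apply: Cn_ext (CnM oD (CnN oD (CnM oD CV CV)) Cf') => // z /[1!inE] Dz.
rewrite deriveV; [|exact: f0|exact: CnWd Cf _].
by rewrite [RHS]mulNr -mulNr -expr2 exprVn.
Qed.

Lemma is_derive_sqrt f z u : 0 < f z -> derivable f z u ->
  is_derive z u (fun y => Num.sqrt (f y)) ((2 * Num.sqrt (f z))^-1 * 'D_u f z).
Proof.
move=> f0 df.
have z0 : z = 0 *: u + z by rewrite scale0r add0r.
have df' : is_derive (0 : R) 1 (fun t : R => f (t *: u + z)) ('D_u f z).
  by rewrite {2}z0; apply: line_is_derive; rewrite -z0.
have ds : is_derive (f (0 *: u + z)) 1 (@Num.sqrt R) (2 * Num.sqrt (f z))^-1.
  by rewrite -z0; exact: is_derive1_sqrt.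
have := @is_derive1_comp _ _ _ _ _ _ ds df'.
move=> [dc Dc]; split.
  by rewrite z0; apply/line_derivable.
by rewrite {1}z0 -(line_derive (fun y => Num.sqrt (f y))).
Qed.

Lemma Cn_sqrt n D f : open D -> (forall z, D z -> 0 < f z) ->
  Cn n D f -> Cn n D (fun z => Num.sqrt (f z)).
Proof.
move=> oD f0; elim: n f f0 => [|n IH] f f0 Cf; (split; first by
  move=> z Dz; split => [|u];
   [apply: (@continuous_comp _ _ _ f (@Num.sqrt R)); [exact: CnW Cf _|exact: sqrt_continuous]
   |apply: ex_derive; apply: is_derive_sqrt; [exact: f0|exact: CnWd Cf _]]) => //.
move=> u; have [_ /(_ u) Cf'] := Cf.
have CV := IH _ f0 (Cn_le Cf).
have C2 : Cn n D (fun z => (2 * Num.sqrt (f z))^-1).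
  apply: CnV => //; last exact: CnM (Cn_cst _ _ _) _.
  by move=> z Dz; rewrite mulf_neq0// gt_eqF// sqrtr_gt0 f0.
apply: Cn_ext (CnM oD C2 Cf') => // z /[1!inE] Dz.
by have [_ ->] := is_derive_sqrt (f0 _ Dz) (@CnWd _ _ _ _ u Cf Dz).
Qed.

Lemma is_derive_affine f z u (c : R) :
  (forall h : R, f (h *: u + z) = f z + h * c) -> is_derive z u f c.
Proof.
move=> fE.
suff L : h^-1 *: ((f \o shift z) (h *: u) - f z) @[h --> 0^'] --> c.
  by split; [apply/cvg_ex; exists c|apply: cvg_lim].
apply: cvg_near_cst; near=> h => /=.
rewrite fE addrAC subrr add0r [LHS]mulKf//.
by near: h; exact: nbhs_dnbhs_neq.
Unshelve. all: by end_near. Qed.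

(** The directional derivatives of an affine function are constant. *)
Lemma Cn_affine n D f : open D -> continuous f ->
  (forall u, exists c, forall z (h : R), f (h *: u + z) = f z + h * c) -> Cn n D f.
Proof.
move=> oD cf fE; case: n => [|n]; (split; first by
  move=> z Dz; split => [|u]; [exact: cf|have [c fc] := fE u;
   by have [] := @is_derive_affine f z u c (fc z)]) => //.
move=> u; have [c fc] := fE u.
apply: Cn_ext (Cn_cst n c oD) => // z _.
by have [_ ->] := is_derive_affine (fc z).
Qed.

End LineCalculus.

Lemma smooth_onP (R : realType) (D : set (R * R)) g : smooth_on D g <-> forall n, Cn n D g.
Proof.
split=> [+ n|].
  elim: n g => [|n IH] g sg; (split; first by move=> z Dz; exact: (sg [::])) => //.
  by move=> u; apply: IH => us z Dz; have := sg (rcons us u) z Dz; rewrite foldr_rcons.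
move=> sg us z Dz /=.
elim/last_ind: us g sg => [|us u IH] g sg /=; first by have [/(_ z Dz)] := sg 0%N.
by rewrite foldr_rcons; apply: IH => n; have [_ /(_ u)] := sg n.+1.
Qed.

Lemma Cn_fst (R : realType) n (D : set (R * R)) : open D -> Cn n D fst.
Proof.
move=> oD; apply: Cn_affine => // [z|u]; first exact: cvg_fst.
by exists u.1 => z h /=; rewrite addrC.
Qed.

Lemma Cn_snd (R : realType) n (D : set (R * R)) : open D -> Cn n D snd.
Proof.
move=> oD; apply: Cn_affine => // [z|u]; first exact: cvg_snd.
by exists u.2 => z h /=; rewrite addrC.
Qed.

(** * Symmetry of second derivatives *)

Section SecondDifferences.
Variables (R : realType) (V : normedModType R).
Implicit Types (D : set V) (f g k : V -> R) (z u v : V).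

Lemma shift_growth g c z u :
  (fun h : R => h^-1 *: (((fun y => g (c + y)) \o shift z) (h *: u) - g (c + z)))
  = (fun h : R => h^-1 *: ((g \o shift (c + z)) (h *: u) - g (c + z))).
Proof. by apply/funext => h /=; rewrite addrCA. Qed.

Lemma shift_derivable g c z u :
  derivable g (c + z) u <-> derivable (fun y => g (c + y)) z u.
Proof. by rewrite /derivable shift_growth. Qed.

Lemma shift_derive g c z u : 'D_u (fun y => g (c + y)) z = 'D_u g (c + z).
Proof. by rewrite /derive shift_growth. Qed.

(** The mean value theorem along u for the difference of g on two parallel
    segments, then along v. *)
Lemma second_difference D g z u v (a : R) : 0 < a -> Cn 1 D g ->
  (forall s t : R, 0 <= s <= a -> 0 <= t <= a -> D (t *: v + (s *: u + z))) ->
  exists s t : R, [/\ 0 <= s <= a, 0 <= t <= a &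
    g (a *: v + (a *: u + z)) - g (a *: u + z) - (g (a *: v + z) - g z) =
    a * (a * 'D_v (fun y => 'D_u g y) (t *: v + (s *: u + z)))].
Proof.
move=> a0 Cg DD.
have Da (s : R) : 0 <= s <= a -> D (a *: v + (s *: u + z)).
  by move=> sa; apply: DD => //; rewrite ltW// lexx.
have D0 (s : R) : 0 <= s <= a -> D (s *: u + z).
  by move=> sa; have := DD s 0 sa; rewrite scale0r add0r lexx ltW//; apply.
have d1 (s : R) : 0 <= s <= a -> derivable (fun y => g (a *: v + y)) (s *: u + z) u.
  move=> sa; exact (proj1 (shift_derivable g (a *: v) (s *: u + z) u) (CnWd Cg (Da s sa))).
have d2 (s : R) : 0 <= s <= a -> derivable g (s *: u + z) u.
  move=> sa; exact (CnWd Cg (D0 s sa)).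
have df (s : R) : 0 <= s <= a ->
    derivable (fun y => g (a *: v + y) - g y) (s *: u + z) u.
  move=> sa; exact (derivableB (d1 s sa) (d2 s sa)).
have [s sa E] := line_MVT a0 df.
have sa' : 0 <= s <= a by case/andP: sa => ? ?; rewrite !ltW.
have [t ta E'] : exists2 t, 0 < t < a &
    'D_u g (a *: v + (s *: u + z)) - 'D_u g (s *: u + z) =
    a * 'D_v (fun y => 'D_u g y) (t *: v + (s *: u + z)).
  apply: (@line_MVT _ _ (fun y => 'D_u g y) (s *: u + z) v a a0) => t ta.
  exact (CnWd (Cn_derive u Cg) (DD s t sa' ta)).
exists s, t; split => //; first by case/andP: ta => ? ?; rewrite !ltW.
rewrite E; congr (_ * _); rewrite -E' -(shift_derive g (a *: v) (s *: u + z) u).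
exact (deriveB (d1 s sa') (d2 s sa')).
Qed.

Lemma near_parallelogram z u v (P : set V) : nbhs z P ->
  exists2 a : R, 0 < a & forall s t : R, 0 <= s <= a -> 0 <= t <= a ->
    P (t *: v + (s *: u + z)).
Proof.
case/nbhs_ballP => r /= r0 rP.
have N0 : 0 < 2 * (`|u| + `|v| + 1) :> R by rewrite mulr_gt0// ltr_wpDl// addr_ge0.
(* The term 1 keeps the denominator positive when u and v vanish. *)
exists (r / (2 * (`|u| + `|v| + 1))); first by rewrite divr_gt0.
set a := r / _ => s t /andP[s0 sa] /andP[t0 ta]; apply: rP.
rewrite -ball_normE /= addrA opprD addrCA subrr addr0 normrN.
rewrite (le_lt_trans (ler_normD _ _))// !normrZ !ger0_norm//.
have ua : s * `|u| <= a * `|u| by rewrite ler_wpM2r.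
have va : t * `|v| <= a * `|v| by rewrite ler_wpM2r.
have E : 2 * (a * `|u|) + 2 * (a * `|v|) + 2 * a = r.
  rewrite -[RHS](divfK (lt0r_neq0 N0)) -/a; ring.
have a0 : 0 < a by rewrite divr_gt0.
have u0 : 0 <= a * `|u| by rewrite mulr_ge0// ltW.
have v0 : 0 <= a * `|v| by rewrite mulr_ge0// ltW.
move: (a * `|u|) (a * `|v|) (s * `|u|) (t * `|v|) u0 v0 ua va a0 E => au av su tv.
lra.
Qed.

(** The points p and q need not coincide; continuity makes both values close to
    those at z. *)
Lemma eq_of_close_values f g z : {for z, continuous f} -> {for z, continuous g} ->
  (forall P : set V, nbhs z P -> exists p q, [/\ P p, P q & f p = g q]) -> f z = g z.
Proof.
move=> cf cg H; apply/eqP; rewrite -subr_eq0 -normr_le0 leNgt; apply/negP => e0.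
set e := `|_| in e0.
have e2 : 0 < e / 2 by rewrite divr_gt0.
have nf : \forall y \near z, `|f z - f y| < e / 2 by exact (proj1 (cvgrPdist_lt f (f z)) cf _ e2).
have ng : \forall y \near z, `|g z - g y| < e / 2 by exact (proj1 (cvgrPdist_lt g (g z)) cg _ e2).
have [p [q [[fp _] [_ gq] E]]] := H _ (filterI nf ng).
have : e <= `|f z - f p| + `|g z - g q|.
  by rewrite /e -E (le_trans _ (ler_normB _ _))// opprB addrA subrK.
rewrite /= in fp gq; lra.
Qed.

(** Clairaut: both iterated derivatives are the limit of the same second
    difference quotient. *)
Lemma derive_comm D g z u v : open D -> Cn 2 D g -> D z ->
  'D_v (fun y => 'D_u g y) z = 'D_u (fun y => 'D_v g y) z.
Proof.
move=> oD Cg Dz.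
apply: (@eq_of_close_values (fun y => 'D_v (fun y => 'D_u g y) y)
  (fun y => 'D_u (fun y => 'D_v g y) y)).
- exact (CnW (Cn_derive v (Cn_derive u Cg)) Dz).
- exact (CnW (Cn_derive u (Cn_derive v Cg)) Dz).
move=> P nP.
have nDP : nbhs z (D `&` P) by exact (filterI (open_nbhs_nbhs (conj oD Dz)) nP).
have [a1 a10 H1] := near_parallelogram u v nDP.
have [a2 a20 H2] := near_parallelogram v u nDP.
pose a := Num.min a1 a2.
have a0 : 0 < a by rewrite lt_min a10.
have le1 (s : R) : 0 <= s <= a -> 0 <= s <= a1.
  by case/andP=> ->; rewrite le_min => /andP[].
have le2 (s : R) : 0 <= s <= a -> 0 <= s <= a2.
  by case/andP=> ->; rewrite le_min => /andP[].
have D1 (s t : R) : 0 <= s <= a -> 0 <= t <= a -> D (t *: v + (s *: u + z)).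
  by move=> /le1 sa /le1 ta; have [] := H1 _ _ sa ta.
have D2 (s t : R) : 0 <= s <= a -> 0 <= t <= a -> D (t *: u + (s *: v + z)).
  by move=> /le2 sa /le2 ta; have [] := H2 _ _ sa ta.
have [s1 [t1 [/le1 s1a /le1 t1a E1]]] := second_difference a0 (Cn_le Cg) D1.
have [s2 [t2 [/le2 s2a /le2 t2a E2]]] := second_difference a0 (Cn_le Cg) D2.
exists (t1 *: v + (s1 *: u + z)), (t2 *: u + (s2 *: v + z)); split.
- by have [] := H1 _ _ s1a t1a.
- by have [] := H2 _ _ s2a t2a.
apply: (mulfI (lt0r_neq0 a0)); apply: (mulfI (lt0r_neq0 a0)).
refine (etrans (esym E1) (etrans _ E2)); rewrite (addrCA (a *: u)).
move: (g (a *: v + _)) (g (a *: u + z)) (g (a *: v + z)) (g z) => g1 g2 g3 g4.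
by ring.
Qed.

Lemma line_MVT_signed g z u (a : R) :
  (forall s : R, `|s| <= `|a| -> derivable g (s *: u + z) u) ->
  exists2 s, `|s| <= `|a| & g (a *: u + z) - g z = a * 'D_u g (s *: u + z).
Proof.
move=> dg; have [a0|a0|<-] := ltgtP 0 a.
- have [|s /andP[s0 sa] E] := @line_MVT _ _ g z u a a0.
    by move=> s /andP[s0 sa]; apply: dg; rewrite !ger0_norm// ltW.
  by exists s => //; rewrite !gtr0_norm// ltW.
- have a0' : 0 < - a by rewrite oppr_gt0.
  have [|s /andP[s0 sa] E] := @line_MVT _ _ g (a *: u + z) u (- a) a0'.
    move=> s /andP[s0 sa]; rewrite addrA -scalerDl; apply: dg.
    by rewrite [`|a|]ltr0_norm// ler0_norm; lra.
  exists (s + a); first by rewrite [`|a|]ltr0_norm// ler0_norm; lra.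
  apply: oppr_inj; rewrite opprB scalerDl -addrA -mulNr -E.
  by rewrite addrA -scalerDl addNr scale0r add0r.
- by exists 0; rewrite ?normr0// mul0r scale0r add0r subrr.
Qed.

End SecondDifferences.

(** * Differentiability of C^1 functions of the plane *)

Section Frechet.
Variable R : realType.
Implicit Types (D : set (R * R)) (f g : R * R -> R) (z u : R * R).

Definition dx : R * R := (1, 0).
Definition dy : R * R := (0, 1).

Lemma plane_decomp (h z : R * R) : h + z = h.1 *: dx + (h.2 *: dy + z).
Proof.
case: h z => [a b] [x y]; rewrite /dx /dy /=.
by congr (_, _); rewrite /= [_ *: 0]mulr0 [_ *: 1]mulr1 ?add0r.
Qed.

Lemma ball_dxdy (h z : R * R) (r s t : R) : ball (0 : (R * R)%type) r h ->
  `|s| <= `|h.1| -> `|t| <= `|h.2| -> ball z r (s *: dx + (t *: dy + z)).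
Proof.
case: h z => [a b] [x y] /= [/= ha hb] sa ta.
have -> : s *: dx + (t *: dy + (x, y)) = (s + x, t + y).
  by rewrite -[RHS]/((s, t) + (x, y)) plane_decomp.
split; rewrite /ball /= opprD addrCA subrr addr0 normrN.
  by rewrite (le_lt_trans sa)//; move: ha; rewrite /ball/= sub0r normrN.
by rewrite (le_lt_trans ta)//; move: hb; rewrite /ball/= sub0r normrN.
Qed.

Let lin (a b : R) (h : R * R) : R := h.1 * a + h.2 * b.

Let lin_linear a b : linear (lin a b).
Proof. move=> c [h1 h2] [k1 k2].
change ((c * h1 + k1) * a + (c * h2 + k2) * b = c * (h1 * a + h2 * b) + (k1 * a + k2 * b)).
ring.
Qed.

Let lin_cont a b : continuous (lin a b).
Proof.
move=> h; apply: cvgD; (apply: cvgM; last exact: cvg_cst); [exact: cvg_fst|exact: cvg_snd].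
Qed.

Let linL (a b : R) : {linear (R * R)%type -> R} :=
  HB.pack (lin a b) (GRing.isLinear.Build _ _ _ _ (lin a b) (lin_linear a b)).

(** The increment is split into a step along each axis, and the mean value
    theorem applies to each step. *)
Lemma C1_increment D g z : open D -> Cn 1 D g -> D z ->
  (g : (R * R)%type -> R^o) \o shift z = cst (g z) + (linL ('D_dx g z) ('D_dy g z) : (R * R)%type -> R^o) +o_ (0 : (R * R)%type) id.
Proof.
move=> oD Cg Dz.
have cF := CnW (Cn_derive dx Cg) Dz.
have cG := CnW (Cn_derive dy Cg) Dz.
apply/eqaddoP => e0 /posnumP[e].
have e2 : 0 < e%:num / 2 :> R by rewrite divr_gt0.
have nF : \forall y \near z, `|'D_dx g z - 'D_dx g y| < e%:num / 2.
  exact (proj1 (cvgrPdist_lt (fun y => 'D_dx g y) ('D_dx g z)) cF _ e2).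
have nG : \forall y \near z, `|'D_dy g z - 'D_dy g y| < e%:num / 2.
  exact (proj1 (cvgrPdist_lt (fun y => 'D_dy g y) ('D_dy g z)) cG _ e2).
pose A := D `&` ([set y | `|'D_dx g z - 'D_dx g y| < e%:num / 2] `&`
  [set y | `|'D_dy g z - 'D_dy g y| < e%:num / 2]).
have nA : nbhs z A by exact (filterI (open_nbhs_nbhs (conj oD Dz)) (filterI nF nG)).
case/nbhs_ballP: nA => r /= r0 rP.
apply/nbhs_ballP; exists r => // h hr.
have hball := fun s t => @ball_dxdy h z r s t hr.
have [s sa E1] : exists2 s, `|s| <= `|h.1| &
    g (h.1 *: dx + (h.2 *: dy + z)) - g (h.2 *: dy + z) =
    h.1 * 'D_dx g (s *: dx + (h.2 *: dy + z)).
  apply: (@line_MVT_signed _ _ g (h.2 *: dy + z) dx h.1) => s sa.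
  exact (CnWd Cg (rP _ (hball s h.2 sa (lexx _))).1).
have [t ta E2] : exists2 t, `|t| <= `|h.2| &
    g (h.2 *: dy + z) - g z = h.2 * 'D_dy g (t *: dy + z).
  apply: (@line_MVT_signed _ _ g z dy h.2) => t ta.
  have := hball 0 t; rewrite normr0 scale0r add0r normr_ge0 => /(_ isT ta) /rP[Dt _].
  exact (CnWd Cg Dt).
have [_ [F1 _]] := rP _ (hball s h.2 sa (lexx _)).
have [_ [_ G1]] : A (t *: dy + z).
  by have := hball 0 t; rewrite normr0 scale0r add0r normr_ge0 => /(_ isT ta) /rP.
have h1 : `|h.1| <= `|h| by rewrite [leRHS]prod_normE le_max lexx.
have h2 : `|h.2| <= `|h| by rewrite [leRHS]prod_normE le_max lexx orbT.
change (`|g (h + z) - (g z + (h.1 * 'D_dx g z + h.2 * 'D_dy g z))| <= e%:num * `|h|).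
rewrite /= in F1 G1.
rewrite plane_decomp; move: E1 E2 F1 G1 h1 h2.
move: (g (_ + _)) (g (_ + z)) (g z) ('D_dx g _) ('D_dx g _) ('D_dy g _) ('D_dy g _).
move=> g1 g2 g3 p p' q q' E1 E2 F1 G1 h1 h2.
have -> : g1 - (g3 + (h.1 * p + h.2 * q)) = h.1 * (p' - p) + h.2 * (q' - q).
  have -> : g1 - (g3 + (h.1 * p + h.2 * q)) = (g1 - g2) + (g2 - g3) - (h.1 * p + h.2 * q) by ring.
  by rewrite E1 E2; ring.
rewrite (le_trans (ler_normD _ _))// !normrM [in leRHS](splitr e%:num) mulrDl.
by rewrite lerD// mulrC ler_pM// distrC ltW.
Qed.

Lemma C1_diff D g z : open D -> Cn 1 D g -> D z ->
  differentiable (g : (R * R)%type -> R) z /\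
  forall u, 'D_u g z = u.1 * 'D_dx g z + u.2 * 'D_dy g z.
Proof.
move=> oD Cg Dz.
have dE := @diff_unique R (R * R)%type R^o g (linL ('D_dx g z) ('D_dy g z)) z
  (@lin_cont _ _) (C1_increment oD Cg Dz).
have df : differentiable (g : (R * R)%type -> R) z.
  apply/diff_locallyP; rewrite dE; split; first exact: lin_cont.
  exact (C1_increment oD Cg Dz).
by split => // u; have -> := deriveE u df; rewrite dE.
Qed.

End Frechet.

(** * Means over the segments issuing from a point *)

Section Hadamard.
Variables (R : realType) (V : normedModType R) (D : set V) (z0 : V).
Implicit Types (f g phi : V -> R) (z u v : V).
Local Notation mu := (@lebesgue_measure R).
Local Notation I01 := (`[0, 1]%classic : set R).

Lemma is_derive_scale_dir f z u (c : R) : derivable f z u ->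
  is_derive z (c *: u) f (c * 'D_u f z).
Proof.
move=> df.
have d1 : is_derive (0 : R) 1 (fun s : R => s * c) c.
  have := @is_derive_affine R R (fun s => s * c) 0 1 c.
  by apply => h; rewrite addr0 mul0r add0r [h *: 1]mulr1.
have d2 : is_derive (0 * c : R) 1 (fun s : R => f (s *: u + z)) ('D_u f z).
  have := @line_is_derive R V f z u (0 * c).
  by rewrite mul0r scale0r add0r; apply.
have [d3 D3] := @is_derive1_comp R (fun s : R => f (s *: u + z)) (fun s : R => s * c) 0 _ _ d2 d1.
have E : (fun s : R => f (s *: u + z)) \o (fun s : R => s * c) =
  (fun s : R => f (s *: (c *: u) + z)).
  by apply/funext => s /=; rewrite scalerA.
rewrite E in d3 D3.
have z1 : z = 0 *: (c *: u) + z by rewrite scale0r add0r.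
split; first by rewrite z1; apply/line_derivable.
by rewrite {1}z1 -line_derive D3 mulrC.
Qed.

Hypothesis oD : open D.
(** That D is star-shaped about z0 makes the means defined on D. The bound near
    the segment from z0 to z is the domination that differentiation under the
    integral sign needs. *)
Hypothesis starD : forall z (t : R), D z -> 0 <= t <= 1 -> D (t *: (z - z0) + z0).
Hypothesis bndD : forall phi, (forall z, D z -> {for z, continuous phi}) ->
  forall z, D z -> exists K : R, \forall y \near z, forall t : R, 0 <= t <= 1 ->
    `|phi (t *: (y - z0) + z0)| <= K.

(** The weights t^k make the family stable under differentiation: the chain rule
    adds a factor t to the weight. *)
Definition radial_mean (k : nat) phi z : R :=
  \int[mu]_(t in I01) (t ^+ k * phi (t *: (z - z0) + z0)).

Lemma radial_continuous phi z : (forall z, D z -> {for z, continuous phi}) -> D z ->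
  {in I01, continuous (fun t : R => phi (t *: (z - z0) + z0))}.
Proof.
move=> cphi Dz t; rewrite inE/= in_itv/= => t01.
apply: (@continuous_comp _ _ _ (fun t : R => t *: (z - z0) + z0) phi).
  apply: cvgD; last exact: cvg_cst.
  by apply: cvgZ; [exact: cvg_id|exact: cvg_cst].
by apply: cphi; exact: starD.
Qed.

Lemma radial_integrable k phi z : (forall z, D z -> {for z, continuous phi}) -> D z ->
  mu.-integrable I01 (EFin \o (fun t : R => t ^+ k * phi (t *: (z - z0) + z0))).
Proof.
move=> cphi Dz; apply: continuous_compact_integrable; first exact: segment_compact.
apply: continuous_in_subspaceT => t t01.
apply: cvgM; first exact: exprn_continuous.
by have := radial_continuous cphi Dz t01.
Qed.

(** Differentiation under the integral sign along the line z + R u. *)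
Lemma radial_mean_is_derive k phi z u : Cn 1 D phi -> D z ->
  is_derive z u (radial_mean k phi) (radial_mean k.+1 (fun y => 'D_u phi y) z).
Proof.
move=> Cphi Dz.
have cphi y (Dy : D y) := CnW Cphi Dy.
have cphi' y (Dy : D y) := CnW (Cn_derive u Cphi) Dy.
have [K nK] := bndD cphi' Dz.
have nD : \forall y \near z, D y by exact (open_nbhs_nbhs (conj oD Dz)).
pose S := [set y | forall t : R, 0 <= t <= 1 -> `|'D_u phi (t *: (y - z0) + z0)| <= K].
have /nbhs_ballP[e /= e0 He] : nbhs z (D `&` S) by exact (filterI nD nK).
have u1 : 0 < `|u| + 1 by rewrite ltr_wpDl.
(* For |s| < d the point z + s u stays in the ball of radius e on which the
   derivative is bounded. *)
pose d := e / (`|u| + 1).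
have d0 : 0 < d by rewrite divr_gt0.
have HI (s : R) : s \in `]-d, d[ -> (D `&` S) (s *: u + z).
  rewrite in_itv/= => sd; apply: He.
  rewrite -ball_normE /= opprD addrCA subrr addr0 normrN normrZ.
  have sd' : `|s| < d by rewrite ltr_norml.
  rewrite -[e](divfK (lt0r_neq0 u1)) -/d.
  rewrite (@le_lt_trans _ _ (d * `|u|))//; first by rewrite ler_wpM2r// ltW.
  by rewrite ltr_pM2l// ltrDl.
pose f (s t : R) := t ^+ k * phi (t *: ((s *: u + z) - z0) + z0).
have fder (s t : R) : s \in `]-d, d[ -> 0 <= t <= 1 -> is_derive s 1 (f ^~ t)
    (t ^+ k.+1 * 'D_u phi (t *: ((s *: u + z) - z0) + z0)).
  move=> /HI[Ds _] t01.
  have argE (s' : R) : t *: ((s' *: u + z) - z0) + z0 = s' *: (t *: u) + (t *: (z - z0) + z0).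
    by rewrite -addrA scalerDr -addrA scalerA mulrC -scalerA.
  have dphi : derivable phi (t *: ((s *: u + z) - z0) + z0) u by exact (CnWd Cphi (starD Ds t01)).
  have [dphi' E] := is_derive_scale_dir t dphi.
  rewrite {1}argE in dphi'.
  have := line_is_derive dphi'; rewrite -argE E => dl.
  have -> : f ^~ t = (fun s : R => t ^+ k * phi (s *: (t *: u) + (t *: (z - z0) + z0))).
    by apply/funext => s'; rewrite /f argE.
  rewrite exprSr -mulrA.
  exact: is_deriveZ.

have int (s : R) : s \in `]-d, d[ -> mu.-integrable I01 (EFin \o f s).
  by move=> /HI[Ds _]; exact: radial_integrable.
have I0 : (0 : R) \in `]-d, d[ by rewrite in_itv/= oppr_lt0 d0.
have derf (s t : R) : `]-d, d[%classic s -> I01 t -> derivable (f ^~ t) s 1.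
  by move=> sI; rewrite /= in_itv/= => tI; have [] := fder s t sI tI.
have d1f (s t : R) : `]-d, d[%classic s -> I01 t ->
    partial1of2 f s t = t ^+ k.+1 * 'D_u phi (t *: ((s *: u + z) - z0) + z0).
  move=> sI; rewrite /= in_itv/= => tI; rewrite partial1of2E.
  by have [_ ->] := fder s t sI tI.
have bnd (s t : R) : `]-d, d[%classic s -> I01 t -> `|partial1of2 f s t| <= K.
  move=> sI tI; rewrite d1f//; have [_ HS] := HI s sI.
  move: tI; rewrite /= in_itv/= => tI; have := HS t tI.
  rewrite normrM normrX => HK; rewrite (le_trans _ HK)// ler_piMl//.
  by case/andP: tI => t0 t1; rewrite exprn_ile1// ger0_norm.
have K0 : 0 <= K.
  by have := bnd 0 0 I0; rewrite /= in_itv/= lexx ler01 => /(_ isT); exact: le_trans.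
have intK : mu.-integrable I01 (EFin \o (cst K : R -> R)).
  apply: continuous_compact_integrable; first exact: segment_compact.
  by apply: continuous_in_subspaceT => t _; exact: cst_continuous.
have dF := @derivable_under_integral R _ _ mu f I01 (measurable_itv _) 0 (- d) d
  I0 int derf (cst K) (fun=> K0) intK bnd.
have DF := @differentiation_under_integral R _ _ mu f I01 (measurable_itv _) 0 (- d) d
  I0 int derf (cst K) (fun=> K0) intK bnd.
have z1 : z = 0 *: u + z by rewrite scale0r add0r.
have -> : radial_mean k.+1 (fun y => 'D_u phi y) z = \int[mu]_(t in I01) (partial1of2 f ^~ t) 0.
  apply: eq_Rintegral => t /set_mem tI; rewrite d1f// scale0r add0r.
  by [].
rewrite -DF derive1E.
have -> : (fun x' : R => \int[mu]_(y in I01) f x' y) = (fun s => radial_mean k phi (s *: u + z)) by [].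
rewrite line_derive -z1; apply: derivableP.
by rewrite z1; apply/line_derivable.
Qed.

Lemma radial_mean_bound k phi z (K : R) :
  (forall z, D z -> {for z, continuous phi}) -> D z ->
  (forall t : R, 0 <= t <= 1 -> `|phi (t *: (z - z0) + z0)| <= K) ->
  `|radial_mean k phi z| <= K.
Proof.
move=> cphi Dz HK.
have iphi := radial_integrable k cphi Dz.
have mI : measurable I01 by exact: measurable_itv.
have H := @le_normr_Rintegral _ _ _ mu _ _ mI iphi; rewrite /radial_mean; apply: (le_trans H).
have intK : mu.-integrable I01 (EFin \o (cst K : R -> R)).
  apply: continuous_compact_integrable; first exact: segment_compact.
  by apply: continuous_in_subspaceT => t _; exact: cst_continuous.
have E1 : fine (mu I01) = 1 by rewrite lebesgue_measure_itv/= lte_fin ltr01 oppr0 adde0.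
have -> : K = \int[mu]_(t in I01) (cst K t) by rewrite Rintegral_cst// E1 mulr1.
apply: le_Rintegral => //; first exact: integrable_norm iphi.
move=> t; rewrite /= in_itv/= => t01.
rewrite normrM normrX (le_trans _ (HK t t01))// ler_piMl//.
by case/andP: t01 => t0 t1; rewrite exprn_ile1// ger0_norm.
Qed.

(** The fundamental theorem of calculus on the segment from z0 to z. *)
Lemma radial_FTC phi z : Cn 1 D phi -> D z ->
  phi z - phi z0 = radial_mean 0 (fun y => 'D_(z - z0) phi y) z.
Proof.
move=> Cphi Dz.
have cphi' y (Dy : D y) := CnW (Cn_derive (z - z0) Cphi) Dy.
pose F (t : R) := phi (t *: (z - z0) + z0).
pose f (t : R) := 'D_(z - z0) phi (t *: (z - z0) + z0).
have cf : {within I01, continuous f}.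
  by apply: continuous_in_subspaceT => t t01; have := radial_continuous cphi' Dz t01.
have dF (t : R) : t \in `[0, 1] -> is_derive t 1 F (f t).
  rewrite in_itv/= => t01; apply: line_is_derive.
  exact (CnWd Cphi (starD Dz t01)).
have cF : {within I01, continuous F}.
  by apply: derivable_within_continuous => t /dF[].
have LR : derivable_oo_LRcontinuous F 0 1.
  split; first by move=> t /subset_itv_oo_cc /dF[].
  - by have /continuous_within_itvP[] := cF.
  - by have /continuous_within_itvP[] := cF.
have F'f : {in `]0, 1[, (F : R -> R)^`()%classic =1 f}.
  by move=> t /subset_itv_oo_cc /dF[_ <-]; rewrite derive1E.
have := continuous_FTC2 ltr01 cf LR F'f.
rewrite /F scale1r scale0r add0r subrK => E.
rewrite /radial_mean /Rintegral; under eq_integral do rewrite expr0 mul1r.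
by rewrite E -EFinB.
Qed.

End Hadamard.

(** * Discs for the maximum norm of the plane *)

Section PlaneBall.
Variable R : realType.
Implicit Types (D : set (R * R)) (f g phi : R * R -> R) (z u : R * R).

Lemma plane_closed_ball_compact (z0 : R * R) (r : R) :
  compact [set z : R * R | `|z0.1 - z.1| <= r /\ `|z0.2 - z.2| <= r].
Proof.
have -> : [set z : R * R | `|z0.1 - z.1| <= r /\ `|z0.2 - z.2| <= r] =
    `[z0.1 - r, z0.1 + r]%classic `*` `[z0.2 - r, z0.2 + r]%classic.
  apply/seteqP; split => z /=.
    by move=> [h1 h2]; rewrite /= !in_itv/= -!ler_distlC h1 h2.
  by move=> [/=]; rewrite !in_itv/= -!ler_distlC.
by apply: compact_setX; exact: segment_compact.
Qed.

Lemma star_ball (z0 z : R * R) (r t : R) : ball z0 r z -> 0 <= t <= 1 ->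
  ball z0 r (t *: (z - z0) + z0).
Proof.
move=> [h1 h2] /andP[t0 t1].
have H (a b : R) : `|a - b| < r -> `|a - (t * (b - a) + a)| < r.
  move=> ab; rewrite opprD addrCA subrr addr0 normrN normrM ger0_norm//.
  by rewrite distrC in ab; apply: le_lt_trans ab; rewrite ler_piMl.
by split; [exact: H h1|exact: H h2].
Qed.

(** The segments from z0 to the points near z stay in a smaller closed disc,
    which is compact. *)
Lemma bounded_ball (z0 : R * R) (r : R) phi :
  (forall z, ball z0 r z -> {for z, continuous phi}) ->
  forall z, ball z0 r z -> exists K : R, \forall y \near z, forall t : R, 0 <= t <= 1 ->
    `|phi (t *: (y - z0) + z0)| <= K.
Proof.
move=> cphi z [h1 h2].
pose m := Num.max `|z0.1 - z.1| `|z0.2 - z.2|.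
have mr : m < r by rewrite gt_max h1 h2.
pose r' := (m + r) / 2.
have mr' : m < r' by rewrite /r'; lra.
have rr' : r' < r by rewrite /r'; lra.
pose C := [set z : R * R | `|z0.1 - z.1| <= r' /\ `|z0.2 - z.2| <= r'].
have cC : {within C, continuous phi}.
  apply: continuous_in_subspaceT => y /set_mem[y1 y2]; apply: cphi.
  by split; [exact: le_lt_trans y1 rr'|exact: le_lt_trans y2 rr'].
have [K [_ HK]] := compact_bounded (continuous_compact cC (@plane_closed_ball_compact z0 r')).
exists (K + 1); near=> y => t t01.
apply: (HK (K + 1)); first by rewrite ltrDl.
exists (t *: (y - z0) + z0) => //.
have [] : ball z0 r' (t *: (y - z0) + z0); last by move=> y1 y2; split; exact: ltW.
apply: star_ball => //; near: y.
apply: open_nbhs_nbhs; split; first exact: ball_open.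
by move: mr'; rewrite gt_max => /andP[].
Unshelve. all: by end_near. Qed.

(** Bounded partial derivatives make g Lipschitz near z. This is how continuity
    is obtained for the means, whose derivatives are known first. *)
Lemma bounded_partials_continuous (z : R * R) (K : R) g :
  (\forall y \near z, [/\ forall u, derivable g y u, `|'D_(dx R) g y| <= K &
     `|'D_(dy R) g y| <= K]) -> {for z, continuous g}.
Proof.
case/nbhs_ballP => r /= r0 rP.
have zz : ball z r z by exact: ballxx.
have K0 : 0 <= K by have [_ + _] := rP _ zz; exact: le_trans.
apply/cvgrPdist_le => e e0.
pose d := Num.min r (e / (2 * K + 1)).
have K1 : 0 < 2 * K + 1 by rewrite ltr_wpDl// mulr_ge0.
have d0 : 0 < d by rewrite lt_min r0/= divr_gt0.
have nb : \forall y \near z, ball z d y by exact: nbhsx_ballx.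
near=> y.
have [y1 y2] : ball z d y by near: y.
pose h := y - z.
have hr : ball (0 : (R * R)%type) d h.
  split; rewrite /ball/= sub0r opprB; [exact: y1|exact: y2].
have sub p : ball z d p -> ball z r p.
  by move=> [p1 p2]; split; rewrite /ball/=; [apply: (lt_le_trans p1)|apply: (lt_le_trans p2)]; rewrite ge_min lexx.
have hball := fun s t H1 H2 => sub _ (@ball_dxdy R h z d s t hr H1 H2).
have [s sa E1] : exists2 s, `|s| <= `|h.1| &
    g (h.1 *: dx R + (h.2 *: dy R + z)) - g (h.2 *: dy R + z) =
    h.1 * 'D_(dx R) g (s *: dx R + (h.2 *: dy R + z)).
  apply: (@line_MVT_signed _ _ g (h.2 *: dy R + z) (dx R) h.1) => s sa.
  by have [H _ _] := rP _ (hball s h.2 sa (lexx _)); exact (H (dx R)).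
have ball0 (t : R) : `|t| <= `|h.2| -> ball z r (t *: dy R + z).
  by move=> ta; have := hball 0 t; rewrite normr0 scale0r add0r normr_ge0 => /(_ isT ta).
have [t ta E2] : exists2 t, `|t| <= `|h.2| &
    g (h.2 *: dy R + z) - g z = h.2 * 'D_(dy R) g (t *: dy R + z).
  apply: (@line_MVT_signed _ _ g z (dy R) h.2) => t ta.
  by have [H _ _] := rP _ (ball0 t ta); exact (H (dy R)).
have [_ F1 _] := rP _ (hball s h.2 sa (lexx _)).
have [_ _ G1] := rP _ (ball0 t ta).
have -> : y = h.1 *: dx R + (h.2 *: dy R + z) by rewrite -plane_decomp subrK.
have h1 : `|h.1| <= d by have [] := hr; rewrite /ball/= sub0r normrN => /ltW.
have h2 : `|h.2| <= d by have [_] := hr; rewrite /ball/= sub0r normrN => /ltW.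
move: E1 E2 F1 G1.
move: (g (_ + _)) (g (_ + z)) (g z) ('D_(dx R) g _) ('D_(dy R) g _).
move=> g1 g2 g3 p q E1 E2 F1 G1.
have -> : g3 - g1 = - (h.1 * p + h.2 * q) by rewrite -E1 -E2; ring.
have : d * (2 * K + 1) <= e by rewrite -ler_pdivlMr// ge_min lexx orbT.
rewrite mulrDr mulr1 mulrCA => dK.
rewrite normrN (le_trans (ler_normD _ _))// !normrM.
have : `|h.1| * `|p| <= d * K by rewrite ler_pM.
have : `|h.2| * `|q| <= d * K by rewrite ler_pM.
have : 0 <= d by exact: ltW.
move: (`|h.1| * _) (`|h.2| * _) (d * K) dK => A B C dK *.
lra.
Unshelve. all: by end_near. Qed.

(** The derivatives of a mean are means of derivatives with one more factor t in
    the weight, so the induction is on n for all weights at once. *)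
Lemma radial_mean_Cn (z0 : R * R) (r : R) n k phi :
  (forall m, Cn m (ball z0 r) phi) -> Cn n (ball z0 r) (radial_mean z0 k phi).
Proof.
have oB : open (ball z0 r) by exact: ball_open.
have sB := fun z t => @star_ball z0 z r t.
have bB := fun f => @bounded_ball z0 r f.
have der m f z u : (forall m, Cn m (ball z0 r) f) -> ball z0 r z ->
    is_derive z u (radial_mean z0 m f) (radial_mean z0 m.+1 (fun y => 'D_u f y) z).
  by move=> Cf Bz; exact: radial_mean_is_derive oB sB bB _ _ _ _ (Cf 1) Bz.
have Cd f u : (forall m, Cn m (ball z0 r) f) -> forall m, Cn m (ball z0 r) (fun y => 'D_u f y).
  by move=> Cf m; exact (Cn_derive u (Cf m.+1)).
have cont m f z : (forall m, Cn m (ball z0 r) f) -> ball z0 r z ->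
    {for z, continuous (radial_mean z0 m f)}.
  move=> Cf Bz.
  have [K1 nK1] := bB _ (fun y By => CnW (Cd f (dx R) Cf 0%N) By) z Bz.
  have [K2 nK2] := bB _ (fun y By => CnW (Cd f (dy R) Cf 0%N) By) z Bz.
  apply: (@bounded_partials_continuous z (Num.max K1 K2)).
  have nB : \forall y \near z, ball z0 r y by exact (open_nbhs_nbhs (conj oB Bz)).
  near=> y.
  have By : ball z0 r y by near: y.
  split.
  - by move=> u; have [] := der m f y u Cf By.
  - have [_ ->] := der m f y (dx R) Cf By.
    apply: (radial_mean_bound sB); [|exact: By|].
      by move=> w Bw; exact (CnW (Cd f (dx R) Cf 0%N) Bw).
    by move=> t t01; rewrite le_max; apply/orP; left; move: t t01; near: y.
  - have [_ ->] := der m f y (dy R) Cf By.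
    apply: (radial_mean_bound sB); [|exact: By|].
      by move=> w Bw; exact (CnW (Cd f (dy R) Cf 0%N) Bw).
    by move=> t t01; rewrite le_max; apply/orP; right; move: t t01; near: y.
elim: n k phi => [|n IH] k phi Cphi; (split; first by
  move=> z Bz; split; [exact: cont|move=> u; have [] := der k phi z u Cphi Bz]).
  exact I.
move=> u; apply: Cn_ext (IH k.+1 _ (Cd phi u Cphi)) => // z /set_mem Bz.
by have [_ ->] := der k phi z u Cphi Bz.
Unshelve. all: by end_near. Qed.

Lemma chain_rule D g (phi : R * R -> R * R) z u : open D -> Cn 1 D g -> D (phi z) ->
  differentiable (fun y => (phi y).1) z -> differentiable (fun y => (phi y).2) z ->
  is_derive z u (fun y => g (phi y))
    ('D_('D_u (fun y => (phi y).1) z, 'D_u (fun y => (phi y).2) z) g (phi z)).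
Proof.
move=> oD Cg Dz d1 d2.
have dphi : differentiable phi z.
  have -> : phi = fun y => ((phi y).1, (phi y).2) by apply/funext => y; case: (phi y).
  exact: differentiable_pair.
have [dg _] := C1_diff oD Cg Dz.
have dgp : differentiable (g \o phi) z by exact: differentiable_comp.
split; first exact: diff_derivable.
rewrite [LHS](deriveE u dgp) diff_comp// (deriveE _ dg) (deriveE u d1) (deriveE u d2)/=.
congr ('d g (phi z) _).
have E : phi = fun y => ((phi y).1, (phi y).2) by apply/funext => y; case: (phi y).
by rewrite {1}E diff_pair.
Qed.

End PlaneBall.

(** * Complex-valued functions of the plane *)

Section ComplexAlgebra.
Variable R : realType.
Implicit Types x y : R[i].
Local Notation Re := complex.Re.
Local Notation Im := complex.Im.

Lemma cReD x y : Re (x + y) = Re x + Re y. Proof. by case: x y => [a b] [c d]. Qed.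
Lemma cImD x y : Im (x + y) = Im x + Im y. Proof. by case: x y => [a b] [c d]. Qed.
Lemma cReN x : Re (- x) = - Re x. Proof. by case: x. Qed.
Lemma cImN x : Im (- x) = - Im x. Proof. by case: x. Qed.
Lemma cReM x y : Re (x * y) = Re x * Re y - Im x * Im y.
Proof. by case: x y => [a b] [c d]. Qed.
Lemma cImM x y : Im (x * y) = Re x * Im y + Im x * Re y.
Proof. by case: x y => [a b] [c d]. Qed.
Lemma cReJ x : Re x^* = Re x. Proof. by case: x. Qed.
Lemma cImJ x : Im x^* = - Im x. Proof. by case: x. Qed.

Definition nsq x : R := Re x ^+ 2 + Im x ^+ 2.

Lemma nsq_ge0 x : 0 <= nsq x. Proof. by rewrite addr_ge0 ?sqr_ge0. Qed.

Lemma nsq_eq0 x : (nsq x == 0) = (x == 0).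
Proof. by case: x => a b; rewrite /nsq/= paddr_eq0 ?sqr_ge0// !sqrf_eq0 eq_complex. Qed.

Lemma nsqM x y : nsq (x * y) = nsq x * nsq y.
Proof. by rewrite /nsq cReM cImM; ring. Qed.

Lemma cReV x : Re x^-1 = Re x / nsq x. Proof. by case: x. Qed.
Lemma cImV x : Im x^-1 = - (Im x / nsq x).
Proof. by case: x. Qed.

Lemma complex_ext x y : Re x = Re y -> Im x = Im y -> x = y.
Proof. by case: x y => [a b] [c d] /= -> ->. Qed.

End ComplexAlgebra.

Section ComplexCalculus.
Variable R : realType.
Implicit Types (D : set (R * R)) (f g : R * R -> R[i]) (z u : R * R).
Local Notation Re := complex.Re.
Local Notation Im := complex.Im.

Definition cderivable g z u :=
  derivable (fun y => Re (g y)) z u /\ derivable (fun y => Im (g y)) z u.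

Lemma cdiff_eq g z u (a b : R) :
  is_derive z u (fun y => Re (g y)) a -> is_derive z u (fun y => Im (g y)) b ->
  cderivable g z u /\ cdiff g z u = a +i* b.
Proof. by move=> [da Da] [db Db]; split => //; rewrite /cdiff Da Db. Qed.

Lemma cder_is g z u : cderivable g z u ->
  is_derive z u (fun y => Re (g y)) (Re (cdiff g z u)) /\
  is_derive z u (fun y => Im (g y)) (Im (cdiff g z u)).
Proof. by move=> [da db]; split; exact: derivableP. Qed.

Lemma cdiff_near f g z u : (\near z, f z = g z) ->
  (cderivable f z u -> cderivable g z u) /\ cdiff f z u = cdiff g z u.
Proof.
move=> fg.
have r : \near z, Re (f z) = Re (g z) by near=> y; rewrite (near fg).
have i : \near z, Im (f z) = Im (g z) by near=> y; rewrite (near fg).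
split; first by move=> [dr di]; split; [exact: near_eq_derivable r dr|exact: near_eq_derivable i di].
by rewrite /cdiff (near_eq_derive u r) (near_eq_derive u i).
Unshelve. all: by end_near. Qed.

Lemma cdiff_cst (c : R[i]) z u :
  cderivable (fun=> c) z u /\ cdiff (fun=> c) z u = 0.
Proof.
exact (@cdiff_eq (fun=> c) z u 0 0 (is_derive_cst _ _ _) (is_derive_cst _ _ _)).
Qed.

Lemma cdiffD f g z u : cderivable f z u -> cderivable g z u ->
  cderivable (fun y => f y + g y) z u /\
  cdiff (fun y => f y + g y) z u = cdiff f z u + cdiff g z u.
Proof.
move=> /cder_is[fr fi] /cder_is[gr gi].
have [] := @cdiff_eq (fun y => f y + g y) z u
  (Re (cdiff f z u) + Re (cdiff g z u)) (Im (cdiff f z u) + Im (cdiff g z u)).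
- have -> : (fun y => Re (f y + g y)) = (fun y => Re (f y)) + (fun y => Re (g y)).
    by apply/funext => y; rewrite cReD.
  exact: is_deriveD.
- have -> : (fun y => Im (f y + g y)) = (fun y => Im (f y)) + (fun y => Im (g y)).
    by apply/funext => y; rewrite cImD.
  exact: is_deriveD.
move=> d ->; split; first exact: d.
by apply: complex_ext; rewrite (cReD, cImD).
Qed.

Lemma cdiffN f z u : cderivable f z u ->
  cderivable (fun y => - f y) z u /\ cdiff (fun y => - f y) z u = - cdiff f z u.
Proof.
move=> /cder_is[fr fi].
have [] := @cdiff_eq (fun y => - f y) z u (- Re (cdiff f z u)) (- Im (cdiff f z u)).
- have -> : (fun y => Re (- f y)) = - (fun y => Re (f y)).
    by apply/funext => y; rewrite cReN.
  exact: is_deriveN.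
- have -> : (fun y => Im (- f y)) = - (fun y => Im (f y)).
    by apply/funext => y; rewrite cImN.
  exact: is_deriveN.
move=> d ->; split; first exact: d.
by apply: complex_ext; rewrite (cReN, cImN).
Qed.

Lemma cdiffJ f z u : cderivable f z u ->
  cderivable (fun y => (f y)^*) z u /\ cdiff (fun y => (f y)^*) z u = (cdiff f z u)^*.
Proof.
move=> /cder_is[fr fi].
have [] := @cdiff_eq (fun y => (f y)^*) z u (Re (cdiff f z u)) (- Im (cdiff f z u)).
- have -> : (fun y => Re (f y)^*) = (fun y => Re (f y)).
    by apply/funext => y; rewrite cReJ.
  exact: fr.
- have -> : (fun y => Im (f y)^*) = - (fun y => Im (f y)).
    by apply/funext => y; rewrite cImJ.
  exact: is_deriveN.
move=> d ->; split; first exact: d.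
by apply: complex_ext; rewrite (cReJ, cImJ).
Qed.

Lemma is_deriveM' (f g : R * R -> R) z u (a b : R) :
  is_derive z u f a -> is_derive z u g b ->
  is_derive z u (fun y => f y * g y) (f z * b + g z * a).
Proof. by move=> df dg; exact: is_deriveM. Qed.

Lemma cdiffM f g z u : cderivable f z u -> cderivable g z u ->
  cderivable (fun y => f y * g y) z u /\
  cdiff (fun y => f y * g y) z u = f z * cdiff g z u + g z * cdiff f z u.
Proof.
move=> /cder_is[fr fi] /cder_is[gr gi].
have [] := @cdiff_eq (fun y => f y * g y) z u
  ((Re (f z) * Re (cdiff g z u) + Re (g z) * Re (cdiff f z u))
   - (Im (f z) * Im (cdiff g z u) + Im (g z) * Im (cdiff f z u)))
  ((Re (f z) * Im (cdiff g z u) + Im (g z) * Re (cdiff f z u))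
   + (Im (f z) * Re (cdiff g z u) + Re (g z) * Im (cdiff f z u))).
- have -> : (fun y => Re (f y * g y)) =
    (fun y => Re (f y) * Re (g y)) - (fun y => Im (f y) * Im (g y)).
    by apply/funext => y; rewrite cReM.
  by apply: is_deriveB; exact: is_deriveM'.
- have -> : (fun y => Im (f y * g y)) =
    (fun y => Re (f y) * Im (g y)) + (fun y => Im (f y) * Re (g y)).
    by apply/funext => y; rewrite cImM.
  by apply: is_deriveD; exact: is_deriveM'.
move=> d ->; split; first exact: d.
move: (f z) (cdiff f z u) (g z) (cdiff g z u) => [a1 a2] [b1 b2] [c1 c2] [e1 e2].
by apply: complex_ext => /=; ring.
Qed.

Definition csm D g := (forall n, Cn n D (fun z => Re (g z))) /\
  (forall n, Cn n D (fun z => Im (g z))).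

Lemma csmoothP D g : csmooth_on D g <-> csm D g.
Proof. by split => -[/smooth_onP h1 /smooth_onP h2]; split => //; exact/smooth_onP. Qed.

Lemma csm_der D g z u : csm D g -> D z -> cderivable g z u.
Proof. by move=> [r i] Dz; split; [exact (CnWd (r 0%N) Dz)|exact (CnWd (i 0%N) Dz)]. Qed.

Lemma csm_contRe D g z : csm D g -> D z -> {for z, continuous (fun z => Re (g z))}.
Proof. by move=> [r i] Dz; exact (CnW (r 0%N) Dz). Qed.

Lemma csm_contIm D g z : csm D g -> D z -> {for z, continuous (fun z => Im (g z))}.
Proof. by move=> [r i] Dz; exact (CnW (i 0%N) Dz). Qed.

Lemma csm_sub D D' g : D' `<=` D -> csm D g -> csm D' g.
Proof. by move=> sD [r i]; split=> n; [exact: Cn_sub (r n)|exact: Cn_sub (i n)]. Qed.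

Lemma csm_cst D (c : R[i]) : open D -> csm D (fun=> c).
Proof. by move=> oD; split=> n; exact: Cn_cst. Qed.

Lemma csm_real D (r : R * R -> R) : open D -> (forall n, Cn n D r) -> csm D (fun z => (r z)%:C).
Proof. by move=> oD Cr; split=> n; [exact: Cr|exact: Cn_cst]. Qed.

Lemma csmD D f g : open D -> csm D f -> csm D g -> csm D (fun z => f z + g z).
Proof.
move=> oD [fr fi] [gr gi]; split=> n.
  by under eq_fun do rewrite cReD; exact: CnD.
by under eq_fun do rewrite cImD; exact: CnD.
Qed.

Lemma csmN D f : open D -> csm D f -> csm D (fun z => - f z).
Proof.
move=> oD [fr fi]; split=> n.
  by under eq_fun do rewrite cReN; exact: CnN.
by under eq_fun do rewrite cImN; exact: CnN.
Qed.

Lemma csmJ D f : open D -> csm D f -> csm D (fun z => (f z)^*).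
Proof.
move=> oD [fr fi]; split=> n.
  by under eq_fun do rewrite cReJ; exact: fr.
by under eq_fun do rewrite cImJ; exact: CnN.
Qed.

Lemma csmM D f g : open D -> csm D f -> csm D g -> csm D (fun z => f z * g z).
Proof.
move=> oD [fr fi] [gr gi]; split=> n.
  by under eq_fun do rewrite cReM; apply: CnD => //; [|apply: CnN => //]; exact: CnM.
by under eq_fun do rewrite cImM; apply: CnD => //; exact: CnM.
Qed.

Lemma Cn_nsq n D f : open D -> csm D f -> Cn n D (fun z => nsq (f z)).
Proof. by move=> oD [fr fi]; apply: CnD => //; exact: CnM. Qed.

Lemma csmV D f : open D -> (forall z, D z -> f z != 0) -> csm D f -> csm D (fun z => (f z)^-1).
Proof.
move=> oD f0 sf; have nf n := Cn_nsq n oD sf; have [fr fi] := sf.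
have n0 z : D z -> nsq (f z) != 0 by move=> /f0; rewrite nsq_eq0.
split=> n.
  by under eq_fun do rewrite cReV; apply: CnM => //; exact: CnV.
by under eq_fun do rewrite cImV; apply: CnN => //; apply: CnM => //; exact: CnV.
Qed.

Lemma csm_cdiff D g u : csm D g -> csm D (fun z => cdiff g z u).
Proof. by move=> [r i]; split=> n; [exact: Cn_derive (r n.+1)|exact: Cn_derive (i n.+1)]. Qed.

Lemma cdiff_lin D g z u : open D -> csm D g -> D z ->
  cdiff g z u = (u.1)%:C * cdiff g z (dx R) + (u.2)%:C * cdiff g z (dy R).
Proof.
move=> oD [r i] Dz.
have [_ Er] := C1_diff oD (r 1) Dz; have [_ Ei] := C1_diff oD (i 1) Dz.
rewrite /cdiff (Er u) (Ei u).
move: ('D_(dx R) (fun y => Re (g y)) z) ('D_(dx R) (fun y => Im (g y)) z)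
 ('D_(dy R) (fun y => Re (g y)) z) ('D_(dy R) (fun y => Im (g y)) z) => a b c d.
by apply: complex_ext => /=; ring.
Qed.

Definition hol D g := csm D g /\ forall z, D z -> type10 (cdiff g z).

Lemma holP D g : holomorphic_on D g <-> hol D g.
Proof. by split=> -[/csmoothP h1 h2]; split => //; exact/csmoothP. Qed.

Lemma type10_lin D g z : open D -> csm D g -> D z ->
  cdiff g z (dy R) = 'i * cdiff g z (dx R) -> type10 (cdiff g z).
Proof.
move=> oD sg Dz E u; rewrite (cdiff_lin _ oD sg Dz) (cdiff_lin u oD sg Dz) /= E.
move: (cdiff g z (dx R)) => [a b].
by apply: complex_ext => /=; ring.
Qed.

(** The Cauchy-Riemann equations. *)
Lemma hol_cdiff D g z u : open D -> hol D g -> D z ->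
  cdiff g z u = (u.1 +i* u.2) * cdiff g z (dx R).
Proof.
move=> oD [sg tg] Dz; rewrite (cdiff_lin u oD sg Dz).
have -> : dy R = iplane (dx R) by rewrite /iplane/= oppr0.
rewrite (tg z Dz) mulrA -mulrDl; congr (_ * _).
by apply: complex_ext; rewrite (cReD, cImD) (cReM, cImM) /=; ring.
Qed.

Lemma hol_sub D D' g : D' `<=` D -> hol D g -> hol D' g.
Proof. by move=> sD [sg tg]; split; [exact: csm_sub sg|move=> z /sD; exact: tg]. Qed.

Lemma holM D f g : open D -> hol D f -> hol D g -> hol D (fun z => f z * g z).
Proof.
move=> oD [sf tf] [sg tg]; split; first exact: csmM.
move=> z Dz u.
have d v : cdiff (fun y => f y * g y) z v = f z * cdiff g z v + g z * cdiff f z v.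
  by have [_ ->] := cdiffM (csm_der v sf Dz) (csm_der v sg Dz).
by rewrite !d (tf z Dz) (tg z Dz); ring.
Qed.

Lemma cdiffV D f z u : open D -> csm D f -> (forall z, D z -> f z != 0) -> D z ->
  cdiff (fun y => (f y)^-1) z u = - ((f z)^-1 ^+ 2 * cdiff f z u).
Proof.
move=> oD sf f0 Dz.
have sV := csmV oD f0 sf.
have [_ E] := cdiffM (csm_der u sf Dz) (csm_der u sV Dz).
have n : \near z, f z * (f z)^-1 = 1.
  by near=> y; rewrite divff// f0//; near: y; exact: open_nbhs_nbhs.
have [_ E1] := cdiff_near u n.
have [_ E0] := cdiff_cst 1 z u; rewrite E1 E0 in E.
apply: (mulfI (f0 z Dz)); apply/eqP; rewrite mulrN -addr_eq0 mulrA expr2 mulrA.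
by rewrite divff ?f0// mul1r -E.
Unshelve. all: by end_near. Qed.

Lemma holV D f : open D -> (forall z, D z -> f z != 0) -> hol D f -> hol D (fun z => (f z)^-1).
Proof.
move=> oD f0 [sf tf]; split; first exact: csmV.
move=> z Dz u; rewrite !(cdiffV _ oD sf f0 Dz) (tf z Dz); ring.
Qed.

(** The derivative of a holomorphic function is holomorphic because mixed
    derivatives commute. *)
Lemma hol_der D g : open D -> hol D g -> hol D (fun z => cdiff g z (dx R)).
Proof.
move=> oD [sg tg].
have s' := csm_cdiff (dx R) sg.
split => // z Dz; apply: (type10_lin oD s' Dz).
have [r i] := sg.
have cr := derive_comm (dx R) (dy R) oD (r 2) Dz.
have ci := derive_comm (dx R) (dy R) oD (i 2) Dz.
have -> : cdiff (fun z => cdiff g z (dx R)) z (dy R) = cdiff (fun z => cdiff g z (dy R)) z (dx R).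
  rewrite /cdiff /=; exact (f_equal2 (@Complex R) cr ci).
have n : \near z, cdiff g z (dy R) = 'i * cdiff g z (dx R).
  have nD : \near z, D z by exact (open_nbhs_nbhs (conj oD Dz)).
  near=> y; have Dy : D y by near: y.
  have -> : dy R = iplane (dx R) by rewrite /iplane/= oppr0.
  exact (tg y Dy (dx R)).
have [_ ->] := cdiff_near (dx R) n.
have [_ ->] := cdiffM (proj1 (cdiff_cst 'i z (dx R))) (csm_der (dx R) s' Dz).
by have [_ ->] := cdiff_cst 'i z (dx R); rewrite mulr0 addr0.
Unshelve. all: by end_near. Qed.

End ComplexCalculus.

(** * The Laplacian and the maximum principle *)

Section SecondDerivativeTest.
Variables (R : realType) (V : normedModType R).
Implicit Types (D : set V) (f g : V -> R) (p z u : V).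

Lemma near_line p u (P : set V) : nbhs p P ->
  exists2 a : R, 0 < a & forall s : R, `|s| <= a -> P (s *: u + p).
Proof.
move=> nP; have [a a0 H] := near_parallelogram u (- u) nP.
exists a => // s sa; have [s0|s0] := leP 0 s.
  have := H s 0; rewrite scale0r add0r; apply; last by rewrite lexx ltW.
  by move: sa; rewrite ger0_norm// s0.
have := H 0 (- s); rewrite scale0r add0r scalerN scaleNr opprK; apply.
  by rewrite lexx ltW.
by move: sa; rewrite ltr0_norm// => ->; rewrite oppr_ge0 ltW.
Qed.

(** If the second derivative were positive then it would be so on a segment
    about p, and f would increase from p in a direction in which its first
    derivative is not negative. *)
Lemma second_derivative_max D f p u : open D -> Cn 2 D f -> D p ->
  (\forall y \near p, f y <= f p) -> 'D_u (fun y => 'D_u f y) p <= 0.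
Proof.
move=> oD Cf Dp maxp; rewrite leNgt; apply/negP => c0.
have cF := CnW (Cn_derive u (Cn_derive u Cf)) Dp.
have nF : \forall y \near p, 0 < 'D_u (fun y => 'D_u f y) y.
  exact (cvgr_gt _ cF _ c0).
have [a a0 H] := near_line u (filterI (open_nbhs_nbhs (conj oD Dp)) (filterI maxp nF)).
have d1 (s : R) : `|s| <= a -> derivable f (s *: u + p) u.
  by move=> /H[Ds _]; exact (CnWd Cf Ds).
have d2 (s : R) : `|s| <= a -> derivable (fun y => 'D_u f y) (s *: u + p) u.
  by move=> /H[Ds _]; exact (CnWd (Cn_derive u Cf) Ds).
have incr (s : R) : `|s| <= a -> exists2 c : R, 0 < c &
    'D_u f (s *: u + p) - 'D_u f p = s * c.
  move=> sa; have [s' s'a E] := @line_MVT_signed _ _ (fun y => 'D_u f y) p u s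
    (fun t ta => d2 t (le_trans ta sa)).
  have [_ [_ Hs]] := H s' (le_trans s'a sa).
  exact (ex_intro2 (fun c : R => 0 < c) (fun c : R => 'D_u f (s *: u + p) - 'D_u f p = s * c) _ Hs E).
have aa : `|a| <= a by rewrite gtr0_norm.
have Na : `|- a| <= a by rewrite normrN gtr0_norm.
have [D0|D0] := leP 0 ('D_u f p).
  have [s /andP[s0 sa] E] := @line_MVT _ _ f p u a a0 (fun t ta => d1 t (ltac:(by rewrite ger0_norm; case/andP: ta))).
  have [_ [+ _]] := H a aa; rewrite -subr_le0 E pmulr_rle0//.
  have [|c c0' Ec] := incr s; first by rewrite gtr0_norm// ltW.
  by rewrite leNgt -(subrK ('D_u f p) ('D_u f (s *: u + p))) Ec ltr_wpDr// mulr_gt0.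
have [|s /andP[s0 sa] E] := @line_MVT _ _ f (- a *: u + p) u a a0.
  move=> t /andP[t0 ta]; rewrite addrA -scalerDl; apply: d1.
  by rewrite ler_norml; apply/andP; split; lra.
have [_ [+ _]] := H (- a) Na.
rewrite addrA -scalerDl subrr scale0r add0r in E.
rewrite -subr_ge0 E pmulr_rge0//.
rewrite addrA -scalerDl.
have [|c c0' Ec] := incr (s - a); first by rewrite ler_norml; apply/andP; split; lra.
rewrite leNgt -(subrK ('D_u f p) ('D_u f ((s - a) *: u + p))) Ec.
have sc : (s - a) * c < 0 by rewrite nmulr_rlt0// subr_lt0.
move: ((s - a) * c) ('D_u f p) D0 sc => x y D0 sc.
by apply/negP; rewrite negbK; lra.
Qed.

End SecondDerivativeTest.

Section Laplacian.
Variable R : realType.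
Implicit Types (D : set (R * R)) (f g a b : R * R -> R) (h : R * R -> R[i]) (z u : R * R).
Local Notation Re := complex.Re.
Local Notation Im := complex.Im.

Definition laplacian f z : R :=
  'D_(dx R) (fun y => 'D_(dx R) f y) z + 'D_(dy R) (fun y => 'D_(dy R) f y) z.

Lemma second_derivativeD D f g z u : open D -> Cn 2 D f -> Cn 2 D g -> D z ->
  'D_u (fun y => 'D_u (fun x => f x + g x) y) z =
  'D_u (fun y => 'D_u f y) z + 'D_u (fun y => 'D_u g y) z.
Proof.
move=> oD Cf Cg Dz.
have n : \forall y \near z, 'D_u (fun x => f x + g x) y = 'D_u f y + 'D_u g y.
  by apply: (near_open oD Dz) => y Dy; exact (deriveD (CnWd Cf Dy) (CnWd Cg Dy)).
rewrite (near_eq_derive u n).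
exact (deriveD (CnWd (Cn_derive u Cf) Dz) (CnWd (Cn_derive u Cg) Dz)).
Qed.

Lemma second_derivative_sq D f z u : open D -> Cn 2 D f -> D z ->
  'D_u (fun y => 'D_u (fun x => f x * f x) y) z =
  2 * ('D_u f z) ^+ 2 + 2 * (f z * 'D_u (fun y => 'D_u f y) z).
Proof.
move=> oD Cf Dz.
have n : \forall y \near z, 'D_u (fun x => f x * f x) y = f y * 'D_u f y + f y * 'D_u f y.
  by apply: (near_open oD Dz) => y Dy; exact (deriveM (CnWd Cf Dy) (CnWd Cf Dy)).
rewrite (near_eq_derive u n).
have df := CnWd (u := u) (Cn_derive u Cf) Dz.
have dm := derivableM (CnWd Cf Dz) df.
refine (etrans (deriveD dm dm) _).
have -> := deriveM (CnWd Cf Dz) df.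
move: ('D_u f z) ('D_u (fun y => 'D_u f y) z) (f z) => x y w.
by rewrite /GRing.scale/=; ring.
Qed.

Lemma laplacianD D f g z : open D -> Cn 2 D f -> Cn 2 D g -> D z ->
  laplacian (fun x => f x + g x) z = laplacian f z + laplacian g z.
Proof.
move=> oD Cf Cg Dz.
rewrite /laplacian (second_derivativeD (dx R) oD Cf Cg Dz) (second_derivativeD (dy R) oD Cf Cg Dz).
exact: addrACA.
Qed.

Lemma laplacian_sq D f z : open D -> Cn 2 D f -> D z ->
  laplacian (fun x => f x * f x) z =
  2 * ('D_(dx R) f z ^+ 2 + 'D_(dy R) f z ^+ 2) + 2 * (f z * laplacian f z).
Proof.
move=> oD Cf Dz.
rewrite /laplacian (second_derivative_sq (dx R) oD Cf Dz) (second_derivative_sq (dy R) oD Cf Dz).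
move: ('D_(dx R) _ z) ('D_(dy R) _ z) ('D_(dx R) f z) ('D_(dy R) f z) (f z) => a b c d e.
by ring.
Qed.

(** The Cauchy-Riemann equations turn each second derivative of one part into a
    mixed derivative of the other, and mixed derivatives commute. *)
Lemma hol_laplacian D h z : open D -> hol D h -> D z ->
  laplacian (fun y => Re (h y)) z = 0 /\ laplacian (fun y => Im (h y)) z = 0.
Proof.
move=> oD hh Dz; have [[r i] th] := hh.
have CR y : D y -> 'D_(dy R) (fun y => Re (h y)) y = - 'D_(dx R) (fun y => Im (h y)) y /\
    'D_(dy R) (fun y => Im (h y)) y = 'D_(dx R) (fun y => Re (h y)) y.
  move=> Dy; have := hol_cdiff (dy R) oD hh Dy; rewrite /cdiff /dy /=.
  move: ('D_(0, 1) _ y) ('D_(0, 1) _ y) ('D_(dx R) _ y) ('D_(dx R) _ y) => a b c d.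
  by case=> -> ->; split; ring.
have n1 := near_open oD Dz (fun y Dy => proj1 (CR y Dy)).
have n2 := near_open oD Dz (fun y Dy => proj2 (CR y Dy)).
rewrite /laplacian (near_eq_derive (dy R) n1) (near_eq_derive (dy R) n2).
have dN := deriveN (CnWd (u := dy R) (Cn_derive (dx R) (i 1)) Dz).
have -> : 'D_(dy R) (fun y => - 'D_(dx R) (fun y => Im (h y)) y) z =
   - 'D_(dx R) (fun y => 'D_(dx R) (fun y => Re (h y)) y) z.
  refine (etrans dN (f_equal (fun x : R => - x) _)).
  rewrite (derive_comm (dx R) (dy R) oD (i 2) Dz).
  exact (near_eq_derive (dx R) n2).
split; first exact: subrr.
rewrite (derive_comm (dx R) (dy R) oD (r 2) Dz) (near_eq_derive (dx R) n1).
have -> := deriveN (CnWd (u := dx R) (Cn_derive (dx R) (i 1)) Dz).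
exact: subrr.
Qed.

End Laplacian.

Section MaximumPrinciple.
Variable R : realType.
Implicit Types (D : set (R * R)) (f g a b : R * R -> R) (h : R * R -> R[i]) (z u : R * R).
Local Notation Re := complex.Re.
Local Notation Im := complex.Im.

Definition box (z0 : R * R) (s : R) : set (R * R) :=
  [set z | `|z0.1 - z.1| <= s /\ `|z0.2 - z.2| <= s].

Lemma affine_Cn D (d c : R) (k : bool) n : open D ->
  Cn n D (fun y => d * ((if k then y.1 else y.2) - c)).
Proof.
move=> oD; have Ck : Cn n D (fun y : R * R => if k then y.1 else y.2).
  by case: k; [exact: Cn_fst|exact: Cn_snd].
exact (CnM oD (Cn_cst n d oD) (CnD oD Ck (Cn_cst n (- c) oD))).
Qed.

Lemma laplacian_affine_sq D (d c : R) (k : bool) z : open D -> D z ->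
  laplacian (fun y => (d * ((if k then y.1 else y.2) - c)) * (d * ((if k then y.1 else y.2) - c))) z
  = 2 * d ^+ 2.
Proof.
move=> oD Dz; set f := fun y : R * R => d * ((if k then y.1 else y.2) - c).
have Cf : Cn 2 D f by exact (affine_Cn d c k 2 oD).
have df u y : 'D_u f y = d * (if k then u.1 else u.2).
  suff [_ ->] : is_derive y u f (d * (if k then u.1 else u.2)) by [].
  apply: is_derive_affine => h; rewrite /f {f Cf}; case: k => /=.
    by change (d * (h * u.1 + y.1 - c) = d * (y.1 - c) + h * (d * u.1)); ring.
  by change (d * (h * u.2 + y.2 - c) = d * (y.2 - c) + h * (d * u.2)); ring.
have ddf u y : 'D_u (fun y => 'D_u f y) y = 0.
  have -> : (fun y => 'D_u f y) = cst (d * (if k then u.1 else u.2)).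
    by apply/funext => w; exact: df.
  exact: derive_cst.
rewrite (laplacian_sq oD Cf Dz) /laplacian !ddf !df /dx /dy /=.
by case: (k); ring.
Qed.

Let le0D (x y : R) : x <= 0 -> y <= 0 -> x + y <= 0.
Proof. by move=> *; lra. Qed.

Let sq_pos (a b c d e : R) : 0 < e ->
  ~ 2 * (a ^+ 2 + b ^+ 2) + 2 * (c ^+ 2 + d ^+ 2) + (2 * e + 2 * e) <= 0.
Proof.
have := sqr_ge0 a; have := sqr_ge0 b; have := sqr_ge0 c; have := sqr_ge0 d.
by move: (a ^+ 2) (b ^+ 2) (c ^+ 2) (d ^+ 2) => *; lra.
Qed.

(** The square of the modulus of h is subharmonic. A small multiple of the
    squared distance to z0 makes it strictly subharmonic, so that it has no
    interior maximum. *)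
Lemma hol_max_principle D h (z0 : R * R) (s M : R) : open D -> hol D h ->
  box z0 s `<=` D ->
  (forall z, box z0 s z -> `|z0.1 - z.1| = s \/ `|z0.2 - z.2| = s -> nsq (h z) <= M) ->
  forall z, box z0 s z -> nsq (h z) <= M.
Proof.
move=> oD hh QD Mb w Qw; rewrite leNgt; apply/negP => gap.
have [r i] := proj1 hh.
(* With this factor the added term is at most 2 e s^2 on the box, less than the
   excess of the value at w over M, so the maximum is not on the boundary. *)
pose e := (nsq (h w) - M) / (4 * (s ^+ 2 + 1)).
have s1 : 0 < 4 * (s ^+ 2 + 1) :> R by rewrite mulr_gt0// ltr_wpDl// sqr_ge0.
have e0 : 0 < e by rewrite divr_gt0// subr_gt0.
pose d := Num.sqrt e.
have d2 : d ^+ 2 = e by rewrite sqr_sqrtr// ltW.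
pose sq (k : bool) c := fun y : R * R =>
  (d * ((if k then y.1 else y.2) - c)) * (d * ((if k then y.1 else y.2) - c)).
pose X := sq true z0.1; pose Y := sq false z0.2.
pose P := fun y => Re (h y) * Re (h y) + Im (h y) * Im (h y).
have CX : Cn 2 D X by exact (CnM oD (affine_Cn d z0.1 true 2 oD) (affine_Cn d z0.1 true 2 oD)).
have CY : Cn 2 D Y by exact (CnM oD (affine_Cn d z0.2 false 2 oD) (affine_Cn d z0.2 false 2 oD)).
have Crr := CnM oD (r 2) (r 2).
have Cii := CnM oD (i 2) (i 2).
have CP : Cn 2 D P by exact (CnD oD Crr Cii).
pose f := fun y => P y + (X y + Y y).
have CXY := CnD oD CX CY.
have Cf : Cn 2 D f by exact (CnD oD CP CXY).
have cf : {within box z0 s, continuous f}.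
  apply: continuous_in_subspaceT => y /set_mem Qy; exact (CnW Cf (QD _ Qy)).
have [p /set_mem Qp maxp] := compact_EVT_max (ex_intro _ w Qw) (@plane_closed_ball_compact R z0 s) cf.
have Pw : P w = nsq (h w) by rewrite /P /nsq !expr2.
have fw : nsq (h w) <= f w.
  rewrite /f Pw lerDl addr_ge0// /X /Y /sq; exact: sqr_ge0.
have fwp : f w <= f p by apply: maxp; rewrite inE.
have XY y : box z0 s y -> X y + Y y <= 2 * (e * s ^+ 2).
  move=> [h1 h2]; rewrite /X /Y /sq /=.
  have -> : 2 * (e * s ^+ 2) = e * s ^+ 2 + e * s ^+ 2 by ring.
  have sqE (c : R) : `|c| <= s -> (d * - c) * (d * - c) <= e * s ^+ 2.
    move=> cs; have -> : (d * - c) * (d * - c) = e * c ^+ 2 by rewrite -d2; ring.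
    have cs2 : c ^+ 2 <= s ^+ 2.
      rewrite -[c ^+ 2](real_normK (num_real c)).
      by apply: lerXn2r => //; rewrite nnegrE//; exact: le_trans cs.
    by apply: ler_wpM2l => //; exact: ltW.
  by rewrite lerD//; [have := sqE _ h1|have := sqE _ h2]; rewrite opprB.
have eE : 4 * (e * s ^+ 2) + 4 * e = nsq (h w) - M.
  by rewrite -[RHS](divfK (lt0r_neq0 s1)) -/e; ring.
have [bd|nbd] := pselect (`|z0.1 - p.1| = s \/ `|z0.2 - p.2| = s).
  have Pp : P p = nsq (h p) by rewrite /P /nsq !expr2.
  have fp : f w <= nsq (h p) + (X p + Y p) by rewrite -Pp.
  have key (A B F S T E : R) : M < A -> A <= F -> F <= B + S -> B <= M -> S <= 2 * T ->
    4 * T + 4 * E = A - M -> 0 < E -> False by move=> *; lra.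
  exact: key gap fw fp (Mb p Qp bd) (XY p Qp) eE e0.
have Bp : ball z0 s p.
  have [p1 p2] := Qp.
  by split; rewrite /ball/= lt_neqAle ?p1 ?p2 andbT; apply/eqP => E; apply: nbd; [left|right].
have near_max : \forall y \near p, f y <= f p.
  have nB : \forall y \near p, ball z0 s y by exact (open_nbhs_nbhs (conj (ball_open z0 s) Bp)).
  near=> y; apply: maxp; rewrite inE.
  by have [/ltW ? /ltW ?] : ball z0 s y by near: y.
have Dp := QD _ Qp.
have L1 := second_derivative_max (dx R) oD Cf Dp near_max.
have L2 := second_derivative_max (dy R) oD Cf Dp near_max.
have : laplacian f p <= 0 by exact (le0D L1 L2).
clear L1 L2 near_max.
rewrite (laplacianD oD CP CXY Dp) (laplacianD oD CX CY Dp) (laplacianD oD Crr Cii Dp).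
rewrite (laplacian_affine_sq d z0.1 true oD Dp) (laplacian_affine_sq d z0.2 false oD Dp).
rewrite (laplacian_sq oD (r 2) Dp) (laplacian_sq oD (i 2) Dp).
have [-> ->] := hol_laplacian oD hh Dp.
rewrite !mulr0 !addr0 d2.
exact (sq_pos e0).
Unshelve. all: by end_near. Qed.

End MaximumPrinciple.

(** * Division of holomorphic functions by a coordinate *)

Section Division.
Variables (R : realType) (z0 : R * R) (r : R).
Implicit Types (phi : R * R -> R) (g h : R * R -> R[i]) (z u : R * R).
Local Notation Re := complex.Re.
Local Notation Im := complex.Im.
Local Notation B := (ball z0 r).
Local Notation mu := (@lebesgue_measure R).

Lemma radial_mean_ext k phi1 phi2 z : (forall y, B y -> phi1 y = phi2 y) -> B z ->
  radial_mean z0 k phi1 z = radial_mean z0 k phi2 z.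
Proof.
move=> E Bz; apply: eq_Rintegral => t /set_mem; rewrite /= in_itv/= => t01.
by rewrite E//; exact: star_ball.
Qed.

Lemma radial_mean_lin k phi1 phi2 (c1 c2 : R) z :
  (forall y, B y -> {for y, continuous phi1}) ->
  (forall y, B y -> {for y, continuous phi2}) -> B z ->
  radial_mean z0 k (fun y => c1 * phi1 y + c2 * phi2 y) z =
  c1 * radial_mean z0 k phi1 z + c2 * radial_mean z0 k phi2 z.
Proof.
move=> cphi1 cphi2 Bz.
have sB := fun z t => @star_ball R z0 z r t.
have i1 := radial_integrable sB k cphi1 Bz.
have i2 := radial_integrable sB k cphi2 Bz.
rewrite /radial_mean -RintegralZl; [|exact: measurable_itv|exact: i1].
rewrite -RintegralZl; [|exact: measurable_itv|exact: i2].
rewrite -RintegralD; [|exact: measurable_itv| |].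
- by apply: eq_Rintegral => t _; ring.
- apply: (@integrableZl _ _ _ mu _ (measurable_itv _) _ _ i1).
- apply: (@integrableZl _ _ _ mu _ (measurable_itv _) _ _ i2).
Qed.

Definition zc (z0 z : R * R) : R[i] := (z.1 - z0.1) +i* (z.2 - z0.2).

Let CR_eq (x y : R) : (-1 * x + 0 * x) +i* (1 * y + 0 * y) = 'i * (y +i* x).
Proof. by apply: complex_ext => /=; ring. Qed.

Let mul_eq (a1 a2 p q a3 a4 : R) : a1 +i* a2 = (p +i* q) * (a3 +i* a4) ->
  a1 = p * a3 + - q * a4 /\ a2 = q * a3 + p * a4.
Proof. by case=> -> ->; split; ring. Qed.

Let mul_conv (w : R[i]) (p q x y : R) : Re w = p * x + - q * y -> Im w = q * x + p * y ->
  w = (p +i* q) * (x +i* y).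
Proof. by case: w => a b /= -> ->; apply: complex_ext => /=; ring. Qed.

(** The quotient is the mean of the derivative of g over the segment from z0 to
    z. It is holomorphic since the Cauchy-Riemann equations of the derivative
    pass through the integral. *)
Lemma hol_divide g : hol B g -> g z0 = 0 ->
  exists2 h, hol B h & forall z, B z -> g z = zc z0 z * h z.
Proof.
move=> hg g0.
have oB : open B by exact: ball_open.
have sB := fun z t => @star_ball R z0 z r t.
have bB := fun f => @bounded_ball R z0 r f.
have hg' := hol_der oB hg.
have [[ra ib] _] := hg'.
pose a := fun z => Re (cdiff g z (dx R)).
pose b := fun z => Im (cdiff g z (dx R)).
pose h := fun z => radial_mean z0 0 a z +i* radial_mean z0 0 b z.
have Ca n k := @radial_mean_Cn R z0 r n k a ra.
have Cb n k := @radial_mean_Cn R z0 r n k b ib.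
have sh : csm B h by split => n; [exact (Ca n 0%N)|exact (Cb n 0%N)].
have ca y (By : B y) : {for y, continuous a} := CnW (ra 0%N) By.
have cb y (By : B y) : {for y, continuous b} := CnW (ib 0%N) By.
have dE u z (Bz : B z) : cdiff h z u =
    radial_mean z0 1 (fun y => 'D_u a y) z +i* radial_mean z0 1 (fun y => 'D_u b y) z.
  have [_ Ea] := radial_mean_is_derive oB sB bB 0 u (ra 1) Bz.
  have [_ Eb] := radial_mean_is_derive oB sB bB 0 u (ib 1) Bz.
  exact (f_equal2 (@Complex R) Ea Eb).
have cda u y (By : B y) : {for y, continuous (fun y => 'D_u a y)} :=
  CnW (Cn_derive u (ra 1)) By.
have cdb u y (By : B y) : {for y, continuous (fun y => 'D_u b y)} :=
  CnW (Cn_derive u (ib 1)) By.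
have CR y : B y -> 'D_(dy R) a y = -1 * 'D_(dx R) b y + 0 * 'D_(dx R) b y /\
    'D_(dy R) b y = 1 * 'D_(dx R) a y + 0 * 'D_(dx R) a y.
  move=> By; have := hol_cdiff (dy R) oB hg' By; rewrite {1 3}/cdiff -/a -/b.
  move: ('D_(dy R) a y) ('D_(dy R) b y) ('D_(dx R) a y) ('D_(dx R) b y) => a1 a2 a3 a4.
  by rewrite /dy /=; case=> -> ->; split; ring.
exists h; first split => //.
  move=> z Bz; apply: (type10_lin oB sh Bz).
  refine (etrans (dE _ z Bz) (etrans _ (f_equal (fun x => 'i * x) (esym (dE _ z Bz))))).
  have E1 := etrans (radial_mean_ext 1 (fun y By => proj1 (CR y By)) Bz)
    (radial_mean_lin 1 (-1) 0 (cdb (dx R)) (cdb (dx R)) Bz).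
  have E2 := etrans (radial_mean_ext 1 (fun y By => proj2 (CR y By)) Bz)
    (radial_mean_lin 1 1 0 (cda (dx R)) (cda (dx R)) Bz).
  exact (etrans (f_equal2 (@Complex R) E1 E2) (CR_eq _ _)).
move=> z Bz.
have [rg ig] := proj1 hg.
have Dg y : B y -> 'D_(z - z0) (fun w => Re (g w)) y = (z.1 - z0.1) * a y + - (z.2 - z0.2) * b y /\
   'D_(z - z0) (fun w => Im (g w)) y = (z.2 - z0.2) * a y + (z.1 - z0.1) * b y.
  move=> By; have H := hol_cdiff (z - z0) oB hg By; apply: mul_eq.
  have -> : a y +i* b y = cdiff g y (dx R) by rewrite /a /b; case: (cdiff g y (dx R)).
  exact H.
have Er := radial_FTC sB (rg 1) Bz.
have Ei := radial_FTC sB (ig 1) Bz.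
have Er' := etrans (etrans Er (radial_mean_ext 0 (fun y By => proj1 (Dg y By)) Bz))
  (radial_mean_lin 0 _ _ ca cb Bz).
have Ei' := etrans (etrans Ei (radial_mean_ext 0 (fun y By => proj2 (Dg y By)) Bz))
  (radial_mean_lin 0 _ _ ca cb Bz).
rewrite g0 subr0 in Er'; rewrite g0 subr0 in Ei'.
exact (mul_conv Er' Ei').
Qed.

Lemma nsq_zc_le z (s : R) : box z0 s z -> nsq (zc z0 z) <= 2 * s ^+ 2.
Proof.
move=> [h1 h2]; rewrite /nsq /zc /=.
have H (a b : R) : `|a - b| <= s -> (b - a) ^+ 2 <= s ^+ 2.
  move=> ab; rewrite -[_ ^+ 2](real_normK (num_real _)) distrC.
  by apply: lerXn2r => //; rewrite nnegrE//; exact: le_trans ab.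
by have := H _ _ h1; have := H _ _ h2; move=> *; lra.
Qed.

Lemma nsq_zc_ge z (s : R) : `|z0.1 - z.1| = s \/ `|z0.2 - z.2| = s ->
  s ^+ 2 <= nsq (zc z0 z).
Proof.
rewrite /nsq /zc /=.
have H (a b : R) : `|a - b| = s -> (b - a) ^+ 2 = s ^+ 2.
  by move=> <-; rewrite -[LHS](real_normK (num_real _)) distrC.
by case=> /H ->; rewrite ?lerDl ?lerDr sqr_ge0.
Qed.

Lemma nsqX (x : R[i]) n : nsq (x ^+ n) = nsq x ^+ n.
Proof.
elim: n => [|n IH]; last by rewrite !exprS nsqM IH.
by rewrite !expr0 /nsq /= expr1n expr0n addr0.
Qed.

Definition divisible (I : Type) (g : I -> R * R -> R[i]) (n : nat) (h : I -> R * R -> R[i]) :=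
  (forall i, hol B (h i)) /\ forall i z, B z -> g i z = zc z0 z ^+ n * h i z.

(** If all the functions are divisible by all the powers of the coordinate then
    the maximum principle applied to the quotients bounds them by a geometric
    sequence: on the boundary of the box of half-side s the coordinate has
    modulus at least s, and on the box of half-side s / 2 at most s divided by
    the square root of 2. *)
Lemma infinite_order_zero (I : Type) (g : I -> R * R -> R[i]) : 0 < r ->
  (forall i, hol B (g i)) -> (forall n, exists h : I -> R * R -> R[i], divisible g n h) ->
  forall i z, ball z0 (r / 4) z -> g i z = 0.
Proof.
move=> r0 hg Hn i z [z1 z2].
have oB : open B by exact: ball_open.
pose s := r / 2.
have s0 : 0 < s by rewrite divr_gt0.
have sr : s < r by rewrite /s; lra.
have QB : box z0 s `<=` B.
  by move=> y [y1 y2]; split; [exact: le_lt_trans y1 sr|exact: le_lt_trans y2 sr].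
have zs : box z0 (s / 2) z.
  by rewrite /ball/= in z1 z2; split; apply: ltW; [apply: lt_le_trans z1 _|apply: lt_le_trans z2 _]; rewrite /s; lra.
have Qz : box z0 s z.
  by have [y1 y2] := zs; split; [apply: le_trans y1 _|apply: le_trans y2 _]; lra.
have cN : {within box z0 s, continuous (fun y => nsq (g i y))}.
  apply: continuous_in_subspaceT => y /set_mem Qy.
  exact (CnW (Cn_nsq 0 oB (proj1 (hg i))) (QB _ Qy)).
have [p _ maxp] := compact_EVT_max (ex_intro _ z Qz) (@plane_closed_ball_compact R z0 s) cN.
pose M := nsq (g i p).
have MP y : box z0 s y -> nsq (g i y) <= M by move=> Qy; apply: maxp; rewrite inE.
have M0 : 0 <= M by exact: nsq_ge0.
have s20 : 0 < s ^+ 2 by rewrite exprn_gt0.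
have bound n : nsq (g i z) <= M / 2 ^+ n.
  have [h [hh gh]] := Hn n.
  have hb : nsq (h i z) <= M / (s ^+ 2) ^+ n.
    apply: (hol_max_principle oB (hh i) QB _ Qz) => y Qy by_.
    have := MP y Qy; rewrite gh; last exact: QB.
    rewrite nsqM nsqX => MPy.
    rewrite ler_pdivlMr ?exprn_gt0// mulrC (le_trans _ MPy)//.
    apply: ler_wpM2r; first exact: nsq_ge0.
    by apply: lerXn2r; [rewrite nnegrE ltW|rewrite nnegrE nsq_ge0|exact: nsq_zc_ge].
  rewrite gh; last exact: QB.
  rewrite nsqM nsqX.
  have zn : nsq (zc z0 z) <= s ^+ 2 / 2.
    apply: le_trans (nsq_zc_le zs) _.
    by rewrite [leLHS](_ : _ = s ^+ 2 / 2)//; field.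
  have zn' : nsq (zc z0 z) ^+ n <= (s ^+ 2 / 2) ^+ n.
    by apply: lerXn2r; [rewrite nnegrE nsq_ge0|rewrite nnegrE divr_ge0// ltW|].
  have -> : M / 2 ^+ n = (s ^+ 2 / 2) ^+ n * (M / (s ^+ 2) ^+ n).
    rewrite expr_div_n; field.
    by rewrite !expf_neq0// ?gt_eqF.
  by apply: ler_pM => //; [rewrite exprn_ge0 ?nsq_ge0|exact: nsq_ge0].
apply/eqP; rewrite -nsq_eq0 eq_le nsq_ge0 andbT leNgt; apply/negP => N0.
have M1 : 0 < M by apply: lt_le_trans N0 _; have := bound 0; rewrite expr0 divr1.
have [n Hlt] : exists n : nat, M / nsq (g i z) < 2 ^+ n.
  exists (Num.bound (M / nsq (g i z))).
  apply: lt_le_trans (archi_boundP _) _; first by rewrite divr_ge0// ltW.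
  by rewrite -natrX ler_nat ltnW// ltn_expl.
have := bound n; rewrite leNgt => /negP; apply.
by rewrite ltr_pdivrMr ?exprn_gt0// mulrC -ltr_pdivrMr.
Qed.

(** Divide by the coordinate as long as all the functions vanish at z0. Either
    this stops, or they vanish to infinite order. *)
Lemma hol_factor (I : Type) (g : I -> R * R -> R[i]) : 0 < r ->
  (forall i, hol B (g i)) ->
  (forall i z, ball z0 (r / 4) z -> g i z = 0) \/
  exists n (h : I -> R * R -> R[i]), divisible g n h /\ exists i, h i z0 <> 0.
Proof.
move=> r0 hg.
have [ex|nex] := pselect (exists n (h : I -> R * R -> R[i]), divisible g n h /\ exists i, h i z0 <> 0).
  by right.
left; apply: infinite_order_zero => // n.
elim: n => [|n [h [hh gh]]].
  by exists g; split => // i z Bz; rewrite expr0 mul1r.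
have h0 i : h i z0 = 0.
  by apply: contrapT => hi; apply: nex; exists n, h; split; [split|exists i].
have [k kP] := choice (fun i => let: ex_intro2 k a b := hol_divide (hh i) (h0 i) in
   ex_intro (fun k => hol B k /\ forall z, B z -> h i z = zc z0 z * k z) k (conj a b)).
exists k; split => [i|i z Bz]; first by have [] := kP i.
by rewrite gh//; have [_ ->] := kP i => //; rewrite exprSr mulrA.
Qed.

End Division.

(** * The quaternionic Hermitian form *)

Notation "x ^-*" := (conjc x) (at level 1, format "x ^-*") : ring_scope.

Section QuaternionicHermitian.
Variable R : realType.
Local Notation C := R[i].
Local Notation V := 'rV[R[i]]_4.
Implicit Types (v w e y : V) (a b : C).

Lemma conjE (x : R[i]) : Num.conj x = conjc x. Proof. by []. Qed.

Lemma conjcM (x y : R[i]) : (x * y)^-* = x^-* * y^-*. Proof. exact: rmorphM. Qed.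
Lemma conjcD (x y : R[i]) : (x + y)^-* = x^-* + y^-*. Proof. exact: rmorphD. Qed.
Lemma conjcN (x : R[i]) : (- x)^-* = - x^-*. Proof. exact: rmorphN. Qed.

Definition co (v : V) (k : nat) : C := v ord0 (inord k).

(** The two components of the quaternionic pairing: [hm] is the Hermitian form,
    antilinear in its first argument, and [om] is the complex symplectic form
    that defines the contact structure. *)
Definition hm v w : C := (qdot v w).1.
Definition om v w : C := (qdot v w).2.
(** [J] is the antilinear structure map of H^2; the symplectic form is the
    Hermitian form composed with it. *)
Definition J v : V := qscale v (qj R).

Lemma qdotE v w : qdot v w = (hm v w, om v w).
Proof. by rewrite /hm /om; case: (qdot v w). Qed.

Lemma hmE v w : hm v w = (co v 0)^-* * co w 0 + (co v 1)^-* * co w 1 +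
  (co v 2)^-* * co w 2 + (co v 3)^-* * co w 3.
Proof.
rewrite /hm /qdot /qmul /qconj /qfst /qsnd /= ?conjE.
by rewrite -!/(co _ _) !conjcN !mulNr !opprK addrA.
Qed.

Lemma omE v w : om v w = co v 0 * co w 1 - co v 1 * co w 0 +
  (co v 2 * co w 3 - co v 3 * co w 2).
Proof.
rewrite /om /qdot /qmul /qconj /qfst /qsnd /= ?conjE.
by rewrite -!/(co _ _) !conjcK !mulNr.
Qed.

Lemma co_ext v w : co v 0 = co w 0 -> co v 1 = co w 1 -> co v 2 = co w 2 ->
  co v 3 = co w 3 -> v = w.
Proof.
move=> h0 h1 h2 h3; apply/rowP => k; rewrite -(inord_val k).
by case: k => -[|[|[|[|k]]]] //= _.
Qed.

Lemma coE (k : 'I_4) v : v ord0 k = co v k.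
Proof. by rewrite /co inord_val. Qed.

Lemma coD v w k : co (v + w) k = co v k + co w k. Proof. by rewrite /co mxE. Qed.
Lemma coZ a v k : co (a *: v) k = a * co v k. Proof. by rewrite /co mxE. Qed.
Lemma coN v k : co (- v) k = - co v k. Proof. by rewrite /co mxE. Qed.
Lemma co0 k : co 0 k = 0. Proof. by rewrite /co mxE. Qed.

Lemma coJ v : [/\ co (J v) 0 = - (co v 1)^-*, co (J v) 1 = (co v 0)^-*,
  co (J v) 2 = - (co v 3)^-* & co (J v) 3 = (co v 2)^-*].
Proof.
rewrite /co /J /qscale /of_quats /qmul /qj /qfst /qsnd /= ?conjE.
split; rewrite mxE inordK//= ?conjc0 ?mulr0 ?mulr1 ?add0r ?addr0 ?sub0r//.
Qed.

Ltac coords := rewrite ?hmE ?omE ?coD ?coZ ?coN ?co0.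
Ltac Jcoords v := let h := fresh in have h := coJ v; case: h => -> -> -> ->.

Lemma hmC v w : hm w v = (hm v w)^-*.
Proof. by coords; rewrite !conjcD !conjcM !conjcK /=; ring. Qed.

Lemma hmDr v w y : hm v (w + y) = hm v w + hm v y.
Proof. by coords; ring. Qed.
Lemma hmZr a v w : hm v (a *: w) = a * hm v w.
Proof. by coords; ring. Qed.
Lemma hmDl v w y : hm (v + w) y = hm v y + hm w y.
Proof. by rewrite hmC hmDr conjcD -!hmC. Qed.
Lemma hmZl a v w : hm (a *: v) w = a^-* * hm v w.
Proof. by rewrite hmC hmZr conjcM -hmC. Qed.

Lemma omDr v w y : om v (w + y) = om v w + om v y.
Proof. by coords; ring. Qed.
Lemma omZr a v w : om v (a *: w) = a * om v w.
Proof. by coords; ring. Qed.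
Lemma omC v w : om w v = - om v w.
Proof. by coords; ring. Qed.
Lemma omDl v w y : om (v + w) y = om v y + om w y.
Proof. by coords; ring. Qed.
Lemma omZl a v w : om (a *: v) w = a * om v w.
Proof. by coords; ring. Qed.
Lemma omvv v : om v v = 0.
Proof. by coords; ring. Qed.

Lemma hm0r v : hm v 0 = 0. Proof. by coords; ring. Qed.
Lemma om0r v : om v 0 = 0. Proof. by coords; ring. Qed.
Lemma om0l v : om 0 v = 0. Proof. by coords; ring. Qed.
Lemma hmNr v w : hm v (- w) = - hm v w. Proof. by rewrite -scaleN1r hmZr mulN1r. Qed.
Lemma omNr v w : om v (- w) = - om v w. Proof. by rewrite -scaleN1r omZr mulN1r. Qed.

Lemma hmJl v w : hm (J v) w = om v w.
Proof. by rewrite hmE omE; Jcoords v; rewrite !conjcN !conjcK /=; ring. Qed.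
Lemma omJl v w : om (J v) w = - hm v w.
Proof. by rewrite hmE omE; Jcoords v; ring. Qed.
Lemma hmJr v w : hm v (J w) = - (om v w)^-*.
Proof. by rewrite hmC hmJl omC conjcN. Qed.
Lemma omJr v w : om v (J w) = (hm v w)^-*.
Proof. by rewrite omC omJl opprK hmC. Qed.

Lemma JJ v : J (J v) = - v.
Proof.
have [h0 h1 h2 h3] := coJ (J v); have [j0 j1 j2 j3] := coJ v.
by apply: co_ext; rewrite coN ?h0 ?h1 ?h2 ?h3 ?j0 ?j1 ?j2 ?j3 ?conjcN ?conjcK.
Qed.

Lemma JD v w : J (v + w) = J v + J w.
Proof.
have [h0 h1 h2 h3] := coJ (v + w); have [j0 j1 j2 j3] := coJ v; have [k0 k1 k2 k3] := coJ w.
by apply: co_ext; rewrite [RHS]coD ?h0 ?h1 ?h2 ?h3 ?j0 ?j1 ?j2 ?j3 ?k0 ?k1 ?k2 ?k3 coD ?conjcD ?opprD.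
Qed.

Lemma JZ a v : J (a *: v) = a^-* *: J v.
Proof.
have [h0 h1 h2 h3] := coJ (a *: v); have [j0 j1 j2 j3] := coJ v.
by apply: co_ext; rewrite [RHS]coZ ?h0 ?h1 ?h2 ?h3 ?j0 ?j1 ?j2 ?j3 coZ ?conjcM ?mulrN.
Qed.

Lemma J0 : J 0 = 0.
Proof. by rewrite -(scale0r 0) JZ conjc0 !scale0r. Qed.

Definition nv v : R := complex.Re (hm v v).

Lemma conjM a : a^-* * a = (complex.Re a ^+ 2 + complex.Im a ^+ 2)%:C.
Proof. by case: a => x y; apply/eqP; rewrite eq_complex /=; apply/andP; split; apply/eqP; ring. Qed.

Lemma hmvv v : hm v v = (nv v)%:C.
Proof.
have : exists r : R, hm v v = r%:C.
  rewrite hmE !conjM -!rmorphD /=; eexists; reflexivity.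
by move=> [r E]; rewrite /nv E.
Qed.

Lemma nv_ge0 v : 0 <= nv v.
Proof. by rewrite /nv hmE !conjM -!rmorphD /= !addr_ge0 ?sqr_ge0. Qed.

Lemma nv_eq0 v : (nv v == 0) = (v == 0).
Proof.
apply/eqP/eqP => [|->]; last by rewrite /nv hm0r.
rewrite /nv hmE !conjM -!rmorphD /=.
have H a : 0 <= complex.Re a ^+ 2 + complex.Im a ^+ 2 by rewrite addr_ge0 ?sqr_ge0.
have Z a : complex.Re a ^+ 2 + complex.Im a ^+ 2 = 0 -> a = 0.
  case: a => x y /= /eqP; rewrite paddr_eq0 ?sqr_ge0// !sqrf_eq0.
  by move=> /andP[/eqP -> /eqP ->].
move: (H (co v 0)) (H (co v 1)) (H (co v 2)) (H (co v 3)).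
move: (Z (co v 0)) (Z (co v 1)) (Z (co v 2)) (Z (co v 3)).
move: (_ + _) (_ + _) (_ + _) (_ + _) => n0 n1 n2 n3 h0 h1 h2 h3 *.
by apply: co_ext; rewrite co0; [apply: h0|apply: h1|apply: h2|apply: h3]; lra.
Qed.

Lemma nv_gt0 v : v != 0 -> 0 < nv v.
Proof. by move=> v0; rewrite lt_neqAle nv_ge0 andbT eq_sym nv_eq0. Qed.

Lemma hmvv_neq0 v : v != 0 -> hm v v != 0.
Proof. by move=> v0; rewrite hmvv eq_complex /= eqxx andbT nv_eq0. Qed.

Lemma J_eq0 v : (J v == 0) = (v == 0).
Proof.
apply/eqP/eqP => [E|->]; last exact: J0.
by rewrite -[v]opprK -(JJ v) E J0 oppr0.
Qed.

Lemma is_frameP e y : is_frame (e, y) <-> [/\ hm e e = 1, hm y y = 1, hm e y = 0 & om e y = 0].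
Proof.
rewrite /is_frame /= !qdotE /qone !omvv; split.
  by move=> [[->] [->] [-> ->]].
by move=> [-> -> -> ->].
Qed.

Lemma mx_hm m n (A : 'M[C]_(m, 4)) (B : 'M[C]_(n, 4)) i j :
  (A *m hconj B) i j = hm (row j B) (row i A).
Proof.
rewrite mxE hmE 4!big_ord_recl big_ord0 addr0 !addrA.
congr (_ + _ + _ + _); rewrite /hconj /co !mxE mulrC; congr (_^-* * _);
  by congr (_ _ _); apply: val_inj; rewrite /= inordK.
Qed.

(** A frame together with its j-multiples is a unitary basis of C^4. *)
Lemma frame_expand e y w : is_frame (e, y) ->
  w = hm e w *: e + om e w *: J e + (hm y w *: y + om y w *: J y).
Proof.
move=> /is_frameP[ee yy ey ey'].
pose r (k : 'I_4) : V := [:: e; J e; y; J y]`_k.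
pose F : 'M[C]_4 := \matrix_k r k.
have rF k : row k F = r k by rewrite rowK.
have ye : hm y e = 0 by rewrite hmC ey conjc0.
have ye' : om y e = 0 by rewrite omC ey' oppr0.
have FF : F *m hconj F = 1%:M.
  apply/matrixP => i j; rewrite mx_hm !rF mxE /r.
  case: i => -[|[|[|[|//]]]] hi; case: j => -[|[|[|[|//]]]] hj /=;
    rewrite ?hmJl ?hmJr ?omJr ?omvv ?ee ?yy ?ey ?ey' ?ye ?ye' ?conjc0 ?conjc1 ?oppr0 //.
rewrite -[LHS]mulmx1 -(mulmx1C FF) mulmxA mulmx_sum_row.
rewrite 4!big_ord_recl big_ord0 addr0 !addrA !rF !mx_hm !rF /r /=.
by rewrite !row_id !hmJl.
Qed.

End QuaternionicHermitian.

(** * The horizontal bundle and the contraction with the tautological line *)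

Section Subspaces.
Variable R : realType.
Local Notation C := R[i].
Local Notation V := 'rV[R[i]]_4.
Implicit Types (v w e y : V) (a b : C).

Lemma hconjD m n (A B : 'M[C]_(m, n)) : hconj (A + B) = hconj A + hconj B.
Proof. by apply/matrixP => i j; rewrite !mxE conjcD. Qed.

Lemma hconjZ m n a (A : 'M[C]_(m, n)) : hconj (a *: A) = a^-* *: hconj A.
Proof. by apply/matrixP => i j; rewrite !mxE conjcM. Qed.

Lemma hconj0 m n : hconj (0 : 'M[C]_(m, n)) = 0.
Proof. by apply/matrixP => i j; rewrite !mxE conjc0. Qed.

Lemma hconjK m n (A : 'M[C]_(m, n)) : hconj (hconj A) = A.
Proof. by apply/matrixP => i j; rewrite !mxE conjcK. Qed.

Lemma hconjM m n p (A : 'M[C]_(m, n)) (B : 'M[C]_(n, p)) :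
  hconj (A *m B) = hconj B *m hconj A.
Proof.
apply/matrixP => i j; rewrite !mxE rmorph_sum.
by apply: eq_bigr => k _; rewrite !mxE rmorphM mulrC.
Qed.

Lemma hconj_sum m n (I : Type) (s : seq I) (F : I -> 'M[C]_(m, n)) :
  hconj (\sum_(i <- s) F i) = \sum_(i <- s) hconj (F i).
Proof.
by elim: s => [|i s IH]; rewrite ?big_nil ?hconj0// !big_cons hconjD IH.
Qed.

Lemma mul_row_hm v w : v *m hconj w = (hm w v)%:M.
Proof.
by apply/matrixP => i j; rewrite !ord1 mx_hm !row_id mxE mulr1n.
Qed.

(** The definition tests orthogonality on a basis only. *)
Lemma mem_hcompl m n (U : {vspace 'M[C]_(m, n)}) A :
  A \in hcompl U <-> forall B, B \in U -> \tr (A *m hconj B) = 0.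
Proof.
have lin (B : 'M[C]_(m, n)) : linear (fun A : 'M[C]_(m, n) => \tr (A *m hconj B) : C^o).
  by move=> k A1 A2; rewrite mulmxDl -scalemxAl mxtraceD mxtraceZ.
have funE (B : 'M[C]_(m, n)) A' :
    linfun (fun A => \tr (A *m hconj B) : C^o) A' = \tr (A' *m hconj B).
  exact: (lfunE (HB.pack_for {linear 'M[C]_(m, n) -> C^o} (fun A => \tr (A *m hconj B) : C^o)
    (GRing.isLinear.Build _ _ _ _ _ (lin B))) A').
have capE (s : seq 'M[C]_(m, n)) :
    A \in (\bigcap_(B <- s) lker (linfun (fun A => \tr (A *m hconj B) : C^o)))%VS <->
    forall B, B \in s -> \tr (A *m hconj B) = 0.
  elim: s => [|B s IH]; first by rewrite big_nil memvf; split.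
  rewrite big_cons memv_cap memv_ker funE; split.
    by move=> /andP[/eqP H /IH Hs] B'; rewrite inE => /orP[/eqP ->|/Hs].
  move=> H; apply/andP; split; first by rewrite H ?mem_head.
  by apply/IH => B' B's; apply: H; rewrite inE B's orbT.
split=> [/capE H B /coord_vbasis ->|H]; last first.
  by apply/capE => B /vbasis_mem; exact: H.
rewrite hconj_sum mulmx_sumr raddf_sum big1// => i _.
by rewrite /= hconjZ -scalemxAr mxtraceZ H ?mulr0// mem_nth// size_tuple.
Qed.

Lemma span_eq_line (T : vectType C) (s : seq T) (x : T) : x != 0 ->
  {subset s <= <[x]>%VS} -> (exists2 y, y \in s & y != 0) -> span s = <[x]>%VS.
Proof.
move=> x0 sx [y ys y0]; apply/eqP; rewrite eqEsubv; apply/andP; split.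
  exact/span_subvP.
have /vlineP[k E] := sx y ys.
have k0 : k != 0 by apply: contraNneq y0 => k0; rewrite E k0 scale0r.
rewrite -memvE; have -> : x = k^-1 *: y by rewrite E scalerA mulVf// scale1r.
exact/memvZ/memv_span.
Qed.

Lemma vbasis_neq0 (T : vectType C) (U : {vspace T}) : U != 0%VS ->
  exists2 y, y \in (vbasis U : seq T) & y != 0.
Proof.
move=> U0; exists (vbasis U)`_0.
  by rewrite mem_nth// size_tuple lt0n dimv_eq0.
have := vbasisP U; move/basis_free => fr.
by apply: (free_not0 fr); rewrite mem_nth// size_tuple lt0n dimv_eq0.
Qed.

Section Fibre.
Variables (l : CP3 R) (e : V).
Hypothesis le : val l = <[e]>%VS.

Lemma mem_Qtilde w : w \in Qtilde l <-> hm e w = 0 /\ om e w = 0.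
Proof.
rewrite /Qtilde mem_hcompl.
have trE v : \tr (w *m hconj v) = hm v w by rewrite mul_row_hm mxtrace_scalar mulr1n.
split.
  move=> H; have el : e \in val l by rewrite le memv_line.
  split; first by rewrite -trE H// memvE (subv_trans _ (addvSl _ _))// -memvE.
  rewrite -hmJl -trE H// memvE (subv_trans _ (addvSr _ _))// -memvE.
  have -> : J e = \sum_(i < \dim (val l)) (coord (vbasis (val l)) i e)^-* *: J (vbasis (val l))`_i.
    rewrite {1}(coord_vbasis el).
    elim/big_ind2: _ => [|x1 x2 y1 y2 <- <-|i _]; [exact: J0|exact: JD|exact: JZ].
  apply: memv_suml => i _; apply/memvZ/memv_span/map_f.
  by rewrite mem_nth// size_tuple.
move=> [h o] B /memv_addP[v vl [u ul ->]].
rewrite trE hmDl.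
move: vl; rewrite le => /vlineP[a ->]; rewrite hmZl h mulr0 add0r.
suff /vlineP[b ->] : u \in <[J e]>%VS by rewrite hmZl hmJl o mulr0.
move: u ul; apply/subvP/span_subvP => u /mapP[v' /vbasis_mem].
by rewrite le => /vlineP[c ->] ->; rewrite -/(J _) JZ memvZ// memv_line.
Qed.

Lemma mem_horizontal A : A \in horizontal l <-> exists2 w, w \in Qtilde l & A = hconj e *m w.
Proof.
rewrite /horizontal; split.
  have lin : linear (fun w : V => hconj e *m w) by move=> k x y; rewrite mulmxDr scalemxAr.
  pose F : {linear V -> 'M[C]_4} := HB.pack (fun w : V => hconj e *m w) (GRing.isLinear.Build _ _ _ _ _ lin).
  suff S : (<<[seq hconj v *m w | v <- vbasis (val l), w <- vbasis (Qtilde l)]>> <= linfun F @: Qtilde l)%VS.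
    by move=> /(subvP S) /memv_imgP[w wQ ->]; exists w => //; rewrite lfunE.
  apply/span_subvP => B /allpairsP[[v w] /= [/vbasis_mem + /vbasis_mem wQ ->]].
  rewrite le => /vlineP[c ->]; rewrite hconjZ -scalemxAl scalemxAr.
  have -> : hconj e *m (c^-* *: w) = linfun F (c^-* *: w) by rewrite lfunE.
  by apply/memv_img/memvZ.
move=> [w wQ ->].
have el : e \in val l by rewrite le memv_line.
rewrite (coord_vbasis el) (coord_vbasis wQ) hconj_sum mulmx_suml.
apply: memv_suml => i _; rewrite mulmx_sumr; apply: memv_suml => j _.
rewrite hconjZ -scalemxAl -scalemxAr; apply/memvZ/memvZ/memv_span.
by apply: allpairs_f; rewrite mem_nth// size_tuple.
Qed.

(** The contraction of N (x) l into C^4, where N is the complement of an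
    arbitrary L in the horizontal space, so that it can be compared for two
    choices of L. *)
Definition tensor_line (l : CP3 R) (L : {vspace 'M[C]_4}) : CP3 R :=
  insubd l <<[seq v *m n | v <- vbasis (val l), n <- vbasis (horizontal l :&: hcompl L)%VS]>>%VS.

Lemma line_neq0 : e != 0.
Proof.
by have := valP l; rewrite le dim_vline; case: (e != 0).
Qed.

Hypothesis ee : hm e e = 1.

Lemma ehe (y : V) : e *m (hconj e *m y) = y.
Proof. by rewrite mulmxA mul_row_hm ee mul1mx. Qed.

Lemma trace_horizontal y w : \tr (hconj e *m y *m hconj (hconj e *m w)) = hm w y.
Proof.
rewrite hconjM hconjK -mulmxA mxtrace_mulC mulmxA mul_row_hm -mulmxA mul_row_hm ee mulmx1.
by rewrite mxtrace_scalar mulr1n.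
Qed.

(** In the quaternionic line orthogonal to e H the Hermitian complement of w C
    is w j C. *)
Lemma tensor_lineE w : w != 0 -> hm e w = 0 -> om e w = 0 ->
  val (tensor_line l <[hconj e *m w]>%VS) = <[J w]>%VS.
Proof.
move=> w0 ew ew'.
have nw0 : nv w != 0 by rewrite nv_eq0.
pose c : C := (Num.sqrt (nv w))^-1%:C.
have cw : is_frame (e, c *: w).
  apply/is_frameP; split=> //; rewrite ?hmZr ?omZr ?ew ?ew' ?mulr0//.
  rewrite hmZl hmvv /c conjc_real -!rmorphM /= mulrA -invfM -expr2 sqr_sqrtr ?nv_ge0//.
  by rewrite mulVf.
have c0 : c != 0.
  by rewrite /c eq_complex /= eqxx andbT invr_eq0 sqrtr_eq0 -ltNge nv_gt0.
have Jw0 : J w != 0 by rewrite J_eq0.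
have hJw : hm e (J w) = 0 by rewrite hmJr ew' conjc0 oppr0.
have oJw : om e (J w) = 0 by rewrite omJr ew conjc0.
have eJw0 : hconj e *m J w != 0.
  by apply: contraNneq Jw0 => E; rewrite -(ehe (J w)) E mulmx0.
have NE A : A \in (horizontal l :&: hcompl <[hconj e *m w]>)%VS <-> A \in <[hconj e *m J w]>%VS.
  rewrite memv_cap; split.
    move=> /andP[/mem_horizontal[y yQ ->] /mem_hcompl H].
    have wy : hm w y = 0 by rewrite -trace_horizontal H// memv_line.
    have [ey ey'] := (iffLR (mem_Qtilde y)) yQ.
    rewrite (frame_expand y cw) ey ey' !scale0r !add0r hmZl wy mulr0 scale0r add0r JZ scalerA.
    by rewrite -scalemxAr memvZ// memv_line.
  move=> /vlineP[k ->]; apply/andP; split; first apply: memvZ.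
    by apply/mem_horizontal; exists (J w) => //; apply/mem_Qtilde.
  apply/mem_hcompl => B /vlineP[k' ->].
  rewrite hconjZ -scalemxAl -scalemxAr !mxtraceZ trace_horizontal hmJr omvv conjc0 oppr0 !mulr0//.
have spanE : <<[seq v *m n | v <- vbasis (val l),
    n <- vbasis (horizontal l :&: hcompl <[hconj e *m w]>)%VS]>>%VS = <[J w]>%VS.
  apply: span_eq_line => //.
    move=> x /allpairsP[[v n] /= [/vbasis_mem + /vbasis_mem/NE/vlineP[k ->] ->]].
    by rewrite le => /vlineP[k' ->]; rewrite -scalemxAl -scalemxAr ehe !memvZ// memv_line.
  have [v vl v0] : exists2 y, y \in (vbasis (val l) : seq V) & y != 0.
    by apply: vbasis_neq0; rewrite le -dimv_eq0 dim_vline line_neq0.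
  have [n nN n0] : exists2 y, y \in (vbasis (horizontal l :&: hcompl <[hconj e *m w]>)%VS : seq 'M[C]_4) & y != 0.
    apply: vbasis_neq0; apply/eqP => E.
    have := (iffRL (NE (hconj e *m J w))) (memv_line _).
    by rewrite E memv0 (negbTE eJw0).
  exists (v *m n); first by apply/allpairsP; exists (v, n).
  move: v0 n0; have := vbasis_mem nN => /NE/vlineP[k ->].
  have := vbasis_mem vl; rewrite le => /vlineP[k' ->].
  rewrite scaler_eq0 negb_or => /andP[k'0 _]; rewrite scaler_eq0 negb_or => /andP[k0 _].
  by rewrite -scalemxAl -scalemxAr ehe !scaler_eq0 !negb_or k0 k'0.
by rewrite /tensor_line spanE insubdK// unfold_in dim_vline Jw0.
Qed.

End Fibre.

End Subspaces.

(** * Differentiation of vector-valued functions *)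

Section VectorCalculus.
Variable R : realType.
Local Notation C := R[i].
Local Notation V := 'rV[R[i]]_4.
Implicit Types (D : set (R * R)) (v w : R * R -> V) (a : R * R -> C) (z u : R * R).

Definition rder v z u := forall k, cderivable (fun y => v y ord0 k) z u.
Definition rsm D v := forall k, csm D (fun y => v y ord0 k).

Lemma rsmP D v : rsmooth_on D v <-> rsm D v.
Proof. by split=> H k; apply/csmoothP; exact: H. Qed.

Lemma rsm_der D v z u : rsm D v -> D z -> rder v z u.
Proof. by move=> sv Dz k; exact (csm_der u (sv k) Dz). Qed.

Lemma rsm_sub D D' v : D' `<=` D -> rsm D v -> rsm D' v.
Proof. by move=> sD sv k; exact (csm_sub sD (sv k)). Qed.

Lemma hol_rsm D v : (forall l, hol D (fun y => v y ord0 l)) -> rsm D v.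
Proof. by move=> hv l; have [] := hv l. Qed.

Lemma rdiffE v z u k : rdiff v z u ord0 k = cdiff (fun y => v y ord0 k) z u.
Proof. by rewrite mxE. Qed.

Lemma rdiff_eq v z u (d : V) :
  (forall k, cderivable (fun y => v y ord0 k) z u /\ cdiff (fun y => v y ord0 k) z u = d ord0 k) ->
  rder v z u /\ rdiff v z u = d.
Proof.
move=> H; split; first by move=> k; have [] := H k.
by apply/rowP => k; rewrite rdiffE; have [] := H k.
Qed.

Lemma rdiffZ a v z u : cderivable a z u -> rder v z u ->
  rder (fun y => a y *: v y) z u /\
  rdiff (fun y => a y *: v y) z u = a z *: rdiff v z u + cdiff a z u *: v z.
Proof.
move=> da dv; apply: rdiff_eq => k.
have -> : (fun y => (a y *: v y) ord0 k) = (fun y => a y * v y ord0 k).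
  by apply/funext => y; rewrite mxE.
have [h ->] := cdiffM da (dv k); split; first exact h.
by rewrite !mxE -rdiffE mxE [v z _ _ * _]mulrC.
Qed.

Lemma rdiffD v w z u : rder v z u -> rder w z u ->
  rder (fun y => v y + w y) z u /\
  rdiff (fun y => v y + w y) z u = rdiff v z u + rdiff w z u.
Proof.
move=> dv dw; apply: rdiff_eq => k.
have -> : (fun y => (v y + w y) ord0 k) = (fun y => v y ord0 k + w y ord0 k).
  by apply/funext => y; rewrite mxE.
have [h ->] := cdiffD (dv k) (dw k); split; first exact h.
by rewrite !mxE.
Qed.

Lemma cdiff_co v z u k : rder v z u -> cderivable (fun y => co (v y) k) z u /\
  cdiff (fun y => co (v y) k) z u = co (rdiff v z u) k.
Proof. by move=> dv; split; [exact (dv (inord k))|rewrite /co rdiffE]. Qed.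

(** In coordinates J is a conjugation followed by a signed permutation, so it
    commutes with differentiation. *)
Lemma J_coord (k : 'I_4) : exists j s, forall x : V, J x ord0 k = s * (x ord0 j)^-*.
Proof.
case: k => -[|[|[|[|//]]]] hk; [exists (inord 1), (-1)|exists (inord 0), 1
  |exists (inord 3), (-1)|exists (inord 2), 1] => x;
  by have [h0 h1 h2 h3] := coJ x; rewrite coE /= ?(h0, h1, h2, h3) ?mulN1r ?mul1r.
Qed.

Lemma rdiffJ v z u : rder v z u ->
  rder (fun y => J (v y)) z u /\ rdiff (fun y => J (v y)) z u = J (rdiff v z u).
Proof.
move=> dv; apply: rdiff_eq => k; have [j [s Jk]] := J_coord k.
have -> : (fun y => J (v y) ord0 k) = (fun y => s * (v y ord0 j)^-*).
  by apply/funext => y; rewrite Jk.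
have [d0 E0] := cdiff_cst s z u; have [d1 E1] := cdiffJ (dv j).
have [d2 E2] := cdiffM d0 d1; split; first exact d2.
by rewrite Jk rdiffE E2 E1 E0 mulr0 addr0.
Qed.

Lemma cdiff_om v w z u : rder v z u -> rder w z u ->
  cderivable (fun y => om (v y) (w y)) z u /\
  cdiff (fun y => om (v y) (w y)) z u = om (rdiff v z u) (w z) + om (v z) (rdiff w z u).
Proof.
move=> dv dw.
have dM i j : cderivable (fun y => co (v y) i * co (w y) j) z u /\
    cdiff (fun y => co (v y) i * co (w y) j) z u =
    co (v z) i * co (rdiff w z u) j + co (w z) j * co (rdiff v z u) i.
  have [h1 h2] := cdiff_co i dv; have [h3 h4] := cdiff_co j dw.
  by have [h5 h6] := cdiffM h1 h3; split; [exact h5|rewrite h6 h2 h4].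
have dB i j : cderivable (fun y => co (v y) i * co (w y) j - co (v y) j * co (w y) i) z u /\
    cdiff (fun y => co (v y) i * co (w y) j - co (v y) j * co (w y) i) z u =
    co (v z) i * co (rdiff w z u) j + co (w z) j * co (rdiff v z u) i
    - (co (v z) j * co (rdiff w z u) i + co (w z) i * co (rdiff v z u) j).
  have [h1 h2] := dM i j; have [h3 h4] := dM j i; have [h5 h6] := cdiffN h3.
  by have [h7 h8] := cdiffD h1 h5; split; [exact h7|rewrite h8 h6 h2 h4].
have -> : (fun y => om (v y) (w y)) =
  (fun y => co (v y) 0 * co (w y) 1 - co (v y) 1 * co (w y) 0 +
  (co (v y) 2 * co (w y) 3 - co (v y) 3 * co (w y) 2)).
  by apply/funext => y; rewrite omE.
have [h1 h2] := dB 0%N 1%N; have [h3 h4] := dB 2%N 3%N.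
have [h5 h6] := cdiffD h1 h3; split; first exact h5.
by rewrite h6 h2 h4 !omE; ring.
Qed.

Lemma cdiff_hm v w z u : rder v z u -> rder w z u ->
  cderivable (fun y => hm (v y) (w y)) z u /\
  cdiff (fun y => hm (v y) (w y)) z u = hm (rdiff v z u) (w z) + hm (v z) (rdiff w z u).
Proof.
move=> dv dw; have [h1 h2] := rdiffJ dv.
have -> : (fun y => hm (v y) (w y)) = (fun y => - om (J (v y)) (w y)).
  by apply/funext => y; rewrite omJl opprK.
have [h3 h4] := cdiff_om h1 dw; have [h5 h6] := cdiffN h3; split; first exact h5.
by rewrite h6 h4 h2 !omJl -opprD opprK.
Qed.

Lemma rsmZ D a v : open D -> csm D a -> rsm D v -> rsm D (fun y => a y *: v y).
Proof.
move=> oD sa sv k.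
have -> : (fun y => (a y *: v y) ord0 k) = (fun y => a y * v y ord0 k).
  by apply/funext => y; rewrite mxE.
exact (csmM oD sa (sv k)).
Qed.

Lemma rsmD D v w : open D -> rsm D v -> rsm D w -> rsm D (fun y => v y + w y).
Proof.
move=> oD sv sw k.
have -> : (fun y => (v y + w y) ord0 k) = (fun y => v y ord0 k + w y ord0 k).
  by apply/funext => y; rewrite mxE.
exact (csmD oD (sv k) (sw k)).
Qed.

Lemma rsmJ D v : open D -> rsm D v -> rsm D (fun y => J (v y)).
Proof.
move=> oD sv k; have [j [s Jk]] := J_coord k.
have -> : (fun y => J (v y) ord0 k) = (fun y => s * (v y ord0 j)^-*).
  by apply/funext => y; rewrite Jk.
exact (csmM oD (csm_cst s oD) (csmJ oD (sv j))).
Qed.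

Lemma csm_om D v w : open D -> rsm D v -> rsm D w -> csm D (fun y => om (v y) (w y)).
Proof.
move=> oD sv sw.
have -> : (fun y => om (v y) (w y)) =
  (fun y => co (v y) 0 * co (w y) 1 - co (v y) 1 * co (w y) 0 +
  (co (v y) 2 * co (w y) 3 - co (v y) 3 * co (w y) 2)).
  by apply/funext => y; rewrite omE.
have sM i j : csm D (fun y => co (v y) i * co (w y) j) by exact (csmM oD (sv _) (sw _)).
have sB i j := csmD oD (sM i j) (csmN oD (sM j i)).
exact (csmD oD (sB 0%N 1%N) (sB 2%N 3%N)).
Qed.

Lemma csm_hm D v w : open D -> rsm D v -> rsm D w -> csm D (fun y => hm (v y) (w y)).
Proof.
move=> oD sv sw.
have -> : (fun y => hm (v y) (w y)) = (fun y => - om (J (v y)) (w y)).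
  by apply/funext => y; rewrite omJl opprK.
exact (csmN oD (csm_om oD (rsmJ oD sv) sw)).
Qed.

Lemma Cn_nv D v n : open D -> rsm D v -> Cn n D (fun y => nv (v y)).
Proof. by move=> oD sv; have [h _] := csm_hm oD sv sv; exact (h n). Qed.

Definition nrm (x : V) : R := Num.sqrt (nv x).

Lemma Cn_nrm D v n : open D -> (forall z, D z -> v z != 0) -> rsm D v ->
  Cn n D (fun y => nrm (v y)).
Proof. by move=> oD v0 sv; apply: Cn_sqrt (Cn_nv n oD sv) => // z Dz; rewrite nv_gt0// v0. Qed.

Lemma csm_nrm D v : open D -> (forall z, D z -> v z != 0) -> rsm D v ->
  csm D (fun y => (nrm (v y))%:C).
Proof. by move=> oD v0 sv; exact (csm_real oD (fun n => Cn_nrm n oD v0 sv)). Qed.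

Lemma nrm_gt0 (x : V) : x != 0 -> 0 < nrm x.
Proof. by move=> x0; rewrite sqrtr_gt0 nv_gt0. Qed.

Lemma nrmC_neq0 (x : V) : x != 0 -> (nrm x)%:C != 0 :> C.
Proof. by move=> x0; rewrite eq_complex /= eqxx andbT gt_eqF// nrm_gt0. Qed.

Lemma nrm_sqr (x : V) : (nrm x)%:C * (nrm x)%:C = hm x x.
Proof. by rewrite hmvv -rmorphM -expr2 sqr_sqrtr// nv_ge0. Qed.

Definition unitize (x : V) : V := ((nrm x)%:C)^-1 *: x.

Lemma rsm_unitize D v : open D -> (forall z, D z -> v z != 0) -> rsm D v ->
  rsm D (fun y => unitize (v y)).
Proof.
move=> oD v0 sv; apply: (rsmZ oD _ sv).
by apply: csmV (csm_nrm oD v0 sv) => // z Dz; rewrite nrmC_neq0// v0.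
Qed.

Lemma hm_unitize (x : V) : x != 0 -> hm (unitize x) (unitize x) = 1.
Proof.
move=> x0; rewrite hmZl hmZr conjc_inv conjc_real -nrm_sqr.
by field; exact: nrmC_neq0.
Qed.

Lemma vline_scale (T : vectType C) (x : T) (k : C) : k != 0 -> <[k *: x]>%VS = <[x]>%VS.
Proof.
move=> k0; apply/eqP; rewrite eqEsubv -!memvE memvZ ?memv_line//=.
have E : x = k^-1 *: (k *: x) by rewrite scalerA mulVf// scale1r.
by rewrite [X in X \in _]E memvZ ?memv_line.
Qed.

Lemma vline_unitize (x : V) : x != 0 -> <[unitize x]>%VS = <[x]>%VS.
Proof. by move=> x0; rewrite vline_scale// invr_eq0 nrmC_neq0. Qed.

Lemma vline_eq (x y : V) : x != 0 -> <[x]>%VS = <[y]>%VS -> exists2 k : C, k != 0 & x = k *: y.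
Proof.
move=> x0 E; have : x \in <[y]>%VS by rewrite -E memv_line.
move=> /vlineP[k Ek]; exists k => //; apply: contraNneq x0 => k0.
by rewrite Ek k0 scale0r.
Qed.

End VectorCalculus.

(** * Jets of lifts and changes of charts *)

Section Jets.
Variable R : realType.
Local Notation C := R[i].
Local Notation V := 'rV[R[i]]_4.
Implicit Types (D : set (R * R)) (v w : R * R -> V) (a : R * R -> C) (z u p q : R * R).

(** The first order jets of v at p and of v' at q represent, up to a change of
    complex coordinate with differential A, the same jet of a map to projective
    space. *)
Definition same_jet v p v' q : Prop := exists (k : C) (A : R * R -> R * R) (m : R * R -> C),
  [/\ k != 0, v' q = k *: v p, forall u, A (iplane u) = iplane (A u) &
    forall u, rdiff v' q u = k *: rdiff v p (A u) + m u *: v p].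

Lemma complex_chain D g (phi : R * R -> R * R) z u : open D -> csm D g -> D (phi z) ->
  differentiable (fun y => (phi y).1) z -> differentiable (fun y => (phi y).2) z ->
  cderivable (fun y => g (phi y)) z u /\
  cdiff (fun y => g (phi y)) z u =
  cdiff g (phi z) ('D_u (fun y => (phi y).1) z, 'D_u (fun y => (phi y).2) z).
Proof.
move=> oD [r i] Dz d1 d2.
have hr := chain_rule u oD (r 1%N) Dz d1 d2.
have hi := chain_rule u oD (i 1%N) Dz d1 d2.
exact (@cdiff_eq R (fun y => g (phi y)) z u _ _ hr hi).
Qed.

Lemma minors_of_line (x y : V) (i j : 'I_4) : (exists k, y = k *: x) ->
  y ord0 i * x ord0 j - y ord0 j * x ord0 i = 0.
Proof. by move=> [k ->]; rewrite !mxE; ring. Qed.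

Lemma neq0_coord (x : V) : x != 0 -> exists k, x ord0 k != 0.
Proof.
move=> x0; apply: contrapT => H; move/eqP: x0; apply.
apply/rowP => k; rewrite mxE; apply/eqP.
by apply: contrapT => /negP nk; apply: H; exists k.
Qed.

(** The 2x2 minors of (v o phi, v') vanish near q; differentiating them
    determines the derivative of v' up to a multiple of v. *)
Lemma same_jet_comp D v v' (phi : R * R -> R * R) q : open D -> rsm D v -> D (phi q) ->
  v (phi q) != 0 -> v' q != 0 -> (forall u, rder v' q u) ->
  differentiable (fun y => (phi y).1) q -> differentiable (fun y => (phi y).2) q ->
  type10 (cdiff (fun y => (phi y).1 +i* (phi y).2) q) ->
  (\near q, exists k, v' q = k *: v (phi q)) ->
  same_jet v (phi q) v' q.
Proof.
move=> oD sv Dp v0 v'0 dv' d1 d2 tphi n.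
pose A u := ('D_u (fun y => (phi y).1) q, 'D_u (fun y => (phi y).2) q).
have AI u : A (iplane u) = iplane (A u).
  have := tphi u; rewrite /cdiff /= => -[h1 h2].
  by rewrite /A h1 h2 /iplane /=; congr (_, _); ring.
have dchain u k : cderivable (fun y => v (phi y) ord0 k) q u /\
    cdiff (fun y => v (phi y) ord0 k) q u = rdiff v (phi q) (A u) ord0 k.
  have [h1 h2] := complex_chain u oD (sv k) Dp d1 d2.
  by split; [exact h1|rewrite rdiffE h2].
have [k Ek] := nbhs_singleton n.
have k0 : k != 0 by apply: contraNneq v'0 => k0; rewrite Ek k0 scale0r.
have [j vj] := neq0_coord v0.
exists k, A, (fun u => (rdiff v' q u ord0 j - k * rdiff v (phi q) (A u) ord0 j) / v (phi q) ord0 j).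
split => // u; apply/rowP => i; rewrite [RHS]mxE [X in X + _]mxE [X in _ + X]mxE.
have mz : \near q, v' q ord0 i * v (phi q) ord0 j - v' q ord0 j * v (phi q) ord0 i = 0.
  near=> y; apply: minors_of_line; near: y; exact n.
have [_ E] := cdiff_near u mz.
have [_ E0] := cdiff_cst (0 : C) q u; rewrite E0 in E.
have M (a b : 'I_4) : cderivable (fun y => v' y ord0 a * v (phi y) ord0 b) q u /\
    cdiff (fun y => v' y ord0 a * v (phi y) ord0 b) q u =
    v' q ord0 a * rdiff v (phi q) (A u) ord0 b + v (phi q) ord0 b * rdiff v' q u ord0 a.
  have [h1 h2] := dchain u b; have [h3 h4] := cdiffM (dv' u a) h1.
  split; first exact h3.
  by rewrite h4 h2; congr (_ + _ * _); exact (esym (rdiffE v' q u a)).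
have [h1 h2] := M i j; have [h3 h4] := M j i; have [h5 h6] := cdiffN h3.
have [_ h8] := cdiffD h1 h5.
rewrite h8 h6 h2 h4 in E.
have Ei : v' q ord0 i = k * v (phi q) ord0 i by rewrite Ek mxE.
have Ej : v' q ord0 j = k * v (phi q) ord0 j by rewrite Ek mxE.
rewrite Ei Ej in E.
move: E vj; move: (rdiff v' q u ord0 i) (rdiff v' q u ord0 j) (rdiff v (phi q) (A u) ord0 i)
  (rdiff v (phi q) (A u) ord0 j) (v (phi q) ord0 i) (v (phi q) ord0 j).
move=> di dj ei ej x y E y0.
apply: (mulfI y0); apply/eqP; rewrite -subr_eq0; apply/eqP.
have -> : y * (k * ei + (dj - k * ej) / y * x) = y * (k * ei) + (dj - k * ej) * x.
  by field.
by rewrite -[RHS]E; ring.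
Unshelve. all: by end_near. Qed.

End Jets.

Section Charts.
Variables (R : realType) (M : riemann_surface R).
Local Notation C := R[i].
Local Notation V := 'rV[R[i]]_4.
Implicit Types (c d : chart R M) (W : set (R * R)) (v w : R * R -> V) (X Y : M -> CP3 R).

Lemma cimg_cinv c z : atlas c -> cimg c z -> cdom c (cinv c z) /\ cmap c (cinv c z) = z.
Proof.
move=> /atlas_chart[_ _ K _ _] [x cx <-].
by rewrite K ?inE.
Qed.

Lemma cdom_cimg c (x : M) : cdom c x -> cimg c (cmap c x).
Proof. by move=> cx; exists x. Qed.

Lemma cmapK c (x : M) : atlas c -> cdom c x -> cinv c (cmap c x) = x.
Proof. by move=> /atlas_chart[_ _ K _ _] cx; rewrite K ?inE. Qed.

Lemma near_cinv c z (U : set M) : atlas c -> cimg c z -> nbhs (cinv c z) U ->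
  \forall y \near z, U (cinv c y).
Proof.
move=> /atlas_chart[_ _ _ _ cI] cz nU.
by have := cI z (mem_set cz); apply.
Qed.

Lemma near_cmap c (x : M) (U : set (R * R)) : atlas c -> cdom c x -> nbhs (cmap c x) U ->
  \forall y \near x, U (cmap c y).
Proof.
move=> /atlas_chart[_ _ _ cC _] cx nU.
by have := cC x (mem_set cx); apply.
Qed.

Lemma near_cdom c (x : M) : atlas c -> cdom c x -> \forall y \near x, cdom c y.
Proof. by move=> /atlas_chart[oc _ _ _ _] cx; exact (open_nbhs_nbhs (conj oc cx)). Qed.

Lemma near_cimg c z : atlas c -> cimg c z -> \forall y \near z, cimg c y.
Proof. by move=> /atlas_chart[_ oc _ _ _] cz; exact (open_nbhs_nbhs (conj oc cz)). Qed.

Lemma lift_neq0 X c W v z : homogeneous_lift X c W v -> W z -> v z != 0.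
Proof.
move=> [_ _ _ H] Wz; have := valP (X (cinv c z)); rewrite (H z Wz) dim_vline.
by case: (v z != 0).
Qed.

(** Two smooth lifts of a map, in any two charts, have the same jet, because the
    transition map of the charts is holomorphic. *)
Lemma chart_jet X c d W W' v v' p q :
  homogeneous_lift X c W v -> homogeneous_lift X d W' v' -> rsm W v -> rsm W' v' ->
  W p -> W' q -> cinv c p = cinv d q -> same_jet v p v' q.
Proof.
move=> lv lv' sv sv' Wp Wq E.
have v0 := lift_neq0 lv Wp; have v'0 := lift_neq0 lv' Wq.
have [ac oW WI vX] := lv; have [ad oW' WI' vX'] := lv'.
have [cdp _] := cimg_cinv ac (WI _ Wp).
have [cdq mq] := cimg_cinv ad (WI' _ Wq).
have [hs ht] := proj1 (holP _ _) (atlas_compatible ad ac).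
set F := cmap d @` (cdom d `&` cdom c) in hs ht.
have oF : open F.
  rewrite openE => z [x [dx cx] <-].
  have nI := near_cimg ad (cdom_cimg dx).
  have nc : \forall y \near (cmap d x), cdom c (cinv d y).
    apply: (near_cinv ad (cdom_cimg dx)); rewrite cmapK//; exact: near_cdom.
  rewrite /interior; near=> y.
  have dy : cimg d y by near: y; exact nI.
  have [h1 h2] := cimg_cinv ad dy.
  exists (cinv d y) => //; split => //; near: y; exact nc.
have Fq : F q by exists (cinv d q) => //; split => //; rewrite -E.
pose phi y := cmap c (cinv d y).
have phiq : phi q = p by rewrite /phi -E; have [_ ->] := cimg_cinv ac (WI _ Wp).
have [hr hi] := hs.
have [d1 _] := C1_diff oF (hr 1%N) Fq.
have [d2 _] := C1_diff oF (hi 1%N) Fq.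
have cphi : \forall y \near q, W (phi y).
  have := near_cinv ad (WI' _ Wq) (near_cmap (U := W) ac (x := cinv d q) _ _); apply.
    by rewrite -E.
  by rewrite -/(phi q) phiq; exact (open_nbhs_nbhs (conj oW Wp)).
have nF : \forall y \near q, F y by exact (open_nbhs_nbhs (conj oF Fq)).
have nW' : \forall y \near q, W' y by exact (open_nbhs_nbhs (conj oW' Wq)).
rewrite -phiq in Wp v0 *.
apply: (same_jet_comp oW sv Wp v0 v'0 (fun u => rsm_der u sv' Wq) d1 d2).
  exact (ht q Fq).
near=> y.
have Wy : W (phi y) by near: y; exact cphi.
have W'y : W' y by near: y; exact nW'.
have [x [dx cx] xy] : F y by near: y; exact nF.
have Ey : cinv c (phi y) = cinv d y by rewrite /phi -xy !cmapK.
have := vX _ Wy; rewrite Ey (vX' _ W'y) => /vline_eq[|k _ ->]; last by exists k.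
exact: lift_neq0 lv' W'y.
Unshelve. all: by end_near. Qed.

End Charts.

(** * Conditions on first order jets *)

Section JetConditions.
Variable R : realType.
Local Notation C := R[i].
Local Notation V := 'rV[R[i]]_4.
Implicit Types (v w : R * R -> V) (z u p q : R * R).

(** The nearly Kaehler condition on a lift of a map to CP^3: the horizontal part
    of the differential is complex linear and, since omega_3 is the conjugate of
    the vertical component, the vertical part is antilinear. *)
Definition pseudohol_jet v p := (forall y : V, hm y (v p) = 0 -> om y (v p) = 0 ->
    type10 (fun u => hm y (rdiff v p u))) /\
  type10 (fun u => (om (v p) (rdiff v p u))^-*).

Definition contact_jet v p := forall u, om (v p) (rdiff v p u) = 0.

Definition critical_jet v p := forall u, exists k, rdiff v p u = k *: v p.

Lemma type10_comp (k : C) (A : R * R -> R * R) (alpha : R * R -> C) :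
  (forall u, A (iplane u) = iplane (A u)) -> type10 alpha -> type10 (fun u => k * alpha (A u)).
Proof. by move=> AI t u; rewrite AI (t (A u)) mulrCA. Qed.

Lemma pseudohol_jet_same v p v' q : same_jet v p v' q -> pseudohol_jet v p -> pseudohol_jet v' q.
Proof.
move=> [k [A [m [k0 E AI dE]]]] [h1 h2].
have dE' y u : hm y (v p) = 0 -> hm y (rdiff v' q u) = k * hm y (rdiff v p (A u)).
  by move=> h; rewrite dE hmDr !hmZr h mulr0 addr0.
split.
  move=> y; rewrite E hmZr omZr => /eqP; rewrite mulf_eq0 (negbTE k0) => /eqP hy.
  move=> /eqP; rewrite mulf_eq0 (negbTE k0) => /eqP oy.
  rewrite (_ : (fun u => _) = (fun u => k * hm y (rdiff v p (A u)))).
    exact (type10_comp k AI (h1 y hy oy)).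
  by apply/funext => u; exact (dE' y u hy).
have oE u : om (v' q) (rdiff v' q u) = k * k * om (v p) (rdiff v p (A u)).
  by rewrite E dE omZl omDr !omZr omvv mulr0 addr0 mulrA.
rewrite (_ : (fun u => _) = (fun u => (k * k)^-* * (om (v p) (rdiff v p (A u)))^-*)).
  exact (type10_comp (k * k)^-* AI h2).
by apply/funext => u; rewrite oE; exact: conjcM.
Qed.

Lemma contact_jet_same v p v' q : same_jet v p v' q -> contact_jet v p -> contact_jet v' q.
Proof.
move=> [k [A [m [k0 E AI dE]]]] h u.
by rewrite E dE omZl omDr !omZr omvv mulr0 addr0 h !mulr0.
Qed.

Lemma critical_jet_same v p v' q : same_jet v p v' q -> critical_jet v p -> critical_jet v' q.
Proof.
move=> [k [A [m [k0 E AI dE]]]] h u; rewrite dE E; have [k' ->] := h (A u).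
by exists (k' + m u / k); rewrite -[v p in RHS]scale1r !scalerA -scalerDl; congr (_ *: _); field.
Qed.

End JetConditions.

Section Frames.
Variable R : realType.
Local Notation C := R[i].
Local Notation V := 'rV[R[i]]_4.
Implicit Types (z u : R * R).
Variables (W : set (R * R)) (f : R * R -> C4 R * C4 R).
Hypothesis (oW : open W) (ff : frame_field W f).
Local Notation e1 := (fun y => (f y).1).
Local Notation e2 := (fun y => (f y).2).

Lemma frame_field_facts z : W z ->
  [/\ hm (f z).1 (f z).1 = 1, hm (f z).2 (f z).2 = 1, hm (f z).1 (f z).2 = 0 & om (f z).1 (f z).2 = 0].
Proof.
move=> Wz; apply/is_frameP; have [_ _ h] := ff.
by have := h z Wz; case: (f z).
Qed.

Lemma frame_rsm : rsm W e1 /\ rsm W e2.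
Proof. by have [/rsmP h1 /rsmP h2 _] := ff. Qed.

(** Differentiation of the orthogonality relations of the frame. *)
Lemma frame_skew z u : W z ->
  hm (f z).1 (rdiff e2 z u) = - (hm (f z).2 (rdiff e1 z u))^-* /\
  om (f z).1 (rdiff e2 z u) = om (f z).2 (rdiff e1 z u).
Proof.
move=> Wz; have [s1 s2] := frame_rsm.
have d1 := rsm_der u s1 Wz; have d2 := rsm_der u s2 Wz.
have n1 : \forall y \near z, hm (f y).1 (f y).2 = 0.
  by apply: (near_open oW Wz) => y Wy; have [_ _ h _] := frame_field_facts Wy.
have n2 : \forall y \near z, om (f y).1 (f y).2 = 0.
  by apply: (near_open oW Wz) => y Wy; have [_ _ _ h] := frame_field_facts Wy.
have [_ E0] := cdiff_cst (0 : C) z u.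
have [_ E1] := cdiff_hm d1 d2; have [_ E2] := cdiff_om d1 d2.
have [_ F1] := cdiff_near u n1; have [_ F2] := cdiff_near u n2.
rewrite F1 E0 in E1; rewrite F2 E0 in E2.
split.
  by rewrite -hmC; apply/eqP; rewrite -addr_eq0 addrC -E1.
by apply/eqP; rewrite -subr_eq0 -omC addrC -E2.
Qed.

(** Differentiation of the normalisation of the frame. *)
Lemma frame_imaginary z u : W z ->
  (hm (f z).1 (rdiff e1 z u))^-* = - hm (f z).1 (rdiff e1 z u) /\
  (hm (f z).2 (rdiff e2 z u))^-* = - hm (f z).2 (rdiff e2 z u).
Proof.
move=> Wz; have [s1 s2] := frame_rsm.
have d1 := rsm_der u s1 Wz; have d2 := rsm_der u s2 Wz.
have n1 : \forall y \near z, hm (f y).1 (f y).1 = 1.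
  by apply: (near_open oW Wz) => y Wy; have [h _ _ _] := frame_field_facts Wy.
have n2 : \forall y \near z, hm (f y).2 (f y).2 = 1.
  by apply: (near_open oW Wz) => y Wy; have [_ h _ _] := frame_field_facts Wy.
have [_ E0] := cdiff_cst (1 : C) z u.
have [_ E1] := cdiff_hm d1 d1; have [_ E2] := cdiff_hm d2 d2.
have [_ F1] := cdiff_near u n1; have [_ F2] := cdiff_near u n2.
rewrite F1 E0 in E1; rewrite F2 E0 in E2.
by split; rewrite -hmC; apply/eqP; rewrite -addr_eq0 -?E1 -?E2.
Qed.

Lemma sqrt2_neq0 : (Num.sqrt 2 : R)%:C != 0 :> C.
Proof. by rewrite eq_complex /= eqxx andbT sqrtr_eq0 -ltNge ltr0n. Qed.

Lemma omega1E z u : omega1 f z u = (Num.sqrt 2)%:C * hm (f z).2 (rdiff e1 z u).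
Proof. by []. Qed.
Lemma omega2E z u : omega2 f z u = (Num.sqrt 2)%:C * om (f z).2 (rdiff e1 z u).
Proof. by []. Qed.
Lemma omega3E z u : omega3 f z u = (om (f z).1 (rdiff e1 z u))^-*.
Proof. by []. Qed.
Lemma kappa21E z u : kappa21 f z u = om (f z).2 (rdiff e2 z u).
Proof. by []. Qed.
Lemma kappa12E z u : kappa12 f z u = - (om (f z).2 (rdiff e2 z u))^-*.
Proof. by []. Qed.

(** The forms rho_1 and rho_2 were defined as imaginary parts; the diagonal
    entries of the Maurer-Cartan form are imaginary, so no information is
    lost. *)
Lemma kappa22E z u : W z ->
  kappa22 f z u = - (hm (f z).1 (rdiff e1 z u) + hm (f z).2 (rdiff e2 z u)).
Proof.
move=> Wz; have [h1 h2] := frame_imaginary u Wz.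
rewrite /kappa22 /rho1 /rho2 /phi11 /phi22 -!/(hm _ _); congr (- _).
have H (x : C) : x^-* = - x -> x = 'i * (complex.Im x)%:C.
  case: x => a b /(congr1 (@complex.Re R)) /= E; apply: complex_ext => /=; last by ring.
  have -> : a = 0 by lra.
  by ring.
rewrite [X in _ = X + _](H _ h1) [X in _ = _ + X](H _ h2) -mulrDr.
by congr (_ * _); rewrite -rmorphD.
Qed.

Lemma I1E z u : I1 f z u = hconj (f z).1 *m
  (hm (f z).2 (rdiff e1 z u) *: (f z).2 + om (f z).2 (rdiff e1 z u) *: J (f z).2).
Proof.
rewrite /I1 omega1E omega2E /fbar1 /fbar2 -/(J _) mulmxDr -!scalemxAr !scalerA.
have E : (Num.sqrt 2 : R)%:C * (Num.sqrt 2 : R)^-1%:C = 1 :> C.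
  by rewrite -rmorphM /= mulfV// sqrtr_eq0 -ltNge ltr0n.
by congr (_ *: _ + _ *: _); rewrite mulrAC E mul1r.
Qed.

(** For a frame the condition need only be tested on e_2 and Je_2, which span
    the orthogonal complement of e_1 H and give omega_1 and omega_2. *)
Lemma frame_dC1 z : W z ->
  (forall u, dC1 f z (iplane u) = 'i *: dC1 f z u) <-> pseudohol_jet e1 z.
Proof.
move=> Wz; have [ee yy ey ey'] := frame_field_facts Wz.
have ye : hm (f z).2 (f z).1 = 0 by rewrite hmC ey conjc0.
have ye' : om (f z).2 (f z).1 = 0 by rewrite omC ey' oppr0.
split.
  move=> H.
  have h1 u : hm (f z).2 (rdiff e1 z (iplane u)) = 'i * hm (f z).2 (rdiff e1 z u).
    have := congr1 (fun x : 'rV_3 => x ord0 (inord 0)) (H u).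
    rewrite !mxE inordK//= !omega1E mulrCA; exact: (mulfI sqrt2_neq0).
  have h2 u : om (f z).2 (rdiff e1 z (iplane u)) = 'i * om (f z).2 (rdiff e1 z u).
    have := congr1 (fun x : 'rV_3 => x ord0 (inord 1)) (H u).
    rewrite !mxE inordK//= !omega2E mulrCA; exact: (mulfI sqrt2_neq0).
  have h3 u : omega3 f z (iplane u) = 'i * omega3 f z u.
    have := congr1 (fun x : 'rV_3 => x ord0 (inord 2)) (H u).
    by rewrite !mxE inordK.
  split; last by move=> u; have := h3 u; rewrite !omega3E.
  move=> y hy oy u.
  have fz : is_frame ((f z).1, (f z).2) by apply/is_frameP.
  have Ey := frame_expand y fz.
  have hy' : hm (f z).1 y = 0 by rewrite hmC hy conjc0.
  have oy' : om (f z).1 y = 0 by rewrite omC oy oppr0.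
  rewrite hy' oy' !scale0r !add0r in Ey.
  by rewrite Ey !hmDl !hmZl !hmJl h1 h2; ring.
move=> [h1 h2] u; apply/rowP => k; rewrite !mxE.
have h1' := h1 _ ye ye' u.
have h2' : om (f z).2 (rdiff e1 z (iplane u)) = 'i * om (f z).2 (rdiff e1 z u).
  have := h1 (J (f z).2) _ _ u; rewrite !hmJl omJl ye ye' oppr0; exact.
case: k => -[|[|[|//]]] hk /=.
- by rewrite !omega1E h1'; ring.
- by rewrite !omega2E h2'; ring.
- by have := h2 u; rewrite -!omega3E.
Qed.

End Frames.

(** * Maps from a Riemann surface to projective space *)

Section Continuity.
Variables (R : realType) (T : topologicalType).
Local Notation C := R[i].
Implicit Types (g h : T -> C) (x : T).

Definition contC g x := {for x, continuous (fun y => complex.Re (g y))} /\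
  {for x, continuous (fun y => complex.Im (g y))}.

Lemma contCM g h x : contC g x -> contC h x -> contC (fun y => g y * h y) x.
Proof.
move=> [gr gi] [hr hi]; split.
  have -> : (fun y => complex.Re (g y * h y)) =
     (fun y => complex.Re (g y) * complex.Re (h y) - complex.Im (g y) * complex.Im (h y)).
    by apply/funext => y; rewrite cReM.
  exact (cvgB (cvgM gr hr) (cvgM gi hi)).
have -> : (fun y => complex.Im (g y * h y)) =
   (fun y => complex.Re (g y) * complex.Im (h y) + complex.Im (g y) * complex.Re (h y)).
  by apply/funext => y; rewrite cImM.
exact (cvgD (cvgM gr hi) (cvgM gi hr)).
Qed.

Lemma contCB g h x : contC g x -> contC h x -> contC (fun y => g y - h y) x.
Proof.
move=> [gr gi] [hr hi]; split.
  have -> : (fun y => complex.Re (g y - h y)) = (fun y => complex.Re (g y) - complex.Re (h y)).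
    by apply/funext => y; rewrite cReD cReN.
  exact (cvgB gr hr).
have -> : (fun y => complex.Im (g y - h y)) = (fun y => complex.Im (g y) - complex.Im (h y)).
  by apply/funext => y; rewrite cImD cImN.
exact (cvgB gi hi).
Qed.

Lemma contC_neq0 g x : contC g x -> g x != 0 -> \forall y \near x, g y != 0.
Proof.
move=> [gr gi] g0.
have cn : (nsq (g y) @[y --> x] --> nsq (g x)).
  have -> : (fun y => nsq (g y)) =
    (fun y => complex.Re (g y) * complex.Re (g y) + complex.Im (g y) * complex.Im (g y)).
    by apply/funext => y; rewrite /nsq !expr2.
  rewrite /nsq !expr2; exact (cvgD (cvgM gr gr) (cvgM gi gi)).
have n0 : 0 < nsq (g x) by rewrite lt_neqAle nsq_ge0 andbT eq_sym nsq_eq0.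
have n : \forall y \near x, 0 < nsq (g y) by exact (cvgr_gt _ cn _ n0).
near=> y.
have : 0 < nsq (g y) by near: y; exact n.
by apply: contraTneq => ->; rewrite /nsq /= expr0n addr0 ltxx.
Unshelve. all: by end_near. Qed.

End Continuity.

Section Density.
Variables (R : realType) (M : riemann_surface R).
Local Notation C := R[i].
Local Notation V := 'rV[R[i]]_4.
Implicit Types (c d : chart R M) (W : set (R * R)) (v w t : R * R -> V) (X Y : M -> CP3 R).

Lemma csm_contC W (g : R * R -> C) z : csm W g -> W z -> contC g z.
Proof. by move=> sg Wz; split; [exact (csm_contRe sg Wz)|exact (csm_contIm sg Wz)]. Qed.

Lemma contC_chart c W (g : R * R -> C) (x : M) : atlas c -> cdom c x -> csm W g -> W (cmap c x) ->
  contC (fun y => g (cmap c y)) x.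
Proof.
move=> ac cx sg Wx; have [_ _ _ cC _] := atlas_chart ac.
have cc := cC x (mem_set cx).
have [gr gi] := csm_contC sg Wx.
by split; [exact (continuous_comp cc gr)|exact (continuous_comp cc gi)].
Qed.

(** Two points of projective space differ when a 2x2 minor of their lifts does
    not vanish, and this is an open condition. *)
Lemma smooth_maps_agree X Y : smooth_map X -> smooth_map Y ->
  (forall U : set M, open U -> U !=set0 -> exists2 x, U x & X x = Y x) -> X = Y.
Proof.
move=> sX sY dense; apply/funext => x.
have [c [W [v [lv cx Wx /rsmP sv]]]] := sX x.
have [d [W' [w [lw dx W'x /rsmP sw]]]] := sY x.
have [ac oW WI vX] := lv; have [ad oW' WI' wY] := lw.
have v0 := lift_neq0 lv Wx; have w0 := lift_neq0 lw W'x.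
apply: contrapT => XY.
pose m i j y := v (cmap c y) ord0 i * w (cmap d y) ord0 j - v (cmap c y) ord0 j * w (cmap d y) ord0 i.
have [i [j mij]] : exists i j, m i j x != 0.
  apply: contrapT => H; apply: XY; apply: val_inj => /=.
  have m0 i j : m i j x = 0.
    by apply/eqP; apply: contrapT => /negP nz; apply: H; exists i, j.
  have [j vj] := neq0_coord v0.
  have wE : w (cmap d x) = (w (cmap d x) ord0 j / v (cmap c x) ord0 j) *: v (cmap c x).
    apply/rowP => i; rewrite [RHS]mxE; apply: (mulfI vj).
    have := m0 j i; rewrite /m => /eqP; rewrite subr_eq0 => /eqP ->.
    by field.
  rewrite -[x in X x](cmapK ac cx) -[x in Y x](cmapK ad dx) vX// wY//.
  have k0 : w (cmap d x) ord0 j / v (cmap c x) ord0 j != 0.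
    by apply: contraNneq w0 => k0; rewrite wE k0 scale0r.
  by rewrite wE vline_scale.
have cm : contC (m i j) x.
  apply: contCB; apply: contCM;
    [exact (contC_chart ac cx (sv i) Wx)|exact (contC_chart ad dx (sw j) W'x)
    |exact (contC_chart ac cx (sv j) Wx)|exact (contC_chart ad dx (sw i) W'x)].
have n1 := contC_neq0 cm mij.
have n2 := near_cdom ac cx; have n3 := near_cdom ad dx.
have n4 := near_cmap (U := W) ac cx (open_nbhs_nbhs (conj oW Wx)).
have n5 := near_cmap (U := W') ad dx (open_nbhs_nbhs (conj oW' W'x)).
have /nbhs_interior n : \forall y \near x, X y <> Y y.
  near=> y.
  have cy : cdom c y by near: y; exact n2.
  have dy : cdom d y by near: y; exact n3.
  have Wy : W (cmap c y) by near: y; exact n4.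
  have W'y : W' (cmap d y) by near: y; exact n5.
  have : m i j y != 0 by near: y; exact n1.
  move=> /eqP my XYy; apply: my.
  have := vX _ Wy; rewrite cmapK// XYy -{1}(cmapK ad dy) wY// => /vline_eq[|k _ E].
    exact: lift_neq0 lw W'y.
  rewrite /m E; move: (cmap c y) => q; rewrite !mxE; ring.
have [y Uy Ey] := dense _ (@open_interior _ _) (ex_intro _ x (nbhs_singleton n)).
exact: interior_subset Uy Ey.
Unshelve. all: by end_near. Qed.

Definition critical Y (x : M) := exists c W v, [/\ homogeneous_lift Y c W v, rsm W v,
  cdom c x, W (cmap c x) & critical_jet v (cmap c x)].

Lemma critical_lift Y (x : M) d W v q : critical Y x -> homogeneous_lift Y d W v ->
  rsm W v -> W q -> cinv d q = x -> critical_jet v q.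
Proof.
move=> [c [W0 [v0 [l0 s0 cx W0x cr]]]] lv sv Wq E.
have ac : atlas c by have [] := l0.
have J := chart_jet l0 lv s0 sv W0x Wq.
by apply: critical_jet_same cr; apply: J; rewrite cmapK.
Qed.

Lemma hol_rdiff W v z u : open W -> (forall l, hol W (fun y => v y ord0 l)) -> W z ->
  rdiff v z u = (u.1 +i* u.2) *: rdiff v z (dx R).
Proof. by move=> oW hv Wz; apply/rowP => l; rewrite [RHS]mxE !rdiffE; exact (hol_cdiff u oW (hv l) Wz). Qed.

Lemma lift_sub Y c W W' v : homogeneous_lift Y c W v -> open W' -> W' `<=` W ->
  homogeneous_lift Y c W' v.
Proof.
move=> [ac oW WI vY] oW' sW; split => //; first exact: subset_trans WI.
by move=> z /sW; exact: vY.
Qed.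

(** Normalising a coordinate to 1 removes from the derivative of the lift its
    component along the lift, so that it vanishes only where the differential of
    Y does. *)
Lemma hol_normalized Y (x : M) : holomorphic_map Y -> exists c r k v,
  [/\ cdom c x, 0 < r, homogeneous_lift Y c (ball (cmap c x) r) v,
    forall l, hol (ball (cmap c x) r) (fun y => v y ord0 l) &
    forall y, ball (cmap c x) r y -> v y ord0 k = 1].
Proof.
move=> /(_ x) [c [W [v [lv cx Wx hv']]]].
have hv l : hol W (fun y => v y ord0 l) by exact/holP.
have v0 := lift_neq0 lv Wx; have [k vk] := neq0_coord v0.
have [ac oW WI vY] := lv.
have n1 := contC_neq0 (csm_contC (proj1 (hv k)) Wx) vk.
have n2 : \forall y \near cmap c x, W y by exact (open_nbhs_nbhs (conj oW Wx)).
have /nbhs_ballP[r /= r0 rP] : nbhs (cmap c x) (W `&` [set y | v y ord0 k != 0]) by exact (filterI n2 n1).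
pose v1 y := (v y ord0 k)^-1 *: v y.
have oB : open (ball (cmap c x) r) by exact: ball_open.
exists c, r, k, v1; split => //.
- split => //; first by move=> y /rP[/WI].
  by move=> y /rP[Wy vy]; rewrite vY// /v1 vline_scale// invr_eq0.
- move=> l; have hB j : hol (ball (cmap c x) r) (fun y => v y ord0 j).
    by apply: hol_sub (hv j) => y /rP[].
  have -> : (fun y => v1 y ord0 l) = (fun y => (v y ord0 k)^-1 * v y ord0 l).
    by apply/funext => y; rewrite mxE.
  by apply: (holM oB _ (hB l)); apply: holV (hB k) => // y /rP[].
- by move=> y /rP[_ vy]; rewrite mxE mulVf.
Qed.

Lemma ball_sub (z0 : R * R) (s r : R) : s <= r -> ball z0 s `<=` ball z0 r.
Proof. by move=> sr y [y1 y2]; split; rewrite /ball/=; [exact: lt_le_trans y1 sr|exact: lt_le_trans y2 sr]. Qed.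

Lemma const_of_cdiff0 (z0 : R * R) (r : R) (g : R * R -> C) z : csm (ball z0 r) g ->
  (forall y u, ball z0 r y -> cdiff g y u = 0) -> ball z0 r z -> g z = g z0.
Proof.
move=> [rg ig] dg Bz.
have zz : z = 1 *: (z - z0) + z0 by rewrite scale1r subrK.
have D0 y : ball z0 r y -> 'D_(z - z0) (fun p => complex.Re (g p)) y = 0 /\
    'D_(z - z0) (fun p => complex.Im (g p)) y = 0.
  by move=> By; have := dg y (z - z0) By; rewrite /cdiff => -[-> ->].
have star (s : R) : 0 <= s <= 1 -> ball z0 r (s *: (z - z0) + z0) by exact: star_ball Bz.
have [s /andP[s0 s1] E] := @line_MVT R _ (fun p => complex.Re (g p)) z0 (z - z0) 1 ltr01
  (fun s hs => CnWd (rg 0%N) (star s hs)).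
have [s' /andP[s0' s1'] E'] := @line_MVT R _ (fun p => complex.Im (g p)) z0 (z - z0) 1 ltr01
  (fun s hs => CnWd (ig 0%N) (star s hs)).
have [h1 _] := D0 _ (star s (introT andP (conj (ltW s0) (ltW s1)))).
have [_ h2] := D0 _ (star s' (introT andP (conj (ltW s0') (ltW s1')))).
rewrite h1 mulr0 -zz in E; rewrite h2 mulr0 -zz in E'.
by apply: complex_ext; apply/eqP; rewrite -subr_eq0; apply/eqP.
Qed.

Lemma zc_neq0 (z0 z : R * R) : z <> z0 -> zc z0 z != 0.
Proof.
move=> zz0; apply/eqP => -[h1 h2]; apply: zz0; case: z z0 h1 h2 => [a b] [a' b'] /= h1 h2.
by congr (_, _); apply/eqP; rewrite -subr_eq0; apply/eqP.
Qed.

Lemma near_punctured (z0 : R * R) (P : set (R * R)) : nbhs z0 P -> exists2 z, z <> z0 & P z.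
Proof.
move=> nP; have [a a0 H] := near_line (dx R) nP.
exists (a *: dx R + z0); last by apply: H; rewrite gtr0_norm.
move/(congr1 (fun p => p - z0)); rewrite addrK subrr => /(congr1 fst)/=.
by rewrite [_ *: _]mulr1 => h; rewrite h ltxx in a0.
Qed.

Lemma contC_zero W (g : R * R -> C) z0 : csm W g -> open W -> W z0 ->
  (forall z, W z -> z <> z0 -> g z = 0) -> g z0 = 0.
Proof.
move=> sg oW Wz0 g0; apply/eqP; apply: contrapT => /negP nz.
have n := contC_neq0 (csm_contC sg Wz0) nz.
have nW : \forall y \near z0, W y by exact (open_nbhs_nbhs (conj oW Wz0)).
have [z zz0 [gz Wz]] := near_punctured (filterI n nW).
by move/eqP: gz; apply; exact: g0.
Qed.

(** The vectors v and t span the tangent line of Y on the whole disc, also at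
    z0, where the differential of Y vanishes if n is positive; they are
    independent because of their k-th coordinates. *)
Definition tangent_lift Y c (z0 : R * R) (r : R) (k : 'I_4) v n t :=
  [/\ 0 < r, homogeneous_lift Y c (ball z0 r) v,
     (forall l, hol (ball z0 r) (fun y => v y ord0 l)) /\
     (forall l, hol (ball z0 r) (fun y => t y ord0 l)),
     forall y, ball z0 r y -> [/\ v y ord0 k = 1, t y ord0 k = 0 & t y != 0] &
     forall y u, ball z0 r y -> rdiff v y u = ((u.1 +i* u.2) * zc z0 y ^+ n) *: t y].

(** The largest power of the coordinate that divides all the derivatives of the
    coordinates of a normalised lift is factored out. *)
Lemma const_or_tangent Y (x : M) : holomorphic_map Y ->
  (\forall y \near x, Y y = Y x) \/
  exists c r k v n t, cdom c x /\ tangent_lift Y c (cmap c x) r k v n t.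
Proof.
move=> hY; have [c [r [k [v [cx r0 lv hv vk]]]]] := hol_normalized x hY.
have [ac _ _ vY] := lv.
set z0 := cmap c x in lv hv vk vY *.
have oB : open (ball z0 r) by exact: ball_open.
have Bz0 : ball z0 r z0 by exact: ballxx.
have sv := hol_rsm hv.
pose g l y := cdiff (fun y => v y ord0 l) y (dx R).
have hg l : hol (ball z0 r) (g l) by exact (hol_der oB (hv l)).
have [g0|[n [h [[hh gh] [i hi]]]]] := hol_factor r0 hg.
  left.
  have r40 : 0 < r / 4 by rewrite divr_gt0.
  have sB : ball z0 (r / 4) `<=` ball z0 r by apply: ball_sub; lra.
  have vc y : ball z0 (r / 4) y -> v y = v z0.
    move=> By; apply/rowP => l.
    apply: (@const_of_cdiff0 z0 (r / 4) (fun y => v y ord0 l)) => //.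
      exact (csm_sub sB (sv l)).
    move=> p u Bp; rewrite (hol_cdiff u oB (hv l) (sB _ Bp)).
    by have := g0 l p Bp; rewrite /g => ->; rewrite mulr0.
  have nB : nbhs z0 (ball z0 (r / 4)) by exact: nbhsx_ballx.
  have n1 := near_cmap ac cx nB; have n2 := near_cdom ac cx.
  near=> y.
  have By : ball z0 (r / 4) (cmap c y) by near: y; exact n1.
  have cy : cdom c y by near: y; exact n2.
  apply: val_inj; rewrite /= -(cmapK ac cy) -(cmapK ac cx) -/z0 vY ?vY//; last exact: sB.
  by rewrite vc.
right.
have hi' : h i z0 != 0 by apply/eqP.
have n1 := contC_neq0 (csm_contC (proj1 (hh i)) Bz0) hi'.
have n2 : \forall y \near z0, ball z0 r y by exact (open_nbhs_nbhs (conj oB Bz0)).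
have /nbhs_ballP[s /= s0 sP] : nbhs z0 (ball z0 r `&` [set y | h i y != 0]) by exact (filterI n2 n1).
have sB : ball z0 s `<=` ball z0 r by move=> y /sP[].
have oBs : open (ball z0 s) by exact: ball_open.
pose t y : V := \row_l h l y.
have gk y : ball z0 r y -> g k y = 0.
  move=> By.
  have n3 : \forall p \near y, v p ord0 k = 1.
    have nB : \forall p \near y, ball z0 r p by exact (open_nbhs_nbhs (conj oB By)).
    by near=> p; apply: vk; near: p; exact nB.
  have [_ E] := cdiff_near (dx R) n3; rewrite /g E.
  by have [_ ->] := cdiff_cst (1 : C) y (dx R).
(* The k-th coordinate of the lift is constant, so its quotient vanishes outside
   z0, and at z0 by continuity. *)
have hk y : ball z0 r y -> h k y = 0.
  have hk' p : ball z0 r p -> p <> z0 -> h k p = 0.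
    move=> Bp pz; have /eqP := gh k p Bp; rewrite gk// eq_sym mulf_eq0.
    by rewrite expf_eq0 (negbTE (zc_neq0 pz)) andbF => /eqP.
  have [->|yz] := pselect (y = z0); last by move=> By; exact: hk'.
  by move=> _; exact: contC_zero (proj1 (hh k)) oB Bz0 hk'.
exists c, s, k, v, n, t; split => //; split => //.
- exact: lift_sub lv oBs sB.
- split=> l; first exact: hol_sub (hv l).
  have -> : (fun y => t y ord0 l) = h l by apply/funext => y; rewrite mxE.
  exact: hol_sub (hh l).
- move=> y By; split; first exact/vk/sB.
    by rewrite mxE hk//; exact: sB.
  have [_ hy] := sP _ By.
  by apply: contraNneq hy => ty; have := congr1 (fun m : V => m ord0 i) ty; rewrite !mxE => ->.
move=> y u By; rewrite (hol_rdiff u oB hv (sB _ By)) -scalerA; congr (_ *: _).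
by apply/rowP => l; rewrite rdiffE !mxE; exact (gh l y (sB _ By)).
Unshelve. all: by end_near. Qed.

End Density.

(** * The zeros of the differential of a holomorphic map *)

Section DensityTheorem.
Variables (R : realType) (M : riemann_surface R).
Hypothesis Mconn : connected [set: M].
Local Notation C := R[i].
Local Notation V := 'rV[R[i]]_4.
Implicit Types (c d : chart R M) (W : set (R * R)) (v w t : R * R -> V) (X Y : M -> CP3 R).

Lemma locally_const_critical Y (x : M) : holomorphic_map Y ->
  (\forall y \near x, Y y = Y x) -> critical Y x.
Proof.
move=> hY cY; have [c [r [k [v [cx r0 lv hv vk]]]]] := hol_normalized x hY.
have [ac _ _ vY] := lv.
have sv := hol_rsm hv.
have Bz : ball (cmap c x) r (cmap c x) by exact: ballxx.
exists c, (ball (cmap c x) r), v; split => // u; exists 0; rewrite scale0r.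
have n1 : \forall z \near cmap c x, Y (cinv c z) = Y x.
  apply: (near_cinv ac (U := fun y => Y y = Y x) (cdom_cimg cx)).
  by rewrite cmapK.
have n2 : \forall z \near cmap c x, ball (cmap c x) r z by exact (nbhsx_ballx _ _ r0).
have n : \forall z \near cmap c x, v z = v (cmap c x).
  near=> z.
  have Bz' : ball (cmap c x) r z by near: z; exact n2.
  have Yz : Y (cinv c z) = Y x by near: z; exact n1.
  have := vY _ Bz'; rewrite Yz -{1}(cmapK ac cx) (vY _ Bz) => /vline_eq[|a _ E].
    exact: lift_neq0 lv Bz.
  have := congr1 (fun m : V => m ord0 k) E; rewrite mxE (vk _ Bz) (vk _ Bz') mulr1 => a1.
  by rewrite E -a1 scale1r.
apply/rowP => l; rewrite rdiffE mxE.
have nl : \forall z \near cmap c x, v z ord0 l = v (cmap c x) ord0 l.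
  near=> z.
  have Ez : v z = v (cmap c x) by near: z; exact n.
  by rewrite Ez.
have [_ E] := cdiff_near u nl; rewrite E.
by have [_ ->] := cdiff_cst (v (cmap c x) ord0 l) (cmap c x) u.
Unshelve. all: by end_near. Qed.

Lemma tangent_lift_noncritical Y c z0 r k v n t z : tangent_lift Y c z0 r k v n t ->
  ball z0 r z -> z <> z0 -> ~ critical Y (cinv c z).
Proof.
move=> [r0 lv [hv ht] vt dv] Bz zz0 cr.
have sv := hol_rsm hv.
have [a E] := critical_lift cr lv sv Bz (erefl _) (dx R).
have [vk tk t0] := vt z Bz.
rewrite dv// in E.
have := congr1 (fun m : V => m ord0 k) E; rewrite !mxE vk tk mulr0 mulr1 => a0.
move/eqP: E; rewrite -a0 scale0r scaler_eq0 (negbTE t0) orbF mulf_eq0.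
rewrite expf_eq0 (negbTE (zc_neq0 zz0)) andbF orbF eq_complex /= oner_eq0//.
Qed.

Lemma locally_const_const Y : (forall x, \forall y \near x, Y y = Y x) -> forall x y, Y x = Y y.
Proof.
move=> lc x y.
have Bo : open [set z | Y z = Y x].
  rewrite openE => z Yz; rewrite /interior.
  have n := lc z; near=> p.
  have Ep : Y p = Y z by near: p; exact n.
  by rewrite /= Ep.
have Bc : open [set z | Y z <> Y x].
  rewrite openE => z Yz; rewrite /interior.
  have n := lc z; near=> p.
  have Ep : Y p = Y z by near: p; exact n.
  by rewrite /= Ep.
have E : [set z | Y z = Y x] = [set: M].
  apply: Mconn; first by exists x.
    by exists [set z | Y z = Y x]; rewrite ?setTI.
  exists [set z | Y z = Y x]; rewrite ?setTI// -openC.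
  by rewrite (_ : ~` _ = [set z | Y z <> Y x]).
have : [set: M] y by [].
by rewrite -E /= => ->.
Unshelve. all: by end_near. Qed.

(** The points near which Y is constant form an open and closed set, because the
    critical points that are not among them are isolated. *)
Lemma nonconst_tangent Y (x : M) : holomorphic_map Y -> nonconstant Y ->
  exists c r k v n t, cdom c x /\ tangent_lift Y c (cmap c x) r k v n t.
Proof.
move=> hY [x1 [x2 x12]].
have [nc|//] := const_or_tangent x hY.
exfalso; apply: x12; apply: locally_const_const.
pose E := [set y | \forall p \near y, Y p = Y y].
have Eo : open E.
  rewrite openE => y Ey; rewrite /interior.
  have n := nbhs_interior Ey.
  near=> p.
  have np : nbhs p [set q | Y q = Y y].
    by have : [set q | Y q = Y y]^° p by near: p; exact n.
  rewrite /E /=; have Yp := nbhs_singleton np; rewrite /= in Yp.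
  by rewrite Yp.
have Ec : open (~` E).
  rewrite openE => y nEy; rewrite /interior.
  have [//|[c [r [k [v [n [t [cy T]]]]]]]] := const_or_tangent y hY.
  have [r0 lv _ _ _] := T; have [ac _ _ _] := lv.
  have n1 := near_cmap ac cy (nbhsx_ballx (cmap c y) r r0); have n2 := near_cdom ac cy.
  near=> p.
  have Bp : ball (cmap c y) r (cmap c p) by near: p; exact n1.
  have cp : cdom c p by near: p; exact n2.
  have [->//|py] := pselect (p = y).
  have pz : cmap c p <> cmap c y by move=> e; apply: py; rewrite -(cmapK ac cp) e cmapK.
  move=> Ep; apply: (tangent_lift_noncritical T Bp pz).
  by rewrite cmapK//; exact: locally_const_critical.
have EE : E = [set: M].
  apply: Mconn; first by exists x.
    by exists E; rewrite ?setTI.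
  by exists E; rewrite ?setTI// -openC.
by move=> y; have : [set: M] y by []; rewrite -EE.
Unshelve. all: by end_near. Qed.

Lemma noncritical_dense Y (U : set M) : holomorphic_map Y -> nonconstant Y ->
  open U -> U !=set0 -> exists2 x, U x & ~ critical Y x.
Proof.
move=> hY nY oU [x Ux].
have [c [r [k [v [n [t [cx T]]]]]]] := nonconst_tangent x hY nY.
have [r0 lv _ _ _] := T; have [ac _ _ _] := lv.
have n1 : \forall z \near cmap c x, U (cinv c z).
  apply: (near_cinv ac (cdom_cimg cx)); rewrite cmapK//; exact: open_nbhs_nbhs.
have [z zz0 [Uz Bz]] := near_punctured (filterI n1 (nbhsx_ballx (cmap c x) r r0)).
by exists (cinv c z) => //; exact: tangent_lift_noncritical T Bz zz0.
Qed.

End DensityTheorem.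

Section NullTorsionFrames.
Variables (R : realType) (M : riemann_surface R).
Local Notation C := R[i].
Local Notation V := 'rV[R[i]]_4.
Implicit Types (c d : chart R M) (W : set (R * R)) (X Y : M -> CP3 R)
  (f g : R * R -> C4 R * C4 R) (L : M -> {vspace 'M[R[i]]_4}).

Definition tensor_map X L (x : M) : CP3 R := tensor_line (X x) (L x).

(** The second vector of such a frame spans the contraction of N (x) X, since
    e_1^* (x) e_2 is orthogonal to e_1^* (x) e_2 j in H_X. *)
Definition splitting_frame X Y L c W f := [/\ frame_along1 X c W f,
  homogeneous_lift Y c W (fun z => (f z).2) &
  forall z, W z -> L (cinv c z) = <[hconj (f z).1 *m J (f z).2]>%VS].

Lemma invsqrt2_neq0 : (Num.sqrt 2 : R)^-1%:C != 0 :> C.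
Proof. by rewrite eq_complex /= eqxx andbT invr_eq0 sqrtr_eq0 -ltNge ltr0n. Qed.

(** A holomorphic section of L is s_1 f_{bar 1} + s_2 f_{bar 2}, and the second
    vector is J of s_1 e_2 + s_2 Je_2 after normalisation. *)
Lemma is_L_frames X L (x : M) : holomorphic_line_subbundle X L -> exists c W f,
  [/\ splitting_frame X (tensor_map X L) L c W f, cdom c x & W (cmap c x)].
Proof.
move=> /(_ x) [c [W [f [s1 [s2 [ff cx Wx [cs1 cs2 _] sL]]]]]].
have [fW lf] := ff; have [ac oW WI fX] := lf.
have [r1 r2] := frame_rsm fW.
move/csmoothP in cs1; move/csmoothP in cs2.
pose w z := s1 z *: (f z).2 + s2 z *: J (f z).2.
have sw : rsm W w.
  exact (rsmD oW (rsmZ oW cs1 r2) (rsmZ oW cs2 (rsmJ oW r2))).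
have w0 z : W z -> w z != 0.
  move=> Wz; have [_ yy _ _] := frame_field_facts fW Wz.
  apply/eqP => E; have [+ _] := sL z Wz; apply.
  have E1 : s1 z = 0.
    by have := congr1 (hm (f z).2) E; rewrite hm0r hmDr !hmZr hmJr omvv conjc0 oppr0 yy mulr1 mulr0 addr0.
  have E2 : s2 z = 0.
    by have := congr1 (om (f z).2) E; rewrite om0r omDr !omZr omJr omvv yy conjc1 mulr1 mulr0 add0r.
  by rewrite E1 E2.
have we z : W z -> hm (f z).1 (w z) = 0 /\ om (f z).1 (w z) = 0.
  move=> Wz; have [_ _ ey ey'] := frame_field_facts fW Wz.
  by rewrite hmDr omDr !hmZr !omZr hmJr omJr ey ey' conjc0 oppr0 !mulr0 addr0.
have Jw0 z : W z -> J (w z) != 0 by move=> /w0; rewrite J_eq0.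
pose f' z := ((f z).1, unitize (J (w z))).
have Lw z : W z -> L (cinv c z) = <[hconj (f z).1 *m w z]>%VS.
  move=> Wz; have [_ ->] := sL z Wz.
  have -> : s1 z *: fbar1 (f z) + s2 z *: fbar2 (f z) =
      (Num.sqrt 2)^-1%:C *: (hconj (f z).1 *m w z).
    rewrite /w /fbar1 /fbar2 mulmxDr -!scalemxAr scalerDr !scalerA.
    by congr (_ *: _ + _ *: _); rewrite mulrC.
  by rewrite vline_scale// invsqrt2_neq0.
exists c, W, f'; split => //; split.
- split; last exact: lf.
  split; first by have [h _ _] := fW.
    by apply/rsmP; exact (rsm_unitize oW Jw0 (rsmJ oW sw)).
  move=> z Wz; have [ee _ _ _] := frame_field_facts fW Wz; have [h1 h2] := we z Wz.
  apply/is_frameP; split => //; first by rewrite hm_unitize// Jw0.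
    by rewrite hmZr hmJr h2 conjc0 oppr0 mulr0.
  by rewrite omZr omJr h1 conjc0 mulr0.
- split => // z Wz; have [ee _ _ _] := frame_field_facts fW Wz; have [h1 h2] := we z Wz.
  rewrite /tensor_map Lw// (tensor_lineE (fX z Wz) ee (w0 z Wz) h1 h2).
  by rewrite /f' /= vline_unitize// Jw0.
- move=> z Wz; rewrite Lw// /f' /= JZ JJ scalerN -scaleNr -scalemxAr vline_scale//.
  by rewrite oppr_eq0 conjc_eq0 invr_eq0 nrmC_neq0// Jw0.
Qed.

Lemma tensor_map_smooth X L : holomorphic_line_subbundle X L -> smooth_map (tensor_map X L).
Proof.
move=> hL x; have [c [W [f [[[fW _] lf _] cx Wx]]]] := is_L_frames x hL.
by exists c, W, (fun z => (f z).2); split => //; have [_ h _] := fW.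
Qed.

(** These conditions say that omega_1 and kappa_{1 bar 2} vanish and that
    omega_2 is of type (1,0). *)
Definition torsionfree_frame f W := forall z, W z -> [/\
  forall u, hm (f z).2 (rdiff (fun y => (f y).1) z u) = 0,
  forall u, om (f z).2 (rdiff (fun y => (f y).2) z u) = 0 &
  type10 (fun u => om (f z).2 (rdiff (fun y => (f y).1) z u))].

Definition vanishing_II X L := forall c W f, adapted_frame X L c W f ->
  forall z, W z -> forall u, II f z u = 0.

Lemma fbar1_neq0 (f : C4 R * C4 R) : is_frame f -> hconj f.1 *m f.2 != 0.
Proof.
case: f => e y /is_frameP[ee yy _ _] /=; apply/eqP => E.
have := congr1 (mulmx e) E; rewrite ehe// mulmx0 => y0.
by move: yy; rewrite y0 hm0r => /eqP; rewrite eq_sym oner_eq0.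
Qed.

(** I_1 has its values in L, which kills omega_1, and II is kappa_{1 bar 2} up
    to a nonzero factor. *)
Lemma null_torsion_frames X L (x : M) : pseudoholomorphic_curve X -> is_L X L ->
  vanishing_II X L -> exists c W f,
  [/\ splitting_frame X (tensor_map X L) L c W f, torsionfree_frame f W, cdom c x & W (cmap c x)].
Proof.
move=> [_ _ pX] [hL IL] vII.
have [c [W [f [sf cx Wx]]]] := is_L_frames x hL.
have [fa lf fL] := sf; have [fW lX] := fa.
have oW : open W by have [] := lf.
exists c, W, f; split => // z Wz.
have [ee yy ey ey'] := frame_field_facts fW Wz.
have adf : adapted_frame X L c W f.
  split => // p Wp; rewrite fL// /fbar2 -/(J _); apply: memvZ; exact: memv_line.
have [PH _] := iffLR (frame_dC1 fW Wz) (pX c W f fa z Wz).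
split=> [u|u|].
- have := IL c W f fa z Wz u; rewrite fL// I1E => /vlineP[k E].
  have := congr1 (mulmx (f z).1) E; rewrite -scalemxAr !ehe// => E'.
  have := congr1 (hm (f z).2) E'.
  by rewrite hmDr !hmZr hmJr omvv conjc0 oppr0 yy mulr1 !mulr0 addr0.
- have := vII c W f adf z Wz u; rewrite /II /fbar1 => /eqP; rewrite !scaler_eq0.
  have [_ _ ffz] := fW.
  rewrite (negbTE invsqrt2_neq0) (negbTE (fbar1_neq0 (ffz z Wz))) !orbF kappa12E oppr_eq0 conjc_eq0.
  by move/eqP.
- have ye : hm (J (f z).2) (f z).1 = 0 by rewrite hmJl omC ey' oppr0.
  have ye' : om (J (f z).2) (f z).1 = 0 by rewrite omJl hmC ey conjc0 oppr0.
  have := PH _ ye ye'; rewrite (_ : (fun u => hm _ _) = (fun u => om (f z).2 (rdiff (fun y => (f y).1) z u)))//.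
  by apply/funext => u; rewrite hmJl.
Qed.

(** The structure equation of e_2, in which the terms along e_1 and Je_2
    vanish. *)
Lemma torsionfree_de2 W f z u : open W -> frame_field W f -> torsionfree_frame f W -> W z ->
  rdiff (fun y => (f y).2) z u =
  om (f z).2 (rdiff (fun y => (f y).1) z u) *: J (f z).1 +
  hm (f z).2 (rdiff (fun y => (f y).2) z u) *: (f z).2.
Proof.
move=> oW fW tf Wz; have [h1 h2 _] := tf z Wz.
have [k1 k2] := frame_skew oW fW u Wz.
have [_ _ ff] := fW; have := ff z Wz; case E : (f z) => [e y] fr /=.
rewrite E /= in h1 h2 k1 k2 *.
rewrite {1}(frame_expand (rdiff (fun y => (f y).2) z u) fr) k1 k2 h1 h2 conjc0 oppr0 !scale0r.
by rewrite add0r addr0.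
Qed.

Lemma torsionfree_de1 W f z u : frame_field W f -> torsionfree_frame f W -> W z ->
  om (f z).2 (rdiff (fun y => (f y).1) z u) = 0 ->
  exists a b, rdiff (fun y => (f y).1) z u = a *: (f z).1 + b *: J (f z).1.
Proof.
move=> fW tf Wz h3; have [h1 _ _] := tf z Wz.
have [_ _ ff] := fW; have := ff z Wz; move: h3 h1; case E : (f z) => [e y] /= h3 h1 fr.
exists (hm e (rdiff (fun y => (f y).1) z u)), (om e (rdiff (fun y => (f y).1) z u)).
by rewrite {1}(frame_expand (rdiff (fun y => (f y).1) z u) fr) h1 h3 !scale0r !addr0.
Qed.

End NullTorsionFrames.

(** * The contact curve of a null-torsion curve *)

Section ForwardMap.
Variables (R : realType) (M : riemann_surface R).
Local Notation C := R[i].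
Local Notation V := 'rV[R[i]]_4.
Implicit Types (c d : chart R M) (W : set (R * R)) (X Y : M -> CP3 R)
  (f g : R * R -> C4 R * C4 R) (L : M -> {vspace 'M[R[i]]_4}).

(** Dividing e_2 by one of its coordinates fixes its component along e_2 in the
    differential, which is then theta times a vector, with theta of type
    (1,0). *)
Lemma torsionfree_hol W f (k : 'I_4) : open W -> frame_field W f -> torsionfree_frame f W ->
  (forall z, W z -> (f z).2 ord0 k != 0) ->
  forall l, hol W (fun y => (((f y).2 ord0 k)^-1 *: (f y).2) ord0 l).
Proof.
move=> oW fW tf fk l; have [_ r2] := frame_rsm fW.
pose a y : C := ((f y).2 ord0 k)^-1.
have sa : csm W a by exact (csmV oW fk (r2 k)).
pose v y := a y *: (f y).2.
have sv : rsm W v by exact (rsmZ oW sa r2).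
split; first exact (sv l).
move=> z Wz.
pose th u := om (f z).2 (rdiff (fun y => (f y).1) z u).
have [e eE] : exists e : V, e = J (f z).1 by exists (J (f z).1).
pose y2 := (f z).2.
have dv u : exists b, rdiff v z u = (a z * th u) *: e + b *: y2.
  have [_ ->] := rdiffZ (csm_der u sa Wz) (rsm_der u r2 Wz).
  rewrite (torsionfree_de2 u oW fW tf Wz) -eE scalerDr !scalerA -addrA -scalerDl.
  by eexists; reflexivity.
have vk u : rdiff v z u ord0 k = 0.
  have nW : \forall y \near z, W y by exact (open_nbhs_nbhs (conj oW Wz)).
  have n : \forall y \near z, v y ord0 k = 1.
    near=> y; have Wy : W y by near: y; exact nW.
    by rewrite mxE mulVf// fk.
  rewrite rdiffE; have [_ ->] := cdiff_near u n.
  by have [_ ->] := cdiff_cst (1 : C) z u.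
have yk : y2 ord0 k != 0 by exact: fk.
have dvE u : rdiff v z u = th u *: (a z *: e - (a z * e ord0 k / y2 ord0 k) *: y2).
  have [b E] := dv u; have := vk u; rewrite E !mxE => Eb.
  have -> : b = - (a z * th u * e ord0 k / y2 ord0 k).
    apply: (mulIf yk); rewrite mulNr divfK//.
    by apply/eqP; rewrite -addr_eq0 addrC Eb.
  rewrite scalerBr !scalerA -scaleNr; congr (_ *: _ + _ *: _); first by rewrite mulrC.
  by ring.
have tth : type10 th by have [_ _ h] := tf z Wz.
move=> u; rewrite -[LHS](rdiffE v z (iplane u) l) -[cdiff _ z u](rdiffE v z u l).
by rewrite !dvE [LHS]mxE [X in _ = _ * X]mxE tth mulrA.
Unshelve. all: by end_near. Qed.

Variables (X : M -> CP3 R) (L : M -> {vspace 'M[R[i]]_4}).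
Hypothesis Mconn : connected [set: M].
Hypothesis pX : pseudoholomorphic_curve X.
Hypothesis IX : I1_nonzero X.
Hypothesis hL : is_L X L.
Hypothesis vII : vanishing_II X L.
Local Notation Y := (tensor_map X L).

Lemma tensor_map_holomorphic : holomorphic_map Y.
Proof.
move=> x; have [c [W [f [[[fW lX] lY _] tf cx Wx]]]] := null_torsion_frames x pX hL vII.
have [ac oW WI fY] := lY; have [_ r2] := frame_rsm fW.
have [k fk] := neq0_coord (lift_neq0 lY Wx).
pose W' := W `&` [set z | (f z).2 ord0 k != 0].
have oW' : open W'.
  rewrite openE => z [Wz fz]; rewrite /interior.
  exact (filterI (open_nbhs_nbhs (conj oW Wz)) (contC_neq0 (csm_contC (r2 k) Wz) fz)).
have fW' : frame_field W' f.
  have [h1 h2 h3] := fW; split; last by move=> z [/h3].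
    by apply/rsmP; apply: (@rsm_sub R W) => [z []//|]; exact/rsmP.
  by apply/rsmP; apply: (@rsm_sub R W) => [z []//|]; exact/rsmP.
have tf' : torsionfree_frame f W' by move=> z [/tf].
exists c, W', (fun y => ((f y).2 ord0 k)^-1 *: (f y).2); split => //.
- split => //; first by move=> z [/WI].
  by move=> z [Wz fz]; rewrite fY// vline_scale// invr_eq0.
- move=> l; apply/holP.
  exact (torsionfree_hol oW' fW' tf' (fun z (h : W' z) => proj2 h) l).
Qed.

Lemma tensor_map_contact : contact_integral Y.
Proof.
move=> d W' g [gW lg] q Wq u; rewrite kappa21E.
have [c [W [f [[[fW lX] lY _] tf cx Wx]]]] := null_torsion_frames (cinv d q) pX hL vII.
have [_ r2] := frame_rsm fW; have [_ s2] := frame_rsm gW.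
have ac : atlas c by have [] := lY.
have Jt := chart_jet lY lg r2 s2 Wx Wq (cmapK ac cx).
have ct : contact_jet (fun z => (f z).2) (cmap c (cinv d q)).
  by move=> u'; have [_ h _] := tf _ Wx; exact: h.
exact (contact_jet_same Jt ct u).
Qed.

Lemma noncritical_theta (x : M) c W f : splitting_frame X Y L c W f -> torsionfree_frame f W ->
  cdom c x -> W (cmap c x) -> ~ critical Y x ->
  exists u, om (f (cmap c x)).2 (rdiff (fun y => (f y).1) (cmap c x) u) != 0.
Proof.
move=> [[fW lX] lY _] tf cx Wx ncr; apply: contrapT => H; apply: ncr.
exists c, W, (fun z => (f z).2); split => //; first by have [_ ] := frame_rsm fW.
move=> u; have oW : open W by have [] := lY.
rewrite (torsionfree_de2 u oW fW tf Wx).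
have -> : om (f (cmap c x)).2 (rdiff (fun y => (f y).1) (cmap c x) u) = 0.
  by apply/eqP; apply: contrapT => /negP nz; apply: H; exists u.
by rewrite scale0r add0r; eexists; reflexivity.
Qed.

(** Where dY vanishes, theta vanishes, and the structure equations leave no
    horizontal part in dX. *)
Lemma I1_critical d W' g q u : frame_along1 X d W' g -> W' q -> critical Y (cinv d q) ->
  I1 g q u = 0.
Proof.
move=> [gW lg] Wq cr.
have [c [W [f [[[fW lX] lY _] tf cx Wx]]]] := null_torsion_frames (cinv d q) pX hL vII.
have [r1 r2] := frame_rsm fW; have [s1 _] := frame_rsm gW.
have oW : open W by have [] := lY.
have ac : atlas c by have [] := lY.
set p := cmap c (cinv d q) in Wx.
have [_ yy ey ey'] := frame_field_facts fW Wx.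
have th0 u' : om (f p).2 (rdiff (fun y => (f y).1) p u') = 0.
  have [k Ek] := critical_lift cr lY r2 Wx (cmapK ac cx) u'.
  have [_ <-] := frame_skew oW fW u' Wx.
  by rewrite Ek omZr ey' mulr0.
have [k [A [m [k0 E AI dE]]]] := chart_jet lX lg r1 s1 Wx Wq (cmapK ac cx).
have [a [b Eab]] := torsionfree_de1 fW tf Wx (th0 (A u)).
have [_ _ gh go] := frame_field_facts gW Wq.
have hf : hm (g q).2 (f p).1 = 0.
  by apply: (mulfI k0); rewrite mulr0 -hmZr -E hmC gh conjc0.
have of_ : om (g q).2 (f p).1 = 0.
  by apply: (mulfI k0); rewrite mulr0 -omZr -E omC go oppr0.
have dgE := dE u; rewrite Eab in dgE.
rewrite I1E dgE.
rewrite !(hmDr, omDr, hmZr, omZr) hmJr omJr hf of_ conjc0 oppr0 !(mulr0, addr0) !scale0r addr0.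
exact: mulmx0.
Qed.

(** If Y were constant then I_1 would vanish everywhere. *)
Lemma tensor_map_nonconstant : nonconstant Y.
Proof.
apply: contrapT => nY.
have Yc x y : Y x = Y y by apply: contrapT => xy; apply: nY; exists x, y.
have [c [W [g [z [u [fa Wz nz]]]]]] := IX.
apply: nz; apply: (I1_critical u fa Wz).
apply: locally_const_critical; first exact: tensor_map_holomorphic.
by apply: nearW => y; exact: Yc.
Qed.

(** Where dY does not vanish, I_1 does not vanish either and spans L. Such
    points are dense. *)
Lemma tensor_map_unique L' : is_L X L' -> tensor_map X L' = Y.
Proof.
move=> hL'; apply: smooth_maps_agree.
- by apply: tensor_map_smooth; have [] := hL'.
- by apply: tensor_map_smooth; have [] := hL.
move=> U oU U0.
have [x Ux ncr] := noncritical_dense Mconn tensor_map_holomorphic tensor_map_nonconstant oU U0.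
exists x => //.
have [c [W [f [sf tf cx Wx]]]] := null_torsion_frames x pX hL vII.
have [u nu] := noncritical_theta sf tf cx Wx ncr.
have [fa lY fL] := sf; have [fW lX] := fa.
have ac : atlas c by have [] := lY.
have [_ IL] := hL; have [hL1 IL'] := hL'.
set p := cmap c x in Wx nu.
have [_ yy _ _] := frame_field_facts fW Wx.
have nI : I1 f p u != 0.
  rewrite I1E; apply/eqP => E; have [ee _ _ _] := frame_field_facts fW Wx.
  have := congr1 (mulmx (f p).1) E; rewrite ehe// mulmx0 => E'.
  have := congr1 (om (f p).2) E'; rewrite om0r omDr !omZr omvv omJr yy conjc1 mulr1 mulr0 add0r.
  by move=> E0; rewrite E0 eqxx in nu.
have [c' [W' [f' [[_ lY' fL'] cx' Wx']]]] := is_L_frames x hL1.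
have ac' : atlas c' by have [] := lY'.
have line_of (T : vectType C) (A w : T) : w != 0 -> w \in <[A]>%VS -> <[A]>%VS = <[w]>%VS.
  move=> w0 /vlineP[k E]; rewrite E vline_scale//.
  by apply: contraNneq w0 => k0; rewrite E k0 scale0r.
rewrite /tensor_map; congr tensor_line.
have Lx := fL _ Wx; have Lx' := fL' _ Wx'; rewrite !cmapK// in Lx Lx'.
have I := IL c W f fa p Wx u; have I' := IL' c W f fa p Wx u.
rewrite /p cmapK// Lx in I; rewrite /p cmapK// Lx' in I'.
by rewrite Lx Lx' (line_of _ _ _ nI I) (line_of _ _ _ nI I').
Qed.

End ForwardMap.

Section Injectivity.
Variables (R : realType) (M : riemann_surface R).
Hypothesis Mconn : connected [set: M].
Local Notation C := R[i].
Local Notation V := 'rV[R[i]]_4.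
Implicit Types (X Y : M -> CP3 R) (L : M -> {vspace 'M[R[i]]_4}).

(** At a noncritical point of Y the line of X is the image under J of the
    Hermitian complement of Y in its tangent line. *)
Lemma tensor_map_injective X L X' L' :
  pseudoholomorphic_curve X -> I1_nonzero X -> is_L X L -> vanishing_II X L ->
  pseudoholomorphic_curve X' -> is_L X' L' -> vanishing_II X' L' ->
  tensor_map X L = tensor_map X' L' -> X = X'.
Proof.
move=> pX IX hL vL pX' hL' vL' EY.
apply: smooth_maps_agree; [by have [] := pX|by have [] := pX'|].
move=> U oU U0.
have hY := tensor_map_holomorphic pX hL vL.
have nY := tensor_map_nonconstant pX IX hL vL.
have [x Ux ncr] := noncritical_dense Mconn hY nY oU U0.
exists x => //.
have [c [W [f [[[fW lX] lY _] tf cx Wx]]]] := null_torsion_frames x pX hL vL.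
have [d [W' [g [sg tg dx W'x]]]] := null_torsion_frames x pX' hL' vL'.
have ncr' : ~ critical (tensor_map X' L') x by rewrite -EY.
have [u nu] := noncritical_theta sg tg dx W'x ncr'.
have [[gW lX'] lY' _] := sg.
have ac : atlas c by have [] := lY.
have ad : atlas d by have [] := lY'.
have oW : open W by have [] := lY.
have oW' : open W' by have [] := lY'.
have [_ r2] := frame_rsm fW; have [_ s2] := frame_rsm gW.
rewrite -EY in lY'.
have E : cinv c (cmap c x) = cinv d (cmap d x) by rewrite !cmapK.
have [k [A [m [k0 Ek _ dE]]]] := chart_jet lY lY' r2 s2 Wx W'x E.
set p := cmap c x in Wx E Ek dE; set q := cmap d x in W'x nu E Ek dE.
have := dE u.
rewrite (torsionfree_de2 u oW' gW tg W'x) (torsionfree_de2 (A u) oW fW tf Wx).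
set th' := om (g q).2 _ in nu *; set th := om (f p).2 _.
set b' := hm (g q).2 _; set b := hm (f p).2 _ => H.
have [_ yy ey ey'] := frame_field_facts fW Wx.
have [_ yy' gey gey'] := frame_field_facts gW W'x.
have H2 := congr1 (hm (g q).2) H.
have gf1 : hm (g q).2 (J (f p).1) = 0.
  by rewrite Ek hmZl hmJr omC ey' oppr0 conjc0 oppr0 mulr0.
have gg1 : hm (g q).2 (J (g q).1) = 0 by rewrite hmJr omC gey' oppr0 conjc0 oppr0.
have fE : (f p).2 = k^-1 *: (g q).2 by rewrite Ek scalerA mulVf// scale1r.
have H' : th' *: J (g q).1 + b' *: (g q).2 = (k * th) *: J (f p).1 + ((k * b + m u) / k) *: (g q).2.
  rewrite H scalerDr fE !scalerA -addrA -scalerDl; congr (_ + _ *: _); ring.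
have bb : b' = (k * b + m u) / k.
  have := congr1 (hm (g q).2) H'; rewrite !hmDr !hmZr gf1 gg1 yy' !mulr0 !add0r !mulr1; exact.
(* The components along e_2 agree by orthogonality, and the remaining ones
   determine the line of X. *)
have H3 : th' *: J (g q).1 = (k * th) *: J (f p).1.
  by move: H'; rewrite bb => /addIr.
have H4 : J (th'^-* *: (g q).1) = J ((k * th)^-* *: (f p).1) by rewrite !JZ !conjcK.
have H5 : th'^-* *: (g q).1 = (k * th)^-* *: (f p).1.
  by have := congr1 (@J R) H4; rewrite !JJ => /oppr_inj.
apply: val_inj; rewrite /=.
have [_ _ _ fX] := lX; have [_ _ _ gX] := lX'.
have Xp := fX _ Wx; have Xq := gX _ W'x; rewrite !cmapK// in Xp Xq.
have nth : th'^-* != 0 by rewrite conjc_eq0.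
have nkth : (k * th)^-* != 0.
  apply/eqP => e; move: H5; rewrite e scale0r => /eqP; rewrite scaler_eq0 (negbTE nth) /=.
  by rewrite (negbTE (lift_neq0 lX' W'x)).
have h1 := vline_scale (g q).1 nth; have h2 := vline_scale (f p).1 nkth.
by rewrite Xp Xq -h1 -h2 H5.
Qed.

End Injectivity.

(** * The frame defined by a Lagrangian tangent line *)

Section TangentFrame.
Variable R : realType.
Local Notation C := R[i].
Local Notation V := 'rV[R[i]]_4.
Implicit Types (z u : R * R).

(** [perp v t] is |v|^2 times the component of t orthogonal to v; the factor
    avoids a division in the derivatives. *)
Definition perp (v t : V) : V := hm v v *: t - hm v t *: v.

Lemma perp_change (k a b : C) (v t : V) :
  perp (k *: v) (a *: t + b *: v) = (k^-* * k * a) *: perp v t.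
Proof.
rewrite /perp !(hmZl, hmZr, hmDr).
move: (hm v v) (hm v t) (k^-*) => x y k'.
by apply/rowP => i; rewrite !mxE; ring.
Qed.

Lemma hm_perp (v t : V) : hm v (perp v t) = 0.
Proof. by rewrite hmDr hmNr !hmZr mulrC subrr. Qed.

Lemma om_perp (v t : V) : om v t = 0 -> om v (perp v t) = 0 /\ om t (perp v t) = 0.
Proof.
move=> vt; have tv : om t v = 0 by rewrite omC vt oppr0.
by rewrite !omDr !omNr !omZr vt tv !omvv !mulr0 subrr.
Qed.

Lemma hm_perp_perp (v t : V) : hm (perp v t) (perp v t) = hm v v * hm (perp v t) t.
Proof.
have E : hm (perp v t) v = 0 by rewrite hmC hm_perp conjc0.
by rewrite {2}/perp hmDr hmNr !hmZr E mulr0 subr0.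
Qed.

Lemma rsm_perp (D : set (R * R)) (v t : R * R -> V) : open D -> rsm D v -> rsm D t ->
  rsm D (fun y => perp (v y) (t y)).
Proof.
move=> oD sv st.
have h1 := rsmZ oD (csm_hm oD sv sv) st.
have h2 := rsmZ oD (csmN oD (csm_hm oD sv st)) sv.
have := rsmD oD h1 h2; rewrite (_ : (fun y => _ + _) = fun y => perp (v y) (t y))//.
by apply/funext => y; rewrite scaleNr.
Qed.

Lemma cdiff_nrm (D : set (R * R)) (w : R * R -> V) z u : open D ->
  (forall z, D z -> w z != 0) -> rsm D w -> D z ->
  cdiff (fun y => (nrm (w y))%:C) z u =
  (hm (w z) (rdiff w z u) + (hm (w z) (rdiff w z u))^-*) / (2 * (nrm (w z))%:C).
Proof.
move=> oD w0 sw Dz; have sn := csm_nrm oD w0 sw.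
have [_ E] := cdiffM (csm_der u sn Dz) (csm_der u sn Dz).
have [_ E'] := cdiff_hm (rsm_der u sw Dz) (rsm_der u sw Dz).
have n : \forall y \near z, (nrm (w y))%:C * (nrm (w y))%:C = hm (w y) (w y).
  near=> y; exact: nrm_sqr.
have [_ En] := cdiff_near u n; rewrite -En E in E'.
have n0 := nrmC_neq0 (w0 z Dz).
rewrite -(hmC (w z) (rdiff w z u)) [X in X / _]addrC -E'.
by field; rewrite ?n0 ?pnatr_eq0.
Unshelve. all: by end_near. Qed.

(** The connection form of a normalised vector field is the imaginary part of
    the one of the field, divided by its squared length. *)
Lemma hm_unitize_diff (D : set (R * R)) (w : R * R -> V) z u : open D ->
  (forall z, D z -> w z != 0) -> rsm D w -> D z ->
  hm (unitize (w z)) (rdiff (fun y => unitize (w y)) z u) =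
  (hm (w z) (rdiff w z u) - (hm (w z) (rdiff w z u))^-*) / (2 * ((nrm (w z))%:C * (nrm (w z))%:C)).
Proof.
move=> oD w0 sw Dz; have sn := csm_nrm oD w0 sw.
have n0 y : D y -> (nrm (w y))%:C != 0 :> C by move=> /w0; exact: nrmC_neq0.
have sV := csmV oD n0 sn.
have [_ ->] := rdiffZ (csm_der u sV Dz) (rsm_der u sw Dz).
rewrite (cdiffV u oD sn n0 Dz) (cdiff_nrm u oD w0 sw Dz).
rewrite hmZl hmDr !hmZr conjc_inv conjc_real -nrm_sqr.
move: (hm (w z) _) => H; have := n0 z Dz; move: ((nrm (w z))%:C) => n n0'.
by move: (H^-*) => Hc; field; rewrite ?n0' ?pnatr_eq0.
Qed.

Variables (W : set (R * R)) (v t : R * R -> V) (th : R * R -> R * R -> C).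
Hypothesis oW : open W.
Hypothesis hv : forall l, hol W (fun y => v y ord0 l).
Hypothesis ht : forall l, hol W (fun y => t y ord0 l).
Hypothesis v0 : forall z, W z -> v z != 0.
Hypothesis b0 : forall z, W z -> perp (v z) (t z) != 0.
Hypothesis vt : forall z, W z -> om (v z) (t z) = 0.
Hypothesis dv : forall z u, W z -> rdiff v z u = th z u *: t z.
Hypothesis th10 : forall z, W z -> type10 (th z).

Local Notation b := (fun y => perp (v y) (t y)).
Local Notation e1 := (fun y => unitize (J (perp (v y) (t y)))).
Local Notation e2 := (fun y => unitize (v y)).

Let sv := hol_rsm hv.
Let st := hol_rsm ht.

Let sb : rsm W b := rsm_perp oW sv st.

Let db z u : W z -> exists (x y : C), rdiff b z u =
  (hm (rdiff v z u) (v z) + hm (v z) (rdiff v z u)) *: t z + hm (v z) (v z) *: rdiff t z u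
  + x *: v z + y *: t z /\ y = - (hm (v z) (t z) * th z u).
Proof.
move=> Wz.
have dvz := rsm_der u sv Wz; have dtz := rsm_der u st Wz.
have [d1 E1] := cdiff_hm dvz dvz; have [d2 E2] := cdiff_hm dvz dtz; have [d3 E3] := cdiffN d2.
have [d4 E4] := rdiffZ d1 dtz; have [d5 E5] := rdiffZ d3 dvz.
have [_ E6] := rdiffD d4 d5.
have -> : b = (fun y => hm (v y) (v y) *: t y + (- hm (v y) (t y)) *: v y).
  by apply/funext => y; rewrite scaleNr.
exists (cdiff (fun y => - hm (v y) (t y)) z u), (- (hm (v z) (t z) * th z u)); split => //.
rewrite E6 E4 E5 E1 [X in _ + (_ *: X + _)]dv// scalerA mulNr.
rewrite addrA [X in X + _ + _]addrC -!addrA; congr (_ + (_ + _)); exact: addrC.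
Qed.

(** As v and Jv span the orthogonal complement of b H, the horizontal part of
    d(Jb) is given by h(v, db) and o(v, db), and the relations h(v, b) = o(v, b)
    = 0 differentiate to expressions in theta. The vertical part is the
    conjugate of |v|^2 o(b, dt), and t is holomorphic. *)
Lemma tangent_pseudohol z : W z -> pseudohol_jet (fun y => J (b y)) z.
Proof.
move=> Wz.
have vb := hm_perp (v z) (t z); have [ob otb] := om_perp (vt Wz).
set bz := perp (v z) (t z) in vb ob otb.
have dJb u := proj2 (rdiffJ (rsm_der u sb Wz)).
have n (P : R * R -> Prop) := @near_open _ W z P oW Wz.
have hvb u : hm (v z) (rdiff b z u) = - (th z u)^-* * hm (t z) bz.
  have [_ E] := cdiff_hm (rsm_der u sv Wz) (rsm_der u sb Wz).
  have [_ E'] := cdiff_near u (n _ (fun y _ => hm_perp (v y) (t y))).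
  have [_ E0] := cdiff_cst (0 : C) z u; rewrite E' E0 dv// hmZl in E.
  by rewrite mulNr; apply/eqP; rewrite -addr_eq0 addrC -E.
have ovb u : om (v z) (rdiff b z u) = 0.
  have [_ E] := cdiff_om (rsm_der u sv Wz) (rsm_der u sb Wz).
  have [_ E'] := cdiff_near u (n _ (fun y Wy => proj1 (om_perp (vt Wy)))).
  have [_ E0] := cdiff_cst (0 : C) z u; rewrite E' E0 dv// omZl otb mulr0 add0r in E.
  by rewrite -E.
split.
  move=> y; rewrite -/bz hmJr omJr => /eqP; rewrite oppr_eq0 conjc_eq0 => /eqP yb.
  move=> /eqP; rewrite conjc_eq0 => /eqP yb'.
  have fr : is_frame (unitize bz, unitize (v z)).
    apply/is_frameP; split; rewrite ?hm_unitize ?b0 ?v0//.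
      by rewrite hmZl hmZr hmC vb conjc0 !mulr0.
    by rewrite omZl omZr omC ob oppr0 !mulr0.
  have Ey := frame_expand y fr.
  have h1 : hm (unitize bz) y = 0 by rewrite hmZl hmC yb' conjc0 mulr0.
  have h2 : om (unitize bz) y = 0 by rewrite omZl omC yb oppr0 mulr0.
  rewrite h1 h2 !scale0r !add0r JZ !scalerA in Ey.
  set al := (X in X *: v z + _) in Ey; set be := (X in _ + X *: _) in Ey.
  have E u : hm y (rdiff (fun y => J (b y)) z u) = - (be^-* * (hm (t z) bz)^-*) * th z u.
    rewrite dJb hmJr Ey omDl !omZl omJl ovb hvb mulr0 add0r.
    rewrite !(conjcM, conjcN) !conjcK; ring.
  rewrite (_ : (fun u => _) = (fun u => - (be^-* * (hm (t z) bz)^-*) * th z u)).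
    exact: (@type10_comp R _ (fun u => u)) (th10 Wz).
  by apply/funext => u; exact: E.
have E u : (om (J bz) (rdiff (fun y => J (b y)) z u))^-* = hm (v z) (v z) * om bz (rdiff t z u).
  rewrite dJb omJr conjcK hmJl.
  have [x [y [-> yE]]] := db u Wz.
  have bv : om bz (v z) = 0 by rewrite omC ob oppr0.
  have bt : om bz (t z) = 0 by rewrite omC otb oppr0.
  by rewrite !omDr !omZr bv bt !mulr0 add0r !addr0.
rewrite (_ : (fun u => _) = (fun u => hm (v z) (v z) * om bz (rdiff t z u))).
  move=> u; have -> : rdiff t z (iplane u) = 'i *: rdiff t z u.
    by apply/rowP => l; rewrite [RHS]mxE !rdiffE; exact (proj2 (ht l) z Wz u).
  by rewrite omZr mulrCA.
by apply/funext => u; exact: E.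
Unshelve. all: by end_near. Qed.

Let Jb0 z : W z -> J (b z) != 0. Proof. by move=> Wz; rewrite J_eq0 b0. Qed.

Lemma tangent_frame_field : frame_field W (fun y => (e1 y, e2 y)).
Proof.
split.
- by apply/rsmP; exact (rsm_unitize oW Jb0 (rsmJ oW sb)).
- by apply/rsmP; exact (rsm_unitize oW v0 sv).
move=> z Wz; have [ob _] := om_perp (vt Wz).
apply/is_frameP; split; rewrite ?hm_unitize ?v0 ?Jb0//.
  by rewrite hmZl hmZr hmJl omC ob oppr0 !mulr0.
by rewrite omZl omZr omJl hmC hm_perp conjc0 oppr0 !mulr0.
Qed.

Let de2 z u : W z -> exists (x y : C), rdiff e2 z u = x *: v z + y *: t z /\
  y = ((nrm (v z))%:C)^-1 * th z u.
Proof.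
move=> Wz.
have sn : csm W (fun y => ((nrm (v y))%:C)^-1).
  by apply: csmV (csm_nrm oW v0 sv) => // y Wy; rewrite nrmC_neq0// v0.
have [_ ->] := rdiffZ (csm_der u sn Wz) (rsm_der u sv Wz).
exists (cdiff (fun y => ((nrm (v y))%:C)^-1) z u), (((nrm (v z))%:C)^-1 * th z u); split => //.
by rewrite dv// scalerA addrC.
Qed.

(** The differential of v/|v| has no component along Jb or Jv because the
    tangent line is Lagrangian; [frame_skew] transfers this to e_1. *)
Lemma tangent_relations z u : W z -> [/\ hm (e2 z) (rdiff e1 z u) = 0,
  om (e2 z) (rdiff e2 z u) = 0 & om (e2 z) (rdiff e1 z u) =
  - (((nrm (J (b z)))%:C)^-1 * ((nrm (v z))%:C)^-1 * hm (b z) (t z)) * th z u].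
Proof.
move=> Wz; have fW := tangent_frame_field.
have [/= k1 k2] := frame_skew oW fW u Wz.
have [ob otb] := om_perp (vt Wz).
have [x [y [E yE]]] := de2 u Wz.
have h1 : hm (e1 z) (rdiff e2 z u) = 0.
  rewrite E hmDr !hmZr !hmZl !hmJl (omC (v z)) (omC (t z)) ob otb.
  by rewrite oppr0 !mulr0 addr0.
have h2 : om (e1 z) (rdiff e2 z u) =
    - (((nrm (J (b z)))%:C)^-1 * ((nrm (v z))%:C)^-1 * hm (b z) (t z)) * th z u.
  rewrite E omDr !omZr !omZl !omJl (hmC (v z)) hm_perp conjc0 yE; ring.
split; last by rewrite -k2 h2.
  by move: k1; rewrite h1 => /eqP; rewrite eq_sym oppr_eq0 conjc_eq0 => /eqP.
by rewrite E omDr !omZr !omZl omvv vt// !mulr0 addr0.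
Qed.

(** The first coefficient may be 0 because kappa_{1 bar 2} = 0. The second one,
    |Jb| / |v|^3, is found from its logarithmic derivative, which has to cancel
    the part of type (0,1) of kappa_{2 bar 2}; that part comes from the lengths
    of Jb and v, and |b|^2 = |v|^2 h(b, t). *)
Lemma tangent_holomorphic_section : holomorphic_section W (fun y => (e1 y, e2 y)) (fun=> 0)
  (fun y => (nrm (J (b y)))%:C * (((nrm (v y))%:C)^-1 * ((nrm (v y))%:C)^-1 * ((nrm (v y))%:C)^-1)).
Proof.
have sJb : rsm W (fun y => J (b y)) by exact (rsmJ oW sb).
have slam := csm_nrm oW Jb0 sJb; have snu := csm_nrm oW v0 sv.
have nu0 y : W y -> (nrm (v y))%:C != 0 :> C by move=> /v0; exact: nrmC_neq0.
have sm := csmV oW nu0 snu.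
have smm := csmM oW (csmM oW sm sm) sm.
have ss := csmM oW slam smm.
set S := (X in holomorphic_section _ _ _ X).
split; [exact/csmoothP/csm_cst|exact/csmoothP|].
move=> z Wz.
have [ob otb] := om_perp (vt Wz).
have fW := tangent_frame_field.
split.
  have A u : cdiff (fun=> 0 : C) z u + (kappa11 (fun y => (e1 y, e2 y)) z u * 0 +
      kappa12 (fun y => (e1 y, e2 y)) z u * S z) = 0.
    have [_ ->] := cdiff_cst (0 : C) z u.
    have [_ h _] := tangent_relations u Wz.
    by rewrite mulr0 !add0r kappa12E /= h conjc0 oppr0 mul0r.
  move=> u; exact (etrans (A (iplane u)) (etrans (esym (mulr0 'i)) (f_equal (fun x => 'i * x) (esym (A u))))).
set bz := perp (v z) (t z) in ob otb.
have bt0 : hm bz (t z) != 0.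
  apply/eqP => E; have := hmvv_neq0 (b0 Wz).
  by rewrite hm_perp_perp -/bz E mulr0 eqxx.
pose K u := hm bz (rdiff t z u) / hm bz (t z) - 2 * (hm (v z) (t z) * th z u) / hm (v z) (v z).
pose s := (nrm (J bz))%:C * (((nrm (v z))%:C)^-1 * ((nrm (v z))%:C)^-1 * ((nrm (v z))%:C)^-1) : C.
have tK : type10 (fun u => s * K u).
  apply: (@type10_comp R s (fun u => u)) => // u.
  have E : rdiff t z (iplane u) = 'i *: rdiff t z u.
    by apply/rowP => l; rewrite [RHS]mxE !rdiffE; exact (proj2 (ht l) z Wz u).
  rewrite /K E hmZr (th10 Wz u).
  move: (hm bz _) (hm bz _)^-1 (hm (v z) (t z)) (th z u) (hm (v z) (v z))^-1 => *; ring.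
suff A u : cdiff S z u + (kappa21 (fun y => (e1 y, e2 y)) z u * 0 +
    kappa22 (fun y => (e1 y, e2 y)) z u * S z) = s * K u.
  move=> u; exact (etrans (A (iplane u)) (etrans (tK u) (f_equal (fun x => 'i * x) (esym (A u))))).
rewrite mulr0 add0r (kappa22E oW fW u Wz) /=.
have dvz := rsm_der u sv Wz.
have dJz := rsm_der u sJb Wz.
have [_ E1] := cdiffM (csm_der u slam Wz) (csm_der u smm Wz).
have [dmm E2] := cdiffM (csm_der u sm Wz) (csm_der u sm Wz).
have [_ E3] := cdiffM dmm (csm_der u sm Wz).
have Em := cdiffV u oW snu nu0 Wz.
rewrite {}E1 {}E3 {}E2 {}Em.
rewrite (cdiff_nrm u oW Jb0 sJb Wz) (cdiff_nrm u oW v0 sv Wz).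
rewrite (hm_unitize_diff u oW Jb0 sJb Wz) (hm_unitize_diff u oW v0 sv Wz).
have [_ ->] := rdiffJ (rsm_der u sb Wz).
have [x [y [Eb Ey]]] := db u Wz.
have bv : hm bz (v z) = 0 by rewrite hmC hm_perp conjc0.
have HJ w1 w2 : hm (J w1) (J w2) = (hm w1 w2)^-* by rewrite hmJl omJr.
have lam2 := nrm_sqr (J bz); have nu2 := nrm_sqr (v z).
rewrite HJ /bz hm_perp_perp -/bz in lam2.
rewrite -/bz !HJ conjcK.
have Nb : (hm bz (t z))^-* = hm bz (t z).
  have : hm bz bz = (hm bz bz)^-* by rewrite {1}hmC.
  rewrite /bz hm_perp_perp -/bz conjcM.
  have -> : (hm (v z) (v z))^-* = hm (v z) (v z) by rewrite -hmC.
  by move/(mulfI (hmvv_neq0 (v0 Wz))) => <-.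
have Nv : (hm (v z) (v z))^-* = hm (v z) (v z) by rewrite -hmC.
have NN : hm (v z) (rdiff v z u) = th z u * hm (v z) (t z) by rewrite dv// hmZr.
have BB : hm bz (rdiff b z u) = ((hm (v z) (rdiff v z u))^-* + hm (v z) (rdiff v z u)) * hm bz (t z)
   + hm (v z) (v z) * hm bz (rdiff t z u) - hm (v z) (t z) * th z u * hm bz (t z).
  rewrite Eb !hmDr !hmZr bv Ey mulr0 addr0 mulNr; congr (_ * _ + _ - _).
  by rewrite -hmC.
rewrite BB NN.
rewrite conjcM Nv Nb in lam2.
have l0 : (nrm (J bz))%:C != 0 :> C by apply: nrmC_neq0; exact: (Jb0 Wz).
have n0 := nu0 z Wz.
have vv0 := hmvv_neq0 (v0 Wz).
rewrite /s /K /S -/bz.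
move: lam2 nu2 l0 n0 vv0 bt0.
move: (hm (v z) (v z)) (hm bz (t z)) (hm (v z) (t z)) (th z u) (hm bz (rdiff t z u)) => NV BT VT TH BDT.
move: ((nrm (J bz))%:C) ((nrm (v z))%:C) => LA NU.
move: ((TH * VT)^-*) => Nc.
move: (conjc _) => Bc E1 E2 l0 n0 vv0 bt0.
(* This is |b|^2 = |v|^2 h(b, t). *)
have EB : BT = LA * LA / (NU * NU).
  by rewrite E1 -E2; field; rewrite n0.
rewrite EB -E2; field.
by rewrite ?l0 ?n0 ?mulf_neq0.
Qed.

End TangentFrame.

(** * The null-torsion curve of a contact curve *)

Section Surjectivity.
Variables (R : realType) (M : riemann_surface R).
Local Notation C := R[i].
Local Notation V := 'rV[R[i]]_4.
Implicit Types (z u : R * R) (c d : chart R M) (W : set (R * R)) (f g : R * R -> C4 R * C4 R).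

(** The quaternionic line of y has complex dimension at most 2. *)
Lemma outside_quaternionic_line (y : V) : exists a : V,
  a - hm y a *: y - om y a *: J y != 0.
Proof.
apply: contrapT => H.
have all0 (a : V) : a \in (<[y]> + <[J y]>)%VS.
  have -> : a = hm y a *: y + om y a *: J y.
    apply/eqP; rewrite -subr_eq0 opprD addrA; apply: contrapT => /negP nz.
    by apply: H; exists a.
  by apply: memv_add; rewrite memvZ// memv_line.
have : (fullv <= <[y]> + <[J y]>)%VS by apply/subvP.
move/dimvS; rewrite dimvf /dim/= => h.
have := leq_trans h (dimv_add_leqif <[y]>%VS <[J y]>%VS).
by rewrite !dim_vline; case: (_ != 0); case: (_ != 0).
Qed.

(** The Gram-Schmidt process over the quaternions, applied to a constant
    vector. *)
Lemma complete_frame W (y : R * R -> V) z : open W -> rsm W y ->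
  (forall p, W p -> hm (y p) (y p) = 1) -> W z ->
  exists W' e, [/\ open W', W' `<=` W, W' z & frame_field W' (fun p => (e p, y p))].
Proof.
move=> oW sy yy Wz; have [a a0] := outside_quaternionic_line (y z).
pose q p : V := a + (- hm (y p) a) *: y p + (- om (y p) a) *: J (y p).
have qE p : q p = a - hm (y p) a *: y p - om (y p) a *: J (y p) by rewrite /q !scaleNr.
have sa : rsm W (fun=> a) by move=> k; exact (csm_cst (a ord0 k) oW).
have sq : rsm W q.
  exact (rsmD oW (rsmD oW sa (rsmZ oW (csmN oW (csm_hm oW sy sa)) sy))
    (rsmZ oW (csmN oW (csm_om oW sy sa)) (rsmJ oW sy))).
rewrite -qE in a0; have [k qk] := neq0_coord a0.
pose W' := W `&` [set p | q p ord0 k != 0].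
have sW : W' `<=` W by move=> p [].
have oW' : open W'.
  rewrite openE => p [Wp fp]; rewrite /interior.
  exact (filterI (open_nbhs_nbhs (conj oW Wp)) (contC_neq0 (csm_contC (sq k) Wp) fp)).
have q0 p : W' p -> q p != 0.
  by move=> [_]; apply: contraNneq => ->; rewrite mxE.
exists W', (fun p => unitize (q p)); split => //; split.
- by apply/rsmP; exact (rsm_unitize oW' q0 (rsm_sub sW sq)).
- by apply/rsmP; exact (rsm_sub sW sy).
move=> p W'p; have Wp := sW _ W'p.
have h1 : hm (y p) (q p) = 0.
  by rewrite qE !hmDr !hmNr !hmZr hmJr omvv yy// conjc0 oppr0 mulr0 mulr1 subrr sub0r oppr0.
have h2 : om (y p) (q p) = 0.
  by rewrite qE !omDr !omNr !omZr omJr omvv yy// conjc1 mulr0 mulr1 oppr0 addr0 subrr.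
apply/is_frameP; split; rewrite ?hm_unitize ?q0 ?yy//.
  by rewrite hmZl hmC h1 conjc0 mulr0.
by rewrite omZl omC h2 oppr0 mulr0.
Qed.

Variable Y : M -> CP3 R.
Hypothesis Mconn : connected [set: M].
Hypothesis hY : holomorphic_map Y.
Hypothesis nY : nonconstant Y.
Hypothesis cY : contact_integral Y.

(** The contact condition is stated for unit lifts which belong to a frame; it
    passes to all lifts by invariance of the jet. *)
Lemma contact_lift c W v z : homogeneous_lift Y c W v -> rsm W v -> W z -> contact_jet v z.
Proof.
move=> lv sv Wz; have [ac oW WI vY] := lv.
have v0 p : W p -> v p != 0 by exact: lift_neq0 lv.
have [W' [e [oW' sW W'z fW]]] := complete_frame oW (rsm_unitize oW v0 sv)
  (fun p Wp => hm_unitize (v0 p Wp)) Wz.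
have l2 : homogeneous_lift Y c W' (fun p => unitize (v p)).
  split => //; first exact: subset_trans WI.
  by move=> p /sW Wp; rewrite vY// vline_unitize// v0.
have ct : contact_jet (fun p => unitize (v p)) z.
  by move=> u; have := cY (conj fW l2) W'z u; rewrite kappa21E.
have [_ s2] := frame_rsm fW.
exact (contact_jet_same (chart_jet l2 lv s2 sv W'z Wz (erefl _)) ct).
Qed.

(** The relation o(v, dv) = 0 gives o(v, t) = 0 outside the centre, where it
    holds by continuity. *)
Lemma tangent_Lagrangian c z0 r k v n t z : tangent_lift Y c z0 r k v n t ->
  ball z0 r z -> om (v z) (t z) = 0.
Proof.
move=> [r0 lv [hv ht] vt dv] Bz.
have sv := hol_rsm hv.
have st := hol_rsm ht.
have oB : open (ball z0 r) by exact: ball_open.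
have off p : ball z0 r p -> p <> z0 -> om (v p) (t p) = 0.
  move=> Bp pz; have := contact_lift lv sv Bp (dx R); rewrite dv// omZr => /eqP.
  rewrite mulf_eq0 => /orP[|/eqP//]; rewrite mulf_eq0 expf_eq0 (negbTE (zc_neq0 pz)) andbF orbF.
  by rewrite eq_complex /= oner_eq0.
have [->|zz0] := pselect (z = z0); last exact: off.
exact (contC_zero (csm_om oB sv st) oB (ballxx z0 r0) off).
Qed.

Lemma perp_neq0 (k : 'I_4) (v t : V) : v ord0 k = 1 -> t ord0 k = 0 -> t != 0 -> perp v t != 0.
Proof.
move=> vk tk t0; apply/eqP => E.
have v0 : v != 0 by apply/eqP => v0; move/eqP: vk; rewrite v0 mxE eq_sym oner_eq0.
have := congr1 (fun x : V => x ord0 k) E; rewrite !mxE vk tk mulr0 mulr1 sub0r.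
move/eqP; rewrite oppr_eq0 => /eqP vt; move/eqP: E.
by rewrite /perp vt scale0r subr0 scaler_eq0 (negbTE (hmvv_neq0 v0)) (negbTE t0).
Qed.

Lemma tangent_perp_neq0 c z0 r k v n t z : tangent_lift Y c z0 r k v n t ->
  ball z0 r z -> perp (v z) (t z) != 0.
Proof. by move=> [_ _ _ vt _] Bz; have [vk tk t0] := vt z Bz; exact: perp_neq0 vk tk t0. Qed.

(** Outside the zeros of dY a change of lift multiplies v by a scalar and
    replaces t by a multiple of t plus a multiple of v; this rescales [perp v
    t]. *)
Lemma tangent_lift_line c z0 r k v n t z d w0 s l w m x : tangent_lift Y c z0 r k v n t ->
  tangent_lift Y d w0 s l w m x -> ball z0 r z -> z <> z0 -> cinv c z = cinv d w0 ->
  <[J (perp (w w0) (x w0))]>%VS = <[J (perp (v z) (t z))]>%VS.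
Proof.
move=> T T' Bz zz0 E.
have ncr := tangent_lift_noncritical T Bz zz0.
have nb' := tangent_perp_neq0 T'.
have [r0 lv [hv ht] vt dv] := T; have [s0 lw [hw hx] wx dw] := T'.
have sv := hol_rsm hv.
have sw := hol_rsm hw.
have Bw : ball w0 s w0 by exact: ballxx.
have [ac _ vI _] := lv; have [ad _ wI _] := lw.
have zw0 : zc w0 w0 = 0 by rewrite /zc !subrr.
(* Otherwise w0 would be a zero of dY. *)
have m0 : m = 0%N.
  apply: contrapT => mn; apply: ncr; rewrite E.
  have [cd mw] := cimg_cinv ad (wI _ Bw).
  exists d, (ball w0 s), w; rewrite mw; split => // u; exists 0.
  rewrite dw// zw0 expr0n; case: m mn {T' dw} => // m' _ /=.
  by rewrite mulr0 !scale0r.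
have [kk [A [mu [k0 Ek _ dE]]]] := chart_jet lv lw sv sw Bz Bw E.
have := dE (dx R); rewrite dw// dv// m0 expr0 mulr1 Ek scalerA.
have -> : (dx R).1 +i* (dx R).2 = 1 by [].
rewrite scale1r; set al := _ * _ => xE.
have nb := nb' _ Bw; rewrite xE Ek perp_change in nb.
rewrite xE perp_change JZ vline_scale// conjc_eq0.
by apply: contraNneq nb => ->; rewrite scale0r.
Qed.

(** A tangent lift is chosen about each point and gives the value of X there; on
    the rest of its disc it gives the same line as the lifts chosen at the other
    points. *)
Lemma tangent_map_exists : exists X : M -> CP3 R, forall x, exists c r k v n t,
  [/\ cdom c x, tangent_lift Y c (cmap c x) r k v n t & forall z, ball (cmap c x) r z ->
    val (X (cinv c z)) = <[J (perp (v z) (t z))]>%VS].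
Proof.
pose data := (chart R M * R * 'I_4 * (R * R -> V) * nat * (R * R -> V))%type.
pose P (x : M) (s : data) := let: (c, r, k, v, n, t) := s in
  cdom c x /\ tangent_lift Y c (cmap c x) r k v n t.
have [S HS] : {S : M -> data & forall x, P x (S x)}.
  apply: choice => x.
  have [c [r [k [v [n [t H]]]]]] := nonconst_tangent Mconn x hY nY.
  by exists (c, r, k, v, n, t).
pose X (x : M) : CP3 R := insubd (Y x) (let: (c, r, k, v, n, t) := S x in
  <[J (perp (v (cmap c x)) (t (cmap c x)))]>%VS).
exists X => x.
have := HS x; case Sx : (S x) => [[[[[c r] k] v] n] t] [cx T].
exists c, r, k, v, n, t; split => // z Bz.
have XE (y : M) c' r' k' v' n' t' : S y = (c', r', k', v', n', t') ->
    val (X y) = <[J (perp (v' (cmap c' y)) (t' (cmap c' y)))]>%VS.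
  move=> Sy; have := HS y; rewrite Sy => -[cy T'].
  have [r0' _ _ _ _] := T'.
  rewrite /X Sy insubdK// unfold_in dim_vline J_eq0 (tangent_perp_neq0 T')//.
  exact: ballxx.
have [r0 lv _ _ _] := T; have [ac _ vI _] := lv.
have [zz0|zz0] := pselect (z = cmap c x).
  by rewrite zz0 cmapK// (XE x _ _ _ _ _ _ Sx).
have := HS (cinv c z); case Sz : (S (cinv c z)) => [[[[[d s] l] w] m] y] [dz T'].
have ad : atlas d by have [_ [? _ _ _] _ _ _] := T'.
rewrite (XE _ _ _ _ _ _ _ Sz); apply: (tangent_lift_line T T' Bz zz0).
by rewrite cmapK.
Qed.

Section TangentMap.
Variable X : M -> CP3 R.
Hypothesis HX : forall x, exists c r k v n t,
  [/\ cdom c x, tangent_lift Y c (cmap c x) r k v n t & forall z, ball (cmap c x) r z ->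
    val (X (cinv c z)) = <[J (perp (v z) (t z))]>%VS].

Definition tangent_L (x : M) : {vspace 'M[C]_4} :=
  <[hconj (vpick (val (X x))) *m J (vpick (val (Y x)))]>%VS.

Lemma vpick_line (U : {vspace V}) (e : V) : U = <[e]>%VS -> e != 0 ->
  exists2 k : C, k != 0 & vpick U = k *: e.
Proof.
move=> -> e0; have /vlineP[k E] := memv_pick <[e]>%VS.
exists k => //; apply: contraTneq e0 => k0; rewrite negbK.
have : vpick <[e]>%VS == 0 by rewrite E k0 scale0r.
by rewrite vpick0 -dimv_eq0 dim_vline; case: (e == 0).
Qed.

Lemma tangent_L_line (x : M) (e y : V) : val (X x) = <[e]>%VS -> val (Y x) = <[y]>%VS ->
  e != 0 -> y != 0 -> tangent_L x = <[hconj e *m J y]>%VS.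
Proof.
move=> Xe Yy e0 y0; have [k k0 E] := vpick_line Xe e0; have [l l0 E'] := vpick_line Yy y0.
rewrite /tangent_L E E' hconjZ JZ -scalemxAl -scalemxAr scalerA vline_scale//.
by rewrite mulf_neq0// conjc_eq0.
Qed.

(** On a disc about x the frame is (Jb/|b|, v/|v|), with b orthogonal to v in
    the tangent line. Its component omega_2 is a nonzero multiple of dY, hence
    vanishes at most at the centre. *)
Lemma tangent_map_frames (x : M) : exists c W f, [/\ frame_along1 X c W f /\
   homogeneous_lift Y c W (fun z => (f z).2), cdom c x, W (cmap c x),
   forall z, W z -> [/\ pseudohol_jet (fun y => (f y).1) z,
     forall u, hm (f z).2 (rdiff (fun y => (f y).1) z u) = 0 &
     z <> cmap c x -> exists u, om (f z).2 (rdiff (fun y => (f y).1) z u) <> 0] &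
   exists s1 s2, holomorphic_section W f s1 s2 /\ forall z, W z -> s1 z = 0 /\ s2 z <> 0].
Proof.
have [c [r [k [v [n [t [cx T Xv]]]]]]] := HX x.
have [r0 lv [hv ht] vt dv] := T; have [ac oB vI vY] := lv.
set W := ball (cmap c x) r in lv hv ht vt dv Xv oB vI vY.
pose b z := perp (v z) (t z).
have b0 z : W z -> b z != 0 by exact: tangent_perp_neq0 T.
have Jb0 z : W z -> J (b z) != 0 by move=> Wz; rewrite J_eq0 b0.
have v0 z : W z -> v z != 0 by exact: lift_neq0 lv.
have ovt z : W z -> om (v z) (t z) = 0 by exact: tangent_Lagrangian T.
pose th z u : C := (u.1 +i* u.2) * zc (cmap c x) z ^+ n.
have dv' z u : W z -> rdiff v z u = th z u *: t z by exact: dv.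
have th10 z : W z -> type10 (th z).
  move=> _ u; rewrite /th /= mulrA; congr (_ * _).
  by apply: complex_ext; rewrite ?cReM ?cImM /=; ring.
have fW := tangent_frame_field oB hv ht v0 b0 ovt.
pose f y := (unitize (J (b y)), unitize (v y)).
have lX : homogeneous_lift X c W (fun z => (f z).1).
  by split => // z Wz; rewrite Xv// vline_unitize// Jb0.
have sJb : rsm W (fun y => J (b y)) := rsmJ oB (rsm_perp oB (hol_rsm hv) (hol_rsm ht)).
have lJb : homogeneous_lift X c W (fun z => J (b z)) by split => //.
exists c, W, f; split => //.
- split; first by split; [exact: fW|exact: lX].
  by split => // z Wz; rewrite vY// vline_unitize// v0.
- exact: ballxx.
- move=> z Wz; have PH := tangent_pseudohol oB hv ht v0 b0 ovt dv' th10 Wz.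
  have [s1 _] := frame_rsm fW.
  split.
  + exact (pseudohol_jet_same (chart_jet lJb lX sJb s1 Wz Wz (erefl _)) PH).
  + by move=> u; have [h _ _] := tangent_relations oB hv ht v0 b0 ovt dv' u Wz.
  + move=> zz0; exists (dx R).
    have [_ _ ->] := tangent_relations oB hv ht v0 b0 ovt dv' (dx R) Wz.
    have bt0 : hm (b z) (t z) != 0.
      apply/eqP => E; have := hmvv_neq0 (b0 z Wz).
      by rewrite hm_perp_perp -/(b z) E mulr0 eqxx.
    apply/eqP; rewrite mulf_neq0//.
      by rewrite oppr_eq0 !mulf_neq0// invr_eq0 nrmC_neq0// ?v0// (Jb0 z Wz).
    rewrite /th mulf_neq0//; first by rewrite eq_complex /= oner_eq0.
    by rewrite expf_neq0// zc_neq0.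
- exists (fun=> 0), (fun y =>
    (nrm (J (b y)))%:C * (((nrm (v y))%:C)^-1 * ((nrm (v y))%:C)^-1 * ((nrm (v y))%:C)^-1)).
  split; first exact (tangent_holomorphic_section oB hv ht v0 b0 ovt dv' th10).
  move=> z Wz; split => //; apply/eqP.
  by rewrite !mulf_neq0// ?invr_eq0 nrmC_neq0// ?v0// (Jb0 z Wz).
Qed.

Lemma tangent_map_smooth : smooth_map X.
Proof.
move=> x; have [c [W [f [[[[h _ _] lX] _] cx Wx _ _]]]] := tangent_map_frames x.
by exists c, W, (fun z => (f z).1).
Qed.

(** The horizontal part of dX has no component along e_1^* (x) e_2 because
    omega_1 = 0 in the frames of [tangent_map_frames]. *)
Lemma tangent_map_is_L : is_L X tangent_L.
Proof.
split.
  move=> x; have [c [W [f [[fa lY] cx Wx _ [s1 [s2 [hs sz]]]]]]] := tangent_map_frames x.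
  have [fW lX] := fa; have [_ _ _ fX] := lX; have [_ _ _ fY] := lY.
  exists c, W, f, s1, s2; split => // z Wz; have [E1 E2] := sz z Wz.
  split; first by rewrite E1 => -[].
  rewrite (tangent_L_line (fX z Wz) (fY z Wz) (lift_neq0 lX Wz) (lift_neq0 lY Wz)).
  rewrite E1 scale0r add0r /fbar2 -/(J _) scalerA vline_scale// mulf_neq0//.
    exact/eqP.
  exact: invsqrt2_neq0.
move=> d W' g [gW lg] q Wq u.
have [c [W [f [[[fW lX] lY] cx Wx H _]]]] := tangent_map_frames (cinv d q).
have [r1 _] := frame_rsm fW; have [s1 _] := frame_rsm gW.
have ac : atlas c by have [] := lX.
set p := cmap c (cinv d q) in Wx H.
have [_ h0 _] := H p Wx.
have [k [A [m [k0 E _ dE]]]] := chart_jet lX lg r1 s1 Wx Wq (cmapK ac cx).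
have [fh1 fh2 fh3 fh4] := frame_field_facts fW Wx.
have [gh1 gh2 gh3 gh4] := frame_field_facts gW Wq.
have [_ _ _ fX] := lX; have [_ _ _ fY] := lY.
have Xp := fX p Wx; have Yp := fY p Wx; rewrite /p cmapK// -/p in Xp Yp.
have Xq : val (X (cinv d q)) = <[(g q).1]>%VS by have [_ _ _ ->] := lg.
rewrite (tangent_L_line Xq Yp (lift_neq0 lg Wq) (lift_neq0 lY Wx)) I1E.
set Q := _ + _.
have dg := dE u.
have frg : is_frame ((g q).1, (g q).2) by apply/is_frameP.
have frf : is_frame ((f p).1, (f p).2) by apply/is_frameP.
have QE : Q = rdiff (fun y => (g y).1) q u - hm (g q).1 (rdiff (fun y => (g y).1) q u) *: (g q).1
   - om (g q).1 (rdiff (fun y => (g y).1) q u) *: J (g q).1.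
  rewrite {1}(frame_expand (rdiff (fun y => (g y).1) q u) frg) -/Q -addrA -opprD addrAC subrr add0r//.
have f21 : hm (f p).2 (f p).1 = 0 by rewrite hmC fh3 conjc0.
have f21' : om (f p).2 (f p).1 = 0 by rewrite omC fh4 oppr0.
have hQ : hm (f p).2 Q = 0.
  rewrite QE !hmDr !hmNr !hmZr hmJr dg E hmDr !omZr !hmZr h0 f21 f21'.
  by rewrite !mulr0 conjc0 oppr0 !mulr0 oppr0 !addr0.
have gQ : hm (g q).1 Q = 0 /\ om (g q).1 Q = 0.
  by rewrite /Q hmDr omDr !hmZr !omZr hmJr omJr gh3 gh4 conjc0 oppr0 !mulr0 addr0.
have fQ : hm (f p).1 Q = 0 /\ om (f p).1 Q = 0.
  have [g1 g2] := gQ; rewrite E hmZl omZl in g1 g2.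
  split; first by apply: (mulfI (_ : k^-* != 0)); rewrite ?conjc_eq0// mulr0.
  by apply: (mulfI k0); rewrite mulr0.
have [q1 q2] := fQ.
rewrite (frame_expand Q frf) q1 q2 hQ !scale0r !add0r -scalemxAr memvZ// memv_line.
by [].
Qed.

(** In an adapted frame the second vector spans Y, so kappa_{1 bar 2} vanishes
    by the contact condition. *)
Lemma tangent_map_vanishing_II : vanishing_II X tangent_L.
Proof.
move=> d W' g [[gW lg] gL] q Wq u.
have l2 : homogeneous_lift Y d W' (fun z => (g z).2).
  have [ad oW' gI gX] := lg; split => // z Wz.
  have [c [W [f [[[fW lX] lY] cx Wx _ _]]]] := tangent_map_frames (cinv d z).
  have ac : atlas c by have [] := lX.
  have [_ _ _ fY] := lY; have Yp := fY _ Wx; rewrite cmapK// in Yp.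
  have [g1 g2 g3 g4] := frame_field_facts gW Wz.
  have := gL z Wz; rewrite (tangent_L_line (gX z Wz) Yp (lift_neq0 lg Wz) (lift_neq0 lY Wx)).
  rewrite /fbar2 -/(J _) => /vlineP[k E].
  have := congr1 (mulmx (g z).1) E; rewrite -!scalemxAr !ehe// => E'.
  have := congr1 (@J R) E'; rewrite !JZ !JJ !scalerN => /oppr_inj E2.
  have i0 : ((Num.sqrt 2 : R)^-1%:C)^-* != 0 :> C by rewrite conjc_eq0 invsqrt2_neq0.
  have k0 : k^-* != 0.
    apply/eqP => k0; move/eqP: E2; rewrite k0 scale0r scaler_eq0 (negbTE i0) /= => /eqP y0.
    by move: g2; rewrite y0 hm0r => /eqP; rewrite eq_sym oner_eq0.
  have h1 := vline_scale (g z).2 i0; have h2 := vline_scale (f (cmap c (cinv d z))).2 k0.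
  by rewrite Yp -h1 -h2 E2.
have K := cY (conj gW l2) Wq u; rewrite kappa21E in K.
by rewrite /II kappa12E K conjc0 oppr0 scale0r.
Qed.

Lemma tangent_map_pseudohol_jet d W' g q : frame_along1 X d W' g -> W' q ->
  pseudohol_jet (fun y => (g y).1) q.
Proof.
move=> [gW lg] Wq.
have [c [W [f [[[fW lX] lY] cx Wx H _]]]] := tangent_map_frames (cinv d q).
have [r1 _] := frame_rsm fW; have [s1 _] := frame_rsm gW.
have ac : atlas c by have [] := lX.
have [PH _ _] := H _ Wx.
exact (pseudohol_jet_same (chart_jet lX lg r1 s1 Wx Wq (cmapK ac cx)) PH).
Qed.

Lemma tangent_map_moving : M -> exists c W f z u, [/\ frame_along1 X c W f, W z &
  om (f z).2 (rdiff (fun y => (f y).1) z u) <> 0].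
Proof.
move=> x; have [c [W [f [[fa lY] cx Wx H _]]]] := tangent_map_frames x.
have oW : open W by have [] := lY.
have [z zz0 Wz] := near_punctured (open_nbhs_nbhs (conj oW Wx)).
have [_ _ h] := H z Wz; have [u hu] := h zz0.
by exists c, W, f, z, u.
Qed.

Lemma tangent_map_I1_nonzero : I1_nonzero X.
Proof.
have [x0 _] := nY.
have [c [W [f [z [u [fa Wz nz]]]]]] := tangent_map_moving x0.
exists c, W, f, z, u; split => // E; apply: nz.
have [fW _] := fa; have [h1 h2 _ _] := frame_field_facts fW Wz.
have := congr1 (mulmx (f z).1) E; rewrite I1E ehe// mulmx0 => E'.
by have := congr1 (om (f z).2) E'; rewrite om0r omDr !omZr omvv omJr h2 conjc1 mulr1 mulr0 add0r.
Qed.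

(** If X were constant then o(e_2, e_1) would vanish near z for the value of e_2
    at z, and so would omega_2 at z. *)
Lemma tangent_map_nonconstant : nonconstant X.
Proof.
have [x0 _] := nY.
have [c [W [f [z [u [[fW lX] Wz nz]]]]]] := tangent_map_moving x0.
apply: contrapT => nc; apply: nz.
have Xc x y : X x = X y by apply: contrapT => xy; apply: nc; exists x, y.
have [_ oW _ fX] := lX.
have [r1 _] := frame_rsm fW.
have [_ _ _ h4] := frame_field_facts fW Wz.
have n : \forall y \near z, om (f z).2 (f y).1 = 0.
  have nW : \forall y \near z, W y by exact (open_nbhs_nbhs (conj oW Wz)).
  near=> y; have Wy : W y by near: y; exact nW.
  have := fX y Wy; rewrite (Xc _ (cinv c z)) (fX z Wz) => /esym/vline_eq[|k _ ->].
    exact: lift_neq0 lX Wy.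
  by rewrite omZr omC h4 oppr0 mulr0.
have dc : rder (fun=> (f z).2) z u by move=> k; have [] := cdiff_cst ((f z).2 ord0 k) z u.
have [_ E] := cdiff_om dc (rsm_der u r1 Wz).
have [_ En] := cdiff_near u n; have [_ E0] := cdiff_cst (0 : C) z u.
have dc0 : rdiff (fun=> (f z).2) z u = 0.
  by apply/rowP => k; rewrite rdiffE mxE; have [_ ->] := cdiff_cst ((f z).2 ord0 k) z u.
by rewrite En E0 dc0 om0l add0r in E.
Unshelve. all: by end_near. Qed.

Lemma tangent_map_pseudoholomorphic : pseudoholomorphic_curve X.
Proof.
split; [exact: tangent_map_nonconstant|exact: tangent_map_smooth|].
move=> c W f fa z Wz; apply/(frame_dC1 fa.1 Wz).
exact: tangent_map_pseudohol_jet fa Wz.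
Qed.

Lemma tangent_map_null_torsion : null_torsion X.
Proof.
split; [exact: tangent_map_pseudoholomorphic|exact: tangent_map_I1_nonzero|].
exists tangent_L; [exact: tangent_map_is_L|exact: tangent_map_vanishing_II].
Qed.

Lemma tensor_tangent_L : tensor_map X tangent_L = Y.
Proof.
apply/funext => x; apply: val_inj.
have [c [W [f [[[fW lX] lY] cx Wx _ _]]]] := tangent_map_frames x.
have ac : atlas c by have [] := lX.
have [_ _ _ fX] := lX; have [_ _ _ fY] := lY.
have Xp := fX _ Wx; have Yp := fY _ Wx; rewrite !cmapK// in Xp Yp.
have [h1 h2 h3 h4] := frame_field_facts fW Wx.
have y0 := lift_neq0 lY Wx.
rewrite /tensor_map (tangent_L_line Xp Yp (lift_neq0 lX Wx) y0).
have Jy0 : J (f (cmap c x)).2 != 0 by rewrite J_eq0.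
rewrite (tensor_lineE Xp h1 Jy0) ?hmJr ?omJr ?h3 ?h4 ?conjc0 ?oppr0//.
by rewrite JJ Yp -scaleN1r vline_scale// oppr_eq0 oner_eq0.
Qed.

End TangentMap.

End Surjectivity.

Theorem theorem3p6 (R : realType) (M : riemann_surface R)
  (Mconn : connected [set: M]) :
  set_bij [set X : M -> CP3 R | null_torsion X]
          [set Y : M -> CP3 R | nonconstant Y /\ holomorphic_integral Y]
          (fun X : M -> CP3 R => @Pi2 R \o hatX X).
Proof.
have hatE (X : M -> CP3 R) : @Pi2 R \o hatX X = tensor_map X (LX X) by [].
have LXP (X : M -> CP3 R) L : is_L X L -> is_L X (LX X).
  by move=> hL; apply: xgetPex; exists L.
split.
- move=> X [pX IX [L hL vL]]; rewrite /= hatE.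
  rewrite (tensor_map_unique Mconn pX IX hL vL (LXP X L hL)).
  split; first exact: tensor_map_nonconstant pX IX hL vL.
  by split; [exact: tensor_map_holomorphic pX hL vL|exact: tensor_map_contact pX hL vL].
- move=> X X' /set_mem[pX IX [L hL vL]] /set_mem[pX' IX' [L' hL' vL']]; rewrite !hatE.
  rewrite (tensor_map_unique Mconn pX IX hL vL (LXP X L hL)).
  rewrite (tensor_map_unique Mconn pX' IX' hL' vL' (LXP X' L' hL')).
  exact: (tensor_map_injective Mconn pX IX hL vL pX' hL' vL').
- move=> Y [nY [hY cY]].
  have [X HX] := tangent_map_exists Mconn hY nY.
  have nX := tangent_map_null_torsion nY cY HX.
  exists X => //; rewrite hatE.
  have [pX IX _] := nX.
  have hL := tangent_map_is_L cY HX.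
  have vL := tangent_map_vanishing_II cY HX.
  by rewrite (tensor_map_unique Mconn pX IX hL vL (LXP X _ hL)) tensor_tangent_L.
Qed.
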